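(* Let $w_1,\dots,w_6\in\mathbb{Z}$ and let $\Gamma$ be the H-graph with these weights (vertices $1,\dots,6$, edges $12,13,14,25,26$), with adjacency matrix $W$. Assume that $\det W=\pm1$, that the upper-left $2\times2$ submatrix $S$ of $-W^{-1}$ is indefinite, and that $w_3,w_4,w_5,w_6\notin\{\pm1\}$. Then one can construct explicitly an indefinite false theta function $\widehat{Z}_\Gamma(q)\in q^{c}\,\mathbb{C}[[q]]$ with some $c\in\mathbb{Q}$ (namely the series defined in the context) such that for any positive integer $k$ it holds $$\mathrm{WRT}_k(M(\Gamma))=\frac{1}{2(\zeta_{2k}-\zeta_{2k}^{-1})}\lim_{q\to\zeta_k^{\varepsilon_\Gamma}}\widehat{Z}_\Gamma(q),$$ where $\varepsilon_\Gamma\in\{\pm1\}$ is an explicit number determined by $\Gamma$ (defined in the context).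
   Context: Notation: $\zeta_k=e^{2\pi i/k}$; $\mathbf{e}(z)=e^{2\pi i z}$; $\mathrm{sgn}(x)=1$ for $x\ge0$ and $-1$ for $x<0$; $q$ is a complex variable with $|q|<1$, and the limit is a radial limit (write $q=\mathbf{e}(\tau)$, $q^s=\mathbf{e}(s\tau)$ for $s\in\mathbb{Q}$, and let $\tau\to\varepsilon_\Gamma/k$ vertically in the upper half-plane). The adjacency (linking) matrix of $\Gamma$ is $$W=\begin{pmatrix}w_1&1&1&1&0&0\\1&w_2&0&0&1&1\\1&0&w_3&0&0&0\\1&0&0&w_4&0&0\\0&1&0&0&w_5&0\\0&1&0&0&0&w_6\end{pmatrix}.$$ $M(\Gamma)$ is the plumbed 3-manifold obtained from $S^3$ by surgery along the framed link associated with $\Gamma$ (one unknot of framing $w_v$ for each vertex $v$, two unknots being simply linked when the vertices are joined by an edge), with linking matrix $W$; it is an integral homology sphere when $\det W=\pm1$. $\mathrm{WRT}_k(M(\Gamma))$ is the Witten--Reshetikhin--Turaev invariant of $M(\Gamma)$ normalised by $\mathrm{WRT}_k(S^3)=1$; it is computed from the representation (quoted from Gukov--Pei--Putrov--Vafa) $$\mathrm{WRT}_k(M(\Gamma))=\frac{\mathbf{e}(-\sigma_W/8)\,\zeta_{4k}^{3\sigma_W-w_1-\cdots-w_6}}{2(\sqrt{2k})^{6}(\zeta_{2k}-\zeta_{2k}^{-1})}\sum_{l\in(\mathbb{Z}\smallsetminus k\mathbb{Z})^6/2k\mathbb{Z}^6}\zeta_{4k}^{{}^t l W l}\prod_{i=1}^6(\zeta_{2k}^{l_i}-\zeta_{2k}^{-l_i})^{2-\deg(i)},$$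 where $\deg(1)=\deg(2)=3$ and $\deg(i)=1$ for $3\le i\le6$. Let $\sigma_W,\sigma_S$ be the signatures (number of positive minus number of negative eigenvalues) of $W$ and $S$ (here $\sigma_S=0$). Put $M=w_3w_4$, $N=w_5w_6$ (both nonzero under the hypotheses), $a=-w_2w_5w_6+w_5+w_6$, $c_0=-w_1w_3w_4+w_3+w_4$, $\varepsilon_\Gamma=\mathrm{sgn}(Ma)\det W$, and $$Q'(x,y)=|Ma|x^2+2|MN|xy+|Nc_0|y^2 .$$ Let $\mathcal{T}=\{\tfrac12+\tfrac{e_3}{2w_3}+\tfrac{e_4}{2w_4}: e_3,e_4\in\{\pm1\}\}$, $\mathcal{U}=\{\tfrac12+\tfrac{e_5}{2w_5}+\tfrac{e_6}{2w_6}: e_5,e_6\in\{\pm1\}\}$, $\chi(\alpha)=\sum e_3e_4$ over all $(e_3,e_4)\in\{\pm1\}^2$ with $\alpha=\tfrac12+\tfrac{e_3}{2w_3}+\tfrac{e_4}{2w_4}$, and $\psi(\beta)=\sum e_5e_6$ over all $(e_5,e_6)\in\{\pm1\}^2$ with $\beta=\tfrac12+\tfrac{e_5}{2w_5}+\tfrac{e_6}{2w_6}$. Let $\sigma'_W=-\sigma_W-\sigma_S+\mathrm{sgn}(w_3)+\mathrm{sgn}(w_4)+\mathrm{sgn}(w_5)+\mathrm{sgn}(w_6)$. The indefinite false theta function of $\Gamma$ is $$\widehat{Z}_\Gamma(q)=q^{\left(3\sigma_W-\sum_{i=1}^6w_i-\sum_{i=3}^6 1/w_i\right)/4}\,\mathbf{e}(\sigma'_W/8)\,\mathrm{sgn}(Na)\sum_{\alpha\in\mathcal{T}}\sum_{\beta\in\mathcal{U}}\chi(\alpha)\psi(\beta)\sum_{m,n\ge0}q^{Q'(\alpha+m,\beta+n)}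 .$$
   Formalization: The prefactor exponent of Ẑ_Γ is taken as ε_Γ·(3σ_W−Σw_i−Σ1/w_i)/4; without the factor ε_Γ the identity fails when ε_Γ=−1, e.g. w=(−1,0,2,−3,2,3), k=2 (limit −4i instead of 4i). For k=1 the display is 0/0, so only existence of the limit has content. *)

(* Defs.v *)
From HB Require Import structures.
From mathcomp Require Import all_boot all_order all_algebra.
From mathcomp Require Import complex polyrcf.
From mathcomp Require Import all_classical all_reals all_analysis.

Set Implicit Arguments.
Unset Strict Implicit.
Unset Printing Implicit Defensive.

Import Order.TTheory GRing.Theory Num.Theory.
Import numFieldNormedType.Exports.

Local Open Scope classical_set_scope.
Local Open Scope ring_scope.
Local Open Scope complex_scope.

Section RealMatrices.
Variables (R : realType) (n : nat).
Implicit Type A : 'M[R]_n.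

(* Eigenvalues are counted with algebraic multiplicity. *)
Definition signature A : int :=
  let p := char_poly A in
  (\sum_(x <- rootsR p | (0 < x)%R) mup x p)%N%:Z -
  (\sum_(x <- rootsR p | (x < 0)%R) mup x p)%N%:Z.

Definition indefinite A : Prop :=
  (exists x : 'rV[R]_n, 0 < (x *m A *m x^T) 0 0) /\
  (exists x : 'rV[R]_n, (x *m A *m x^T) 0 0 < 0).

End RealMatrices.

Section ComplexAnalysis.
Variable R : realType.
Implicit Types (z tau : R[i]).

Definition cexp z : R[i] :=
  (expR (complex.Re z))%:C * (cos (complex.Im z) +i* sin (complex.Im z)).

Definition ee z : R[i] := cexp ((2 * pi)%:C * 'i * z).

Definition zeta (n : nat) : R[i] := ee n%:R^-1.

(* q^s for q = ee tau and s rational *)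
Definition qpow tau (s : rat) : R[i] := ee (ratr s * tau).

(* R[i]^o is R[i] with its topology as a normed space. The double sum is taken
   over squares; it only makes sense for absolutely summable families, which is
   what dsummable asserts. *)
Definition dsum (f : nat -> nat -> R[i]) : R[i] :=
  limn (fun K => \sum_(m < K) \sum_(n < K) f m n : R[i]^o).

Definition dsummable (f : nat -> nat -> R[i]) : Prop :=
  summable [set: nat * nat] (fun p => (complex.Re `|f p.1 p.2|)%:E).

(* F, as a function of tau on the upper half-plane, is the sum of a series in
   q^c C[[q]] with q = ee tau. *)
Definition in_qC (c : rat) (F : R[i] -> R[i]) : Prop :=
  exists u : nat -> R[i], forall tau, 0 < complex.Im tau ->
    exists2 s : R[i],
      series (fun j => u j * qpow tau j%:R : R[i]^o) @ \oo --> (s : R[i]^o) &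
      F tau = qpow tau c * s.

End ComplexAnalysis.

(* The vertices 1, ..., 6 are the elements 0, ..., 5 of 'I_6. *)
Record Hgraph := HGraph {
  w1 : int; w2 : int; w3 : int; w4 : int; w5 : int; w6 : int }.

Definition Hedges : seq (nat * nat) :=
  [:: (0, 1); (0, 2); (0, 3); (1, 4); (1, 5)]%N.

Definition Hadj : rel 'I_6 := fun i j =>
  ((i : nat, j : nat) \in Hedges) || ((j : nat, i : nat) \in Hedges).

Definition Hdeg (i : 'I_6) : nat := #|Hadj i|.

(* sgn 0 = 1 here, unlike Num.sg and sgz *)
Definition sgn (x : int) : int := if 0 <= x then 1 else -1.

(* leaf_exps u v is a duplicate-free list, since the index sets of the theta
   function are sets of rational numbers. *)
Definition leaf_exp (u v s t : int) : rat :=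
  1 / 2 + s%:~R / (2 * u%:~R) + t%:~R / (2 * v%:~R).

Definition leaf_exps (u v : int) : seq rat :=
  undup [seq leaf_exp u v s t | s <- [:: 1; -1], t <- [:: 1; -1]].

Definition leaf_coef (u v : int) (al : rat) : int :=
  \sum_(s <- [:: 1; -1]) \sum_(t <- [:: 1; -1] | al == leaf_exp u v s t) (s * t).

Section HInvariants.
Variables (R : realType) (G : Hgraph).

Definition Hweight (i : 'I_6) : int :=
  nth 0 [:: w1 G; w2 G; w3 G; w4 G; w5 G; w6 G] i.

Definition Wmx : 'M[int]_6 :=
  \matrix_(i, j) if i == j then Hweight i else (Hadj i j)%:R.

Definition WmxR : 'M[R]_6 := map_mx intr Wmx.

Definition Smx : 'M[R]_2 :=
  ulsubmx (- invmx WmxR : 'M[R]_(2 + 4, 2 + 4)).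

Definition sigmaW : int := signature WmxR.
Definition sigmaS : int := signature Smx.

(* The sum runs over the representatives 0 <= l_i < 2k of Z / 2k Z not divisible
   by k. For k = 1 the normalising factor is the inverse of 0. *)
Definition WRT (k : nat) : R[i] :=
  ee (- sigmaW%:~R / 8) *
    zeta R (4 * k) ^ (3 * sigmaW - \sum_i Hweight i) /
    (2 * (Num.sqrt (2 * k%:R : R))%:C ^+ 6 *
       (zeta R (2 * k) - (zeta R (2 * k))^-1)) *
  \sum_(l : {ffun 'I_6 -> 'I_(2 * k)} | [forall i, ~~ (k %| l i)%N])
    (let lv : 'cV[int]_6 := \col_i (l i : nat)%:Z in
     zeta R (4 * k) ^ ((lv^T *m Wmx *m lv) 0 0) *
     \prod_(i < 6)
       (zeta R (2 * k) ^ (l i : nat)%:Z - zeta R (2 * k) ^ (- (l i : nat)%:Z))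
         ^ (2 - (Hdeg i)%:Z)).

Definition HM : int := w3 G * w4 G.
Definition HN : int := w5 G * w6 G.
Definition Ha : int := - w2 G * w5 G * w6 G + w5 G + w6 G.
Definition Hc0 : int := - w1 G * w3 G * w4 G + w3 G + w4 G.

Definition eps : int := sgn (HM * Ha) * \det Wmx.

Definition Qform (x y : rat) : rat :=
  `|HM * Ha|%:~R * x ^+ 2 + 2 * `|HM * HN|%:~R * x * y
    + `|HN * Hc0|%:~R * y ^+ 2.

Definition sigmaW' : int :=
  - sigmaW - sigmaS + sgn (w3 G) + sgn (w4 G) + sgn (w5 G) + sgn (w6 G).

(* The factor eps makes the limit of q^delta at q = zeta_k^eps equal to
   ee (delta0 / k), where delta = eps * delta0; it is what the framing factor
   zeta_{4k}^(3 sigma_W - sum w_i) of WRT requires when eps = -1. *)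
Definition delta : rat :=
  eps%:~R *
  (((3 * sigmaW - \sum_i Hweight i)%:~R -
    ((w3 G)%:~R^-1 + (w4 G)%:~R^-1 + (w5 G)%:~R^-1 + (w6 G)%:~R^-1)) / 4).

Definition theta_term (tau : R[i]) (al be : rat) (m n : nat) : R[i] :=
  qpow tau (Qform (al + m%:R) (be + n%:R)).

Definition Zhat (tau : R[i]) : R[i] :=
  qpow tau delta * ee (sigmaW'%:~R / 8) * (sgn (HN * Ha))%:~R *
  \sum_(al <- leaf_exps (w3 G) (w4 G)) \sum_(be <- leaf_exps (w5 G) (w6 G))
    (leaf_coef (w3 G) (w4 G) al * leaf_coef (w5 G) (w6 G) be)%:~R *
    dsum (theta_term tau al be).

End HInvariants.

(* Main.v *)
Require Import Defs.
From HB Require Import structures.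
From mathcomp Require Import all_boot all_order all_algebra.
From mathcomp Require Import complex polyrcf.
From mathcomp Require Import all_classical all_reals all_analysis.
From mathcomp Require Import ring lra zify.
Set Implicit Arguments.
Unset Strict Implicit.
Unset Printing Implicit Defensive.

Import Order.TTheory GRing.Theory Num.Theory.
Import numFieldNormedType.Exports.
Local Open Scope classical_set_scope.
Local Open Scope ring_scope.
Local Open Scope complex_scope.


(* Write S for the upper-left block of -W^-1 and K = 2k. Completing the square in
   the six-dimensional quadratic Gauss sum of W, whose value is K^3 e((sgn w3 +
   ... + sgn w6)/8) by iterated reciprocity, shows that, up to explicit constants,
   e(S(al + m, be + n)/k) is a finite Fourier sum over (x, y) mod K of the
   characters e((x (2m+1) + y (2n+1))/K), with coefficients that are products of
   four one-dimensional Gauss sums, one per leaf. Since eps Q' is S up to the sign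
   sgn(Na) of y, each theta series at q = zeta_k^eps e(i t) is a finite combination
   of sums of w^m w'^n exp(-2 pi t Q'(al + m, be + n)) with w, w' roots of unity.
   By Abel summation such a sum tends to 1/((1 - w)(1 - w')) when w, w' != 1. When
   w = 1, the leaf coefficients do not depend on the signs of al, so the alternating
   sum over these signs is a second difference in al, which gains two orders in
   s = sqrt(2 pi t) and kills the divergence of the sum over m; likewise for w'.
   The finite sum that remains is the WRT sum, because 1/(1 - w) is, up to a phase,
   the factor (zeta^x - zeta^-x)^-1 of a vertex of degree 3, and a difference of two
   leaf sums is the sum over a leaf. *)

(** * The character e(r) for rational r *)

(** The form Q' is itself indefinite: (MN)^2 - |Ma||Nc| = |MN|(|MN| - |ca|) = |MN| > 0. What makes
    the theta series converge is only that its coefficients are non-negative, so decay is available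
    on the quadrant x, y >= 0 alone; shifts must stay non-negative and differences must step
    upwards. Since an error O(s) is enough, three derivatives of the Gaussian suffice and no
    asymptotic expansion is computed. The six-dimensional Gauss sum is used twice: being nonzero, it
    can be divided out to isolate the theta value, and its phase supplies the leaf signs in
    sigma'_W. The hypotheses act separately. det W = +-1 makes W^-1 integral and the moduli of the
    iterated reciprocity coprime. Indefiniteness makes the last two Gauss phases cancel and gives
    sigma_S = 0. The condition w_i != +-1 makes M and N nonzero and the leaf exponents non-negative.
    The convention 0^-1 = 0 lets every sum run over all residues mod K: labels divisible by k, left
    out of the WRT sum, and characters equal to 1, absent from the limit, both contribute zero. *)

HB.lock Definition er (R : realType) (r : rat) : R[i] := ee (ratr r).

Section Exponential.
Variable R : realType.
Implicit Types (x y : R) (z : R[i]) (r s : rat).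
Local Notation er := (@er R).

Lemma cexpD z z' : cexp (z + z') = cexp z * cexp z'.
Proof.
case: z z' => [a b] [c d]; rewrite /cexp /= expRD cosD sinD; simpc.
by congr (_ +i* _); ring.
Qed.

Lemma cexp0 : cexp (0 : R[i]) = 1.
Proof. by rewrite /cexp /= expR0 cos0 sin0; simpc. Qed.

Lemma norm_cexp z : `|cexp z| = (expR (complex.Re z))%:C.
Proof.
rewrite /cexp; simpc; rewrite /= !exprMn -mulrDr cos2Dsin2 mulr1 sqrtr_sqr.
by rewrite ger0_norm // expR_ge0.
Qed.

Lemma eeD z z' : ee (z + z') = ee z * ee z'.
Proof. by rewrite /ee mulrDr cexpD. Qed.

Lemma ee0 : ee (0 : R[i]) = 1.
Proof. by rewrite /ee mulr0 cexp0. Qed.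

Lemma eeE x y : ee (x +i* y) =
  (expR (- (2 * pi * y)))%:C * (cos (2 * pi * x) +i* sin (2 * pi * x)).
Proof. by rewrite /ee /cexp; simpc. Qed.

Lemma norm_ee x y : `|ee (x +i* y)| = (expR (- (2 * pi * y)))%:C.
Proof. by rewrite /ee norm_cexp; simpc. Qed.

Lemma ee1 : ee (1 : R[i]) = 1.
Proof.
have -> : (1 : R[i]) = 1 +i* 0 by [].
by rewrite eeE mulr0 oppr0 expR0 mulr1 (mulrC 2) mulr_natr cos2pi sin2pi; simpc.
Qed.

Lemma ratrC r : ratr r = (ratr r : R)%:C :> R[i].
Proof. by rewrite -[RHS]/(real_complex R _) fmorph_rat. Qed.

Lemma erD r s : er (r + s) = er r * er s.
Proof. by rewrite !er.unlock rmorphD eeD. Qed.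

Lemma er0 : er 0 = 1.
Proof. by rewrite !er.unlock rmorph0 ee0. Qed.

Lemma norm_er r : `|er r| = 1.
Proof. by rewrite !er.unlock ratrC norm_ee mulr0 oppr0 expR0. Qed.

Lemma er_neq0 r : er r != 0.
Proof. by rewrite -normr_eq0 norm_er oner_eq0. Qed.

Lemma erN r : er (- r) = (er r)^-1.
Proof. by apply: (mulIf (er_neq0 r)); rewrite -erD addNr er0 mulVf ?er_neq0. Qed.

Lemma er_nat (n : nat) : er n%:R = 1.
Proof.
elim: n => [|n IH]; first by rewrite er0.
by rewrite -natr1 erD IH mul1r er.unlock rmorph1 ee1.
Qed.

Lemma er_int (n : int) : er n%:~R = 1.
Proof. by case: n => n; rewrite ?NegzE ?mulrNz ?erN er_nat ?invr1. Qed.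

(** The standard way to compare two characters: exhibit the integer by which the exponents differ,
    then close with [field] in the rationals. *)
Lemma er_congr (n : int) r s : r = s + n%:~R -> er r = er s.
Proof. by move=> ->; rewrite erD er_int mulr1. Qed.

Lemma erXn r (n : nat) : er r ^+ n = er (r * n%:R).
Proof.
elim: n => [|n IH]; first by rewrite expr0 mulr0 er0.
by rewrite exprS IH -erD -natr1 mulrDr mulr1 addrC.
Qed.

Lemma erXz r (n : int) : er r ^ n = er (r * n%:~R).
Proof.
case: n => n; rewrite ?NegzE; first by rewrite -exprnP erXn.
by rewrite -exprnN erXn -erN -mulrN mulrNz.
Qed.

Lemma erE r : er r = cos (2 * pi * ratr r) +i* sin (2 * pi * ratr r).
Proof. by rewrite !er.unlock ratrC eeE mulr0 oppr0 expR0 mul1r. Qed.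

Lemma conj_er r : (er r)^*%C = er (- r).
Proof. by rewrite !erE /= rmorphN /= mulrN cosN sinN. Qed.

End Exponential.

Arguments er_congr {R} n {r s} _.
Arguments ee {R} z : simpl never.
Arguments cexp {R} z : simpl never.

(** * Sums of periodic functions over residues *)

Section PeriodicSums.
Variable V : nmodType.
Implicit Types F : int -> V.

(** A shift by one trades the term at 0 for the term at N, equal by periodicity. Larger shifts
    iterate this, and a negative shift is undone by a positive one. *)
Lemma sum_shift (N : nat) F (s : int) :
  (forall x, F (x + N%:Z) = F x) ->
  \sum_(x < N) F (x%:Z + s) = \sum_(x < N) F x%:Z.
Proof.
case: N => [|N] FN; first by rewrite !big_ord0.
have step (G : int -> V) : (forall x, G (x + N.+1%:Z) = G x) ->
    \sum_(x < N.+1) G (x%:Z + 1) = \sum_(x < N.+1) G x%:Z.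
  move=> GN; rewrite big_ord_recr big_ord_recl /= addrC; congr (_ + _).
    by rewrite -[RHS]GN; congr G; lia.
  by apply: eq_bigr => i _; congr G; rewrite /bump /=; lia.
have shift_nat (n : nat) (G : int -> V) : (forall x, G (x + N.+1%:Z) = G x) ->
    \sum_(x < N.+1) G (x%:Z + n%:Z) = \sum_(x < N.+1) G x%:Z.
  elim: n G => [|n IH] G GN; first by apply: eq_bigr => i _; rewrite addr0.
  rewrite -[RHS](IH _ GN) -(step (fun x => G (x + n%:Z))).
    by apply: eq_bigr => i _; congr G; lia.
  by move=> x; rewrite -[RHS]GN; congr G; lia.
case: s => n; first exact: shift_nat.
rewrite -(shift_nat n.+1 (fun x => F (x + Negz n))).
  by apply: eq_bigr => i _; congr F; lia.
by move=> x; rewrite -[RHS]FN; congr F; lia.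
Qed.

Lemma sum_opp (N : nat) F :
  (forall x, F (x + N%:Z) = F x) ->
  \sum_(x < N) F (- x%:Z) = \sum_(x < N) F x%:Z.
Proof.
move=> FN; rewrite (reindex_inj rev_ord_inj) /=.
rewrite -[RHS](sum_shift 1 FN).
apply: eq_bigr => i _; rewrite -[LHS]FN; congr F.
by have := ltn_ord i; lia.
Qed.

Lemma sum_mul (c u : nat) F :
  \sum_(x < c * u) F x%:Z = \sum_(x < c) \sum_(n < u) F (c%:Z * n%:Z + x%:Z).
Proof.
rewrite exchange_big /=; elim: u => [|u IH]; first by rewrite muln0 !big_ord0.
rewrite big_ord_recr /= -IH -!(big_mkord xpredT (fun x => F x%:Z)) mulnS addnC.
rewrite (big_cat_nat _ (n := (c * u)%N)) ?leq_addr //=; congr (_ + _).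
rewrite -{1}[(c * u)%N]add0n big_addn addKn big_mkord.
by apply: eq_bigr => i _; congr F; lia.
Qed.

(** The map n -> (n mod u, n mod v) is injective by the Chinese remainder theorem, hence bijective
    because the two sides have the same size. *)
Lemma sum_crt (u v : nat) (F : int -> int -> V) : coprime u v ->
  (0 < u)%N -> (0 < v)%N ->
  (forall x y, F (x + u%:Z) y = F x y) -> (forall x y, F x (y + v%:Z) = F x y) ->
  \sum_(x < u) \sum_(y < v) F x%:Z y%:Z = \sum_(n < u * v) F n%:Z n%:Z.
Proof.
move=> cuv u0 v0 Fu Fv.
pose h (n : 'I_(u * v)) : 'I_u * 'I_v :=
  (Ordinal (ltn_pmod n u0), Ordinal (ltn_pmod n v0)).
have h_inj : injective h.
  move=> m n [em en]; apply: val_inj => /=.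
  have /eqP : m = n %[mod u * v] by apply/eqP; rewrite chinese_remainder // em en !eqxx.
  by rewrite !modn_small // => /eqP.
have h_bij : bijective h.
  by apply: inj_card_bij => //; rewrite card_prod !card_ord.
rewrite pair_big /= (reindex h) /=; last exact: onW_bij.
have Fmu (k m : nat) y : F (m + k * u)%N%:Z y = F m%:Z y.
  by elim: k => [|k IH]; rewrite ?addn0 // -[RHS]IH -[RHS]Fu; congr F; lia.
have Fmv (k m : nat) x : F x (m + k * v)%N%:Z = F x m%:Z.
  by elim: k => [|k IH]; rewrite ?addn0 // -[RHS]IH -[RHS]Fv; congr F; lia.
apply: eq_bigr => n _.
rewrite -(Fmu (n %/ u)%N) -(Fmv (n %/ v)%N).
by congr F; congr Posz; rewrite addnC -divn_eq.
Qed.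

End PeriodicSums.

(** * Gauss's product formula for a sum of q-binomial coefficients *)

Section QBinomial.
Variables (F : fieldType) (p : F).

(** The base is q = p^2, because Gauss's identity involves a square root p of the base. *)
Definition qfact (n : nat) : F := \prod_(i < n) (1 - (p ^+ 2) ^+ i.+1).
Definition qbin (n j : nat) : F := qfact n / (qfact j * qfact (n - j)).

Lemma qfactS n : qfact n.+1 = qfact n * (1 - (p ^+ 2) ^+ n.+1).
Proof. by rewrite /qfact big_ord_recr. Qed.

Lemma qfact_neq0 n :
  (forall i, (0 < i <= n)%N -> (p ^+ 2) ^+ i != 1) -> qfact n != 0.
Proof.
move=> p1; apply/prodf_neq0 => i _; rewrite subr_eq0 eq_sym p1 //.
by rewrite ltn_ord.
Qed.

(** Induction on n: in the product of the sum for n with 1 + p^(n+1), the copy multiplied by p^(n+1)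
    is reversed by j -> n - j, and the two copies then combine term by term through the q-Pascal
    rule. The hypothesis keeps the q-factorials invertible. *)
Lemma gauss_qbinomial n :
  (forall i, (0 < i <= n)%N -> (p ^+ 2) ^+ i != 1) ->
  \sum_(j < n.+1) p ^+ j * qbin n j = \prod_(i < n) (1 + p ^+ i.+1).
Proof.
elim: n => [|n IH] p1.
  by rewrite big_ord1 big_ord0 /qbin /qfact !big_ord0 expr0 !mul1r invr1.
have nz j : (j <= n.+1)%N -> qfact j != 0.
  by move=> jn; apply: qfact_neq0 => i /andP[i0 ij]; rewrite p1 // i0 (leq_trans ij).
have nz1 j : (0 < j <= n.+1)%N -> 1 - (p ^+ 2) ^+ j != 0.
  by move=> /p1; rewrite subr_eq0 eq_sym.
have q0 m : (m <= n.+1)%N -> qbin m 0 = 1.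
  move=> mn; rewrite /qbin subn0 {2}/qfact big_ord0 mul1r divff //; exact: nz.
have qn m : (m <= n.+1)%N -> qbin m m = 1.
  move=> mn; rewrite /qbin subnn {3}/qfact big_ord0 mulr1 divff //; exact: nz.
have qsym j : (j <= n)%N -> qbin n (n - j) = qbin n j.
  by move=> jn; rewrite /qbin subKn // [qfact (n - j) * _]mulrC.
rewrite [RHS]big_ord_recr /= -IH; last first.
  by move=> i /andP[i0 ij]; rewrite p1 // i0 ltnW.
rewrite mulrDr mulr1 big_ord_recl q0 // expr0 mulr1 big_ord_recr /= qn // mulr1.
have -> : (\sum_(j < n.+1) p ^+ j * qbin n j) * p ^+ n.+1 =
    \sum_(j < n) p ^+ j.+1 * ((p ^+ 2) ^+ (n - j) * qbin n j) + p ^+ n.+1.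
  rewrite mulr_suml (reindex_inj rev_ord_inj) /= big_ord_recr /=; congr (_ + _).
    apply: eq_bigr => i _; rewrite subSS qsym; last by rewrite ltnW.
    rewrite mulrAC -exprD -exprM mulrA -exprD; congr (p ^+ _ * _).
    by have := ltn_ord i; lia.
  by rewrite subSS subnn expr0 q0 // mulr1 mul1r.
rewrite [X in _ = X + _]big_ord_recl q0 // expr0 mul1r.
rewrite -!addrA; congr (_ + _); rewrite addrA; congr (_ + _).
rewrite -big_split /=; apply: eq_bigr => i _; rewrite /bump /= add1n -mulrDr.
(* What remains is the q-Pascal rule [n+1, i+1] = [n, i+1] + q^(n-i) [n, i], with [n, i] the
   q-binomial coefficient. *)
congr (_ * _); rewrite /qbin subSS.
have li := ltn_ord i.
have -> : (n - i = (n - i.+1).+1)%N by lia.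
rewrite !qfactS.
have -> : (p ^+ 2) ^+ n.+1 = (p ^+ 2) ^+ (n - i.+1).+1 * (p ^+ 2) ^+ i.+1.
  by rewrite -exprD; congr (_ ^+ _); lia.
have := nz1 i.+1 (ltac:(lia)); have := nz1 (n - i.+1).+1 (ltac:(lia)).
have := nz i (ltac:(lia)); have := nz (n - i.+1)%N (ltac:(lia)).
set a := qfact _; set b := qfact i; set c := _ ^+ i.+1; set d := _ ^+ _.+1.
move=> a0 b0 d0 c0; field.
by rewrite a0 b0 c0 d0.
Qed.

End QBinomial.

(** * Quadratic Gauss sums *)

Section GaussSum.
Variable R : realType.
Local Notation er := (@er R).


Lemma er_eq1 (x : rat) : 0 < x < 1 -> er x != 1.
Proof.
move=> /andP[x0 x1]; apply/eqP; rewrite erE => -[/eqP].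
have px0 : 0 < pi * ratr x :> R by rewrite mulr_gt0 ?pi_gt0 // ltr0q.
have px1 : pi * ratr x < pi :> R.
  by rewrite -[ltRHS]mulr1 ltr_pM2l ?pi_gt0 // -(rmorph1 (ratr : rat -> R)) ltr_rat.
have -> : 2 * pi * ratr x = (pi * ratr x) *+ 2 :> R by rewrite -mulr_natr; ring.
rewrite cos_mulr2n => /eqP c1 _.
have := cos2Dsin2 (pi * ratr x : R); have := @sin_gt0_pi _ _ (introT andP (conj px0 px1)).
move: c1; set c := cos _; set s := sin _ => c1 s0 cs.
have : 0 < s ^+ 2 by rewrite exprn_gt0.
by move: c1 cs; rewrite -mulr_natr; lra.
Qed.

Lemma er_half : er (1 / 2) = -1.
Proof.
rewrite erE fmorph_div rmorph1 rmorph_nat.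
have -> : 2 * pi * (1 / 2) = pi :> R by field.
by rewrite cospi sinpi; simpc.
Qed.

Lemma er_neq1 (N : nat) (d : int) : (0 < N)%N -> ~~ (N%:Z %| d)%Z ->
  er (d%:~R / N%:R) != 1.
Proof.
move=> N0 Nd; have N0' : (N%:R : rat) != 0 by rewrite pnatr_eq0 -lt0n.
rewrite (@er_congr _ (d %/ N)%Z _ ((d %% N)%Z%:~R / N%:R)); last first.
  rewrite {1}(divz_eq d N) rmorphD rmorphM /=.
  by field.
have m0 : (0 <= (d %% N)%Z) by apply: modz_ge0; lia.
have mN : (d %% N)%Z < N by apply: ltz_pmod; lia.
apply: er_eq1; rewrite divr_gt0 ?ltr0n //; last first.
  rewrite ltr0z lt0r m0 andbT; apply: contra Nd => /eqP E.
  by apply/dvdz_mod0P.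
by rewrite ltr_pdivrMr ?ltr0n // mul1r -[N%:R]/(N%:~R) ltr_int.
Qed.

Lemma sum_er_orth (N : nat) (d : int) : (0 < N)%N ->
  \sum_(x < N) er (d%:~R * x%:R / N%:R) = if (N%:Z %| d)%Z then N%:R else 0.
Proof.
move=> N0; have N0' : (N%:R : rat) != 0 by rewrite pnatr_eq0 -lt0n.
case: ifPn => [/dvdzP[c ->]|Nd].
  rewrite -[in RHS](card_ord N) -sumr_const; apply: eq_bigr => x _.
  rewrite -[RHS](@er0 R); apply: (er_congr (c * x%:Z)).
  by rewrite !rmorphM /=; field.
have e1 := er_neq1 N0 Nd.
apply: (mulfI (x := er (d%:~R / N%:R) - 1)); first by rewrite subr_eq0.
rewrite mulr0 (eq_bigr (fun x : 'I_N => er (d%:~R / N%:R) ^+ x)); last first.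
  by move=> x _; rewrite erXn mulrAC.
rewrite -subrX1 erXn mulfVK // er_int subrr //.
Qed.

(** The summand has period N only for even N. A negative N gives the complex conjugate, so one
    definition serves both signs. *)
Definition gsum (N : int) : R[i] := \sum_(x < `|N|) er (- (x%:~R ^+ 2 / (2 * N%:~R))).

Lemma er_quad_periodic (N : int) (r : int) (x : int) : (2 %| N)%Z -> N != 0 ->
  er (- ((x + r * N)%:~R ^+ 2 / (2 * N%:~R))) = er (- (x%:~R ^+ 2 / (2 * N%:~R))).
Proof.
move=> /dvdzP[c ->]; rewrite mulf_eq0 negb_or => /andP[c0 _].
apply: (er_congr (- (r * x + r ^+ 2 * c))).
have c0' : c%:~R != 0 :> rat by rewrite intr_eq0.
by rewrite !(rmorphM, rmorphD, rmorphXn, rmorphN) /=; field.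
Qed.

Lemma gsum_conj (N : int) : gsum (- N) = (gsum N)^*%C.
Proof.
rewrite /gsum abszN rmorph_sum; apply: eq_bigr => i _.

apply: etrans (esym (conj_er _ _)).
by rewrite rmorphN /= opprK mulrN invrN mulrN opprK.
Qed.

(** Replacing y by y + x in the conjugate factor cancels the square of x and leaves a character of x
    of frequency y; orthogonality then keeps y = 0 only. *)
Lemma gsum_norm (n : nat) : ~~ odd n -> gsum n%:Z * (gsum n%:Z)^*%C = n%:R.
Proof.
case: n => [|n n2]; first by rewrite /gsum big_ord0 mul0r.
have N2 : (2 %| n.+1%:Z)%Z by rewrite -dvdn2 in n2.
have N0 : n.+1%:Q != 0 by rewrite pnatr_eq0.
rewrite -gsum_conj /gsum abszN absz_nat mulr_suml.
under eq_bigr => x _.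
  rewrite -(@sum_shift _ _ (fun y : int => er (- (y%:~R ^+ 2 / (2 * (- n.+1%:Z)%:~R)))) x).
  rewrite mulr_sumr.
  under eq_bigr => y _.
    rewrite -erD.
    have -> : - (x%:~R ^+ 2 / (2 * n.+1%:~R)) +
        - ((y%:Z + x%:Z)%:~R ^+ 2 / (2 * (- n.+1%:Z)%:~R)) =
        y%:R ^+ 2 / (2 * n.+1%:R) + (y%:Z)%:~R * x%:R / n.+1%:R :> rat.
      by rewrite !(rmorphD, rmorphN) /=; field.
    rewrite erD.
    over.
  over.
  move=> y; have -> : y + n.+1%:Z = y + (-1) * (- n.+1%:Z) by lia.
  by apply: er_quad_periodic; rewrite ?dvdzN // oppr_eq0.
rewrite exchange_big /= (bigD1 ord0) //= [X in _ + X]big1 => [|y y0].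
  by rewrite addr0 -mulr_sumr sum_er_orth // dvdz0 expr0n /= mul0r er0 mul1r.
rewrite -mulr_sumr sum_er_orth // ifF ?mulr0 //.
apply/negbTE; rewrite dvdzE !absz_nat gtnNdvd // ?lt0n //; exact: ltn_ord.
Qed.

Lemma polar_sum (x : rat) : -1/2 < x < 1/2 ->
  exists2 rho : R, 0 < rho & 1 + er x = rho%:C * er (x / 2).
Proof.
move=> /andP[x0 x1]; exists (2 * cos (pi * ratr x)).
  rewrite mulr_gt0 // cos_gt0_pihalf //.
  have y0 : -1/2 < ratr x :> R.
    by rewrite -(ltr_rat R) in x0; move: x0; rewrite fmorph_div rmorphN rmorph1 rmorph_nat.
  have y1 : ratr x < 1/2 :> R.
    by rewrite -(ltr_rat R) in x1; move: x1; rewrite fmorph_div rmorph1 rmorph_nat.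
  have := pi_gt0 R; move: (pi) => p p0.
  have := mulr_gt0 p0 (ltac:(lra) : 0 < ratr x + 1/2 :> R).
  have := mulr_gt0 p0 (ltac:(lra) : 0 < 1/2 - ratr x :> R).
  by lra.
rewrite !erE fmorph_div rmorph_nat.
have -> : 2 * pi * (ratr x / 2) = pi * ratr x :> R by field.
have -> : 2 * pi * ratr x = (pi * ratr x) *+ 2 :> R by rewrite -mulr_natr; ring.
rewrite cos_mulr2n sin_mulr2n.
have -> : (1 : R[i]) = 1 +i* 0 by [].
move: (cos _) (sin _) => c s; apply/eqP; rewrite eq_complex /=.
by apply/andP; split; apply/eqP; ring.
Qed.

(** Each factor 1 + e(x) with |x| < 1/2 has argument x/2. The exponents are i/(2N) - (odd i)/2
    modulo 1; half their sum over i <= n is n(n+1)/(8N) minus a quarter of the number of odd i. *)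
Lemma gauss_prod_polar (N n : nat) : (n < N)%N ->
  exists2 rho : R, 0 < rho &
    \prod_(i < n) (1 + er ((2 * N%:R)^-1 + 1/2) ^+ i.+1) =
    rho%:C * er (n%:R * n.+1%:R / (8 * N%:R) - (uphalf n)%:R / 4).
Proof.
elim: n => [|n IH] nN.
  by exists 1; rewrite ?big_ord0 // !mul0r subr0 er0 mulr1.
have N0 : N%:R != 0 :> rat by rewrite pnatr_eq0; lia.
have [|r r0 E] := IH; first by lia.
(* The exponent of the new factor, reduced modulo 1 into (-1/2, 1/2). *)
pose x : rat := n.+1%:R / (2 * N%:R) - (odd n.+1)%:R / 2.
have [|r' r'0 E'] := @polar_sum x.
  have t0 : 0 < (n.+1%:R / (2 * N%:R) : rat) by rewrite divr_gt0 ?mulr_gt0 ?ltr0n //; lia.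
  have t1 : (n.+1%:R / (2 * N%:R) : rat) < 1/2.
    rewrite ltr_pdivrMr ?mulr_gt0 ?ltr0n //; last by lia.
    by rewrite mulrA mulfVK // mul1r ltr_nat.
  by rewrite /x; move: t0 t1; set t := _ / _; case: (odd _) => /=; lra.
exists (r * r'); first exact: mulr_gt0.
rewrite big_ord_recr /= E erXn.
have E2 : n.+2%:R = n%:R + 2 :> rat by rewrite -addn2 natrD.
have E1 : n.+1%:R = n%:R + 1 :> rat by rewrite -addn1 natrD.
have U : uphalf n.+1 = (odd n.+1 + uphalf n)%N by rewrite uphalf_half.
have -> : er (((2 * N%:R)^-1 + 1 / 2) * n.+1%:R) = er x.
  apply: (er_congr (uphalf n.+1)).
  have UE : (uphalf n.+1)%:~R = (odd n.+1)%:R + (n.+1%:R - (odd n.+1)%:R) / 2 :> rat.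
    have -> : n.+1%:R = (odd n.+1)%:R + 2 * (n.+1./2)%:R :> rat.
      by rewrite -natrM -natrD mul2n odd_double_half.
    by rewrite uphalf_half -pmulrn natrD; field.
  by rewrite UE /x; field.
rewrite -[n./2.+1]/(uphalf n.+1) U E' mulrACA -rmorphM -erD; congr (_ * er _).
rewrite natrD /x E2 E1.
by field.
Qed.

End GaussSum.

Section GaussSumValue.
Variable R : realType.
Local Notation er := (@er R).
Local Notation gsum := (@gsum R).

(** Gauss's own determination of the sign. For p = -e(1/(2N)) the base q = p^2 is a primitive N-th
    root of unity and [N-1, j] = (-1)^j q^(-j(j+1)/2), so p^j [N-1, j] is the j-th term of the Gauss
    sum. The product formula gives the argument (N-1)/8 - N/8 = -1/8, and [gsum_norm] gives the
    modulus. *)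
Lemma gsum_even (n : nat) : (0 < n)%N -> ~~ odd n ->
  gsum n%:Z = (Num.sqrt n%:R)%:C * er (- (1 / 8)).
Proof.
case: n => // n _ n2.
have N0 : n.+1%:R != 0 :> rat by rewrite pnatr_eq0.
pose p := er ((2 * n.+1%:R)^-1 + 1/2).
have p2 : p ^+ 2 = er (n.+1%:R^-1).
  by rewrite /p erXn; apply: (er_congr 1); field.
have p2N i : (0 < i <= n)%N -> (p ^+ 2) ^+ i != 1.
  move=> /andP[i0 ni]; rewrite p2 erXn mulrC; apply: er_eq1.
  by rewrite divr_gt0 ?ltr0n //= ltr_pdivrMr ?ltr0n // mul1r ltr_nat ltnS.
have term j : (j <= n)%N -> p ^+ j * qbin p n j = er (- (j%:Z%:~R ^+ 2 / (2 * n.+1%:Z%:~R))).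
  elim: j => [|j IH] jn.
    rewrite /qbin subn0 {2}/qfact big_ord0 !mul1r divff ?qfact_neq0 //.
    by rewrite expr0n mul0r oppr0 er0.
  (* The quotient of consecutive coefficients is (1 - q^(n-j)) / (1 - q^(j+1)), which equals
     -q^(n-j) because q^(n-j) and q^(j+1) are inverse to each other. *)
  have -> : qbin p n j.+1 = - ((p ^+ 2) ^+ (n - j) * qbin p n j).
    rewrite /qbin; have -> : (n - j = (n - j.+1).+1)%N by lia.
    rewrite !qfactS.
    have E : (p ^+ 2) ^+ (n - j.+1).+1 * (p ^+ 2) ^+ j.+1 = 1.
      by rewrite -exprD p2 erXn -[RHS](@er0 R); apply: (er_congr 1);
         rewrite (_ : (_ + _ = n.+1)%N) ?mulVf //; lia.
    have nz i : (i <= n)%N -> qfact p i != 0.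
      by move=> ?; apply: qfact_neq0 => k ?; apply: p2N; lia.
    have nz1 i : (0 < i <= n)%N -> 1 - (p ^+ 2) ^+ i != 0.
      by move=> ?; rewrite subr_eq0 eq_sym p2N.
    have := nz1 j.+1 (ltac:(lia)); have := nz1 (n - j.+1).+1 (ltac:(lia)).
    have := nz j (ltac:(lia)); have := nz (n - j.+1)%N (ltac:(lia)).
    move: E; set a := qfact p n; set b := qfact p j; set c := _ ^+ j.+1; set d := _ ^+ _.+1.
    set e := qfact _ _ => dc a0 b0 d0 c0.
    have c0' : c != 0.
      by apply/eqP => z; move: dc; rewrite z mulr0 => /eqP; rewrite eq_sym oner_eq0.
    have dE : d = c^-1 by apply: (mulIf c0'); rewrite dc mulVf.
    move: d0; rewrite dE => d0; field.
    by rewrite c0' a0 b0 c0 -opprB oppr_eq0 c0.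
  rewrite exprS mulrN mulrACA -mulNr.
  rewrite IH; last by rewrite ltnW.
  rewrite -mulN1r -(er_half R) p2 erXn natrB ?(ltnW jn) // /p -!erD.
  apply: (er_congr 2).
  have E1 : n%:R = n.+1%:R - 1 :> rat by rewrite -addn1 natrD addrK.
  have E2 : j.+1%:~R = j%:R + 1 :> rat by rewrite -addn1 PoszD rmorphD.
  by rewrite E1 E2; field.
have [rho rho0 E] := @gauss_prod_polar R n.+1 n (ltnSn n).
have gE : gsum n.+1%:Z = rho%:C * er (- (1 / 8)).
  rewrite /gsum absz_nat (eq_bigr (fun j : 'I_n.+1 => p ^+ j * qbin p n j)); last first.
    by move=> j _; rewrite term // -ltnS.
  rewrite gauss_qbinomial // E; congr (_ * er _).
  have -> : (uphalf n)%:R = n.+1%:R / 2 :> rat.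
    have -> : n.+1%:R = (odd n.+1)%:R + 2 * (n.+1./2)%:R :> rat.
      by rewrite -natrM -natrD mul2n odd_double_half.
    by rewrite (negbTE n2) -uphalfE add0r; field.
  have E1 : n%:R = n.+1%:R - 1 :> rat by rewrite -addn1 natrD addrK.
  by rewrite E1; field.
have conjM : forall x y, (x * y)^*%C = x^*%C * y^*%C := rmorphM (@conjc R).
have := gsum_norm R n2.
rewrite gE conjM conj_er opprK conjc_real mulrACA -erD addNr er0 mulr1.
rewrite -rmorphM -(rmorph_nat (real_complex R)) => /complexI rr.
by rewrite -rr -expr2 sqrtr_sqr ger0_norm // ltW.
Qed.

End GaussSumValue.

(** * Reciprocity for one-dimensional Gauss sums *)

Section Reciprocity.
Variable R : realType.
Local Notation er := (@er R).
Local Notation gsum := (@gsum R).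

Lemma gsum_val (N : int) : N != 0 -> (2 %| N)%Z ->
  gsum N = (Num.sqrt `|N|%N%:R)%:C * er (- ((sgz N)%:~R / 8)).
Proof.
have nat_case (n : nat) : (0 < n)%N -> (2 %| n%:Z)%Z ->
    gsum n%:Z = (Num.sqrt n%:R)%:C * er (- (1 / 8)).
  by move=> n0; rewrite dvdzE !absz_nat dvdn2 => n2; apply: gsum_even.
case: N => n N0 N2.
  have n0 : (0 < n)%N by rewrite lt0n.
  by rewrite absz_nat gtr0_sgz ?nat_case.
have -> : Negz n = - n.+1%:Z by [].
rewrite gsum_conj nat_case //.
rewrite abszN absz_nat ltr0_sgz //.
rewrite (rmorphM (@conjc R) : forall x y, (x * y)^*%C = x^*%C * y^*%C) conj_er conjc_real.
by congr (_ * er _); rewrite rmorphN mulNr.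
Qed.

(** A finite argument: shifting the variable of the auxiliary Gauss sum of a c by a l cancels the
    square of l, and the sum over l mod c becomes an orthogonality relation that forces x = m mod
    c. *)
Lemma recip (a : int) (c : nat) (m : int) : a != 0 -> (0 < c)%N -> (2 %| a * c%:Z)%Z ->
  (\sum_(x < c) er ((a%:~R * x%:R ^+ 2 + 2 * x%:R * m%:~R) / (2 * c%:R))) *
    gsum (a * c%:Z) =
  c%:R * \sum_(n < `|a|) er (- ((c%:Z * n%:Z + m)%:~R ^+ 2 / (2 * (a * c%:Z)%:~R))).
Proof.
move=> a0 c0 ac2.
have ac0 : a * c%:Z != 0 by rewrite mulf_neq0 // eqz_nat -lt0n.
have qa : a%:~R != 0 :> rat by rewrite intr_eq0.
have qc : c%:R != 0 :> rat by rewrite pnatr_eq0 -lt0n.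
have absE : (absz (a * c%:Z))%:Z = sgz (a * c%:Z) * (a * c%:Z) by rewrite -abszEsg.
pose h (x : int) := er (- (x%:~R ^+ 2 / (2 * (a * c%:Z)%:~R))).
have hP x : h (x + (absz (a * c%:Z))%:Z) = h x.
  by rewrite /h absE er_quad_periodic.
rewrite mulr_suml.
under eq_bigr => l _.
  rewrite /gsum -(@sum_shift _ _ h (a * l%:Z) hP) mulr_sumr.
  under eq_bigr => x _.
    have -> : er ((a%:~R * l%:R ^+ 2 + 2 * l%:R * m%:~R) / (2 * c%:R)) * h (x%:Z + a * l%:Z) =
        h x%:Z * er ((m - x%:Z)%:~R * l%:R / c%:R).
      rewrite /h -!erD; congr er.
      by rewrite !(rmorphD, rmorphM, rmorphN) /=; field; rewrite qa qc.
    over.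
  over.
rewrite exchange_big /=.
(* The surviving x mod |a| c are the numbers c n + m with n mod |a|; they are enumerated after
   shifting by m. *)
pose F (x : int) := if (c%:Z %| m - x)%Z then h x else 0.
have FP x : F (x + (absz (a * c%:Z))%:Z) = F x.
  rewrite /F hP opprD addrA rpredBr // absE.
  by rewrite dvdz_mull // dvdz_mull.
transitivity (\sum_(x < absz (a * c%:Z)) c%:R * F x%:Z).
  apply: eq_bigr => x _; rewrite -mulr_sumr sum_er_orth // /F.
  by case: ifP => _; rewrite ?mulr0 // mulrC.
rewrite -mulr_sumr; congr (_ * _).
rewrite -(sum_shift m FP) abszM absz_nat mulnC.
rewrite (sum_mul _ _ (fun x => F (x + m))).
rewrite (bigD1 (Ordinal c0)) //= [X in _ + X]big1 => [|x x0].
  rewrite addr0; apply: eq_bigr => n _.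
  by rewrite addr0 /F /h opprD addrCA subrr addr0 rpredN dvdz_mulr.
rewrite big1 // => n _; rewrite /F ifF //.
apply/negbTE; rewrite !opprD addrCA subrr addr0 rpredDl ?rpredN ?dvdz_mulr //.
rewrite dvdzE !absz_nat gtnNdvd //.
  by rewrite lt0n; apply: contra x0 => /eqP x0; apply/eqP/val_inj.
Qed.

End Reciprocity.

(** * The Gauss sum of an H-graph by iterated reciprocity *)

Section QuadraticSums.
Variable R : realType.
Local Notation er := (@er R).
Local Notation gsum := (@gsum R).
Variable K : nat.
Hypotheses (K_gt0 : (0 < K)%N) (K_even : ~~ odd K).

Let qK : K%:R != 0 :> rat. Proof. by rewrite pnatr_eq0 -lt0n. Qed.

Let K_half : K%:R = 2 * (K./2)%:~R :> rat.
Proof. by rewrite -natrM mul2n even_halfK. Qed.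

Definition quadphase (t : rat) (x : int) : R[i] := er (t * x%:~R ^+ 2 / (2 * K%:R)).

(** The sum of the phase over the lifts of m mod K to residues mod K u; K u is a period as soon as t
    u is an integer. *)
Definition quadsum (t : rat) (u : nat) (m : int) : R[i] :=
  \sum_(n < u) quadphase t (K%:Z * n%:Z + m).

Lemma quadD t t' x : quadphase (t + t') x = quadphase t x * quadphase t' x.
Proof. by rewrite /quadphase -erD; congr er; field. Qed.

Lemma quad_periodic t (u : nat) x : t * u%:R \is a Num.int ->
  quadphase t (x + K%:Z * u%:Z) = quadphase t x.
Proof.
move=> /intrP[i tu]; apply: (er_congr (i * x + i * (K./2)%:Z * u%:Z)).
rewrite !(rmorphD, rmorphM) /= -tu.
have -> : K%:~R = K%:R :> rat by [].
have -> : K./2%:~R = K%:R / 2 :> rat by rewrite K_half mulrAC divff ?mul1r.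
by field.
Qed.

Lemma quad_int_periodic (w x n : int) : quadphase w%:~R (x + K%:Z * n) = quadphase w%:~R x.
Proof.
apply: (er_congr (w * n * x + w * n ^+ 2 * (K./2)%:Z)).
rewrite !(rmorphD, rmorphM) /=.
have -> : K%:~R = K%:R :> rat by [].
have -> : K./2%:~R = K%:R / 2 :> rat by rewrite K_half mulrAC divff ?mul1r.
by field.
Qed.

(** For coprime denominators a pair of lifts, mod u and mod v, is one lift mod u v, so the phases of
    two leaves of the same vertex merge into one. *)
Lemma quadsum_crt t t' (u v : nat) m : (0 < u)%N -> (0 < v)%N -> coprime u v ->
  t * u%:R \is a Num.int -> t' * v%:R \is a Num.int ->
  quadsum t u m * quadsum t' v m = quadsum (t + t') (u * v) m.
Proof.
move=> u0 v0 uv tu tv; rewrite mulr_suml.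
under eq_bigr do rewrite mulr_sumr.
pose F (x y : int) := quadphase t (K%:Z * x + m) * quadphase t' (K%:Z * y + m).
rewrite (sum_crt (F := F)) //.
- by apply: eq_bigr => n _; rewrite quadD.
- move=> x y; congr (_ * _); rewrite -[RHS](quad_periodic (_ + m) tu).
  by congr quadphase; rewrite mulrDr addrAC.
- move=> x y; congr (_ * _); rewrite -[RHS](quad_periodic (_ + m) tv).
  by congr quadphase; rewrite mulrDr addrAC.
Qed.

Lemma sum_quadsum (A : int -> R[i]) t (u : nat) :
  (forall x n, A (x + K%:Z * n) = A x) ->
  \sum_(x < K) A x%:Z * quadsum t u x%:Z = \sum_(x < K * u) A x%:Z * quadphase t x%:Z.
Proof.
move=> AK; rewrite (sum_mul _ _ (fun x => A x * quadphase t x)).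
apply: eq_bigr => x _; rewrite mulr_sumr; apply: eq_bigr => n _.
by congr (_ * _); rewrite addrC AK.
Qed.

(** The sum over the label x of one leaf of weight w whose neighbour carries the label m. *)
Definition leafsum (w m : int) : R[i] :=
  \sum_(x < K) er ((w%:~R * x%:R ^+ 2 + 2 * x%:R * m%:~R) / (2 * K%:R)).

Lemma even_mulK (w : int) : (2 %| w * K%:Z)%Z.
Proof. by rewrite dvdz_mull // dvdzE !absz_nat dvdn2. Qed.

Lemma leafsum_recip (w m : int) : w != 0 ->
  leafsum w m * gsum (w * K%:Z) = K%:R * quadsum (- w%:~R^-1) `|w| m.
Proof.
move=> w0; have qw : w%:~R != 0 :> rat by rewrite intr_eq0.
rewrite recip ?even_mulK //; congr (_ * _); apply: eq_bigr => n _.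
congr er; rewrite [(w * K%:Z)%:~R]rmorphM /=.
have -> : K%:~R = K%:R :> rat by [].
by field; rewrite qw qK.
Qed.

(** Reciprocity with modulus K |M|. The linear term then has coefficient |M| m, so |M| factors out
    of the dual variable and the dual phase becomes M/c. The sign of M moves to the quadratic
    coefficient, since a modulus is positive. *)
Lemma inner_recip (c M m : int) : c != 0 -> M != 0 ->
  (\sum_(x < K * `|M|) quadphase (- (c%:~R / M%:~R)) x%:Z * er (x%:R * m%:~R / K%:R)) *
    gsum (- (c * M) * K%:Z) =
  (K * `|M|)%:R * quadsum (M%:~R / c%:~R) `|c| m.
Proof.
move=> c0 M0.
have qM : M%:~R != 0 :> rat by rewrite intr_eq0.
have qc : c%:~R != 0 :> rat by rewrite intr_eq0.
have aM : `|M|%N%:R = (sgz M)%:~R * M%:~R :> rat by rewrite -intrM -abszEsg.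
have sM : (sgz M)%:~R ^+ 2 = 1 :> rat.
  by rewrite -rmorphXn /= -[1]/(1%:~R); congr _%:~R; case: sgzP M0.
have E : - (c * M) * K%:Z = - (c * sgz M) * (K * `|M|)%N%:Z.
  rewrite PoszM abszEsg; have : sgz M * sgz M = 1 by case: sgzP M0.
  by move=> s; transitivity (- (c * (sgz M * sgz M) * M) * K%:Z); [rewrite s|]; ring.
have s0 : sgz M != 0 by rewrite sgz_eq0.
have qs : (sgz M)%:~R != 0 :> rat by rewrite intr_eq0.
have K0 : (0 < K * `|M|)%N by rewrite muln_gt0 K_gt0 absz_gt0.
have := @recip R (- (c * sgz M)) (K * `|M|) (`|M|%N%:Z * m) _ K0.
rewrite -E even_mulK oppr_eq0 mulf_neq0 // => /(_ isT isT) rec.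
transitivity (\sum_(x < K * `|M|)
   er (((- (c * sgz M))%:~R * x%:R ^+ 2 + 2 * x%:R * (`|M|%N%:Z * m)%:~R) /
    (2 * (K * `|M|)%:R)) * gsum (- (c * M) * K)).
  rewrite -mulr_suml; congr (_ * _); apply: eq_bigr => x _.
  rewrite /quadphase -erD; congr er.
  rewrite natrM !(rmorphM, rmorphN) /= -[`|M|%N%:~R]/(`|M|%N%:R) -[x%:Z%:~R]/(x%:R) aM.
  by field; rewrite qM qs qK.
rewrite -mulr_suml rec; congr (_ * _).
have -> : absz (- (c * sgz M)) = absz c.
  by rewrite abszN abszM (_ : absz (sgz M) = 1%N) ?muln1 //; case: sgzP M0.
apply: eq_bigr => n _.
rewrite /quadphase; congr er.
have -> : (K * `|M|)%N%:Z * n%:Z + `|M|%N%:Z * m = `|M|%N%:Z * (K%:Z * n%:Z + m).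
  by rewrite PoszM; ring.
rewrite rmorphM /= exprMn -[`|M|%N%:~R]/(`|M|%N%:R) aM exprMn sM.
rewrite !(rmorphM, rmorphN) /=; have -> : K%:~R = K%:R :> rat by [].
by field; rewrite qM qc qK.
Qed.

Lemma final_gsum (D N c : int) : D ^+ 2 = 1 -> N != 0 -> c != 0 ->
  \sum_(x < K * (`|N| * `|c|)) quadphase (- (D%:~R / (N%:~R * c%:~R))) x%:Z =
  gsum (D * N * c * K%:Z).
Proof.
move=> D2 N0 c0.
have qN : N%:~R != 0 :> rat by rewrite intr_eq0.
have qc : c%:~R != 0 :> rat by rewrite intr_eq0.
have qD2 : D%:~R ^+ 2 = 1 :> rat by rewrite -rmorphXn /= D2.
have qD : D%:~R != 0 :> rat by rewrite -sqrf_eq0 qD2 oner_eq0.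
have aD : absz D = 1%N.
  by apply/eqP; rewrite -(@eqn_exp2r _ _ 2) // exp1n -abszX D2.
rewrite /gsum !abszM aD absz_nat mul1n mulnC.
apply: eq_bigr => x _; rewrite /quadphase; congr er.
rewrite !rmorphM /=; have -> : K%:~R = K%:R :> rat by [].
have DV : D%:~R = D%:~R ^-1 :> rat by apply: (mulIf qD); rewrite -expr2 qD2 mulVf.
rewrite [D%:~R in LHS]DV.
by field; rewrite qD qN qc qK.
Qed.

(** Reciprocity turns each leaf into a phase -1/w_i at its neighbour. At vertex 1 the phases add up
    to w1 - 1/w3 - 1/w4 = -c/M; summing over x by reciprocity sends M/c to vertex 2, where w2 - 1/w5
    - 1/w6 + M/c = -D/(N c) because c a = M N + D. The last sum is thus a plain Gauss sum, and all
    auxiliary Gauss sums have known values. *)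
Lemma gauss_Hgraph (w1 w2 w3 w4 w5 w6 D : int) :
  let M := w3 * w4 in let N := w5 * w6 in
  let a := - w2 * w5 * w6 + w5 + w6 in let c := - w1 * w3 * w4 + w3 + w4 in
  D ^+ 2 = 1 -> c * a = M * N + D -> M * N * D < 0 -> c != 0 ->
  \sum_(x < K) \sum_(y < K)
     quadphase w1%:~R x%:Z * quadphase w2%:~R y%:Z * er (x%:R * y%:R / K%:R) *
     (leafsum w3 x * leafsum w4 x * leafsum w5 y * leafsum w6 y) =
  K%:R ^+ 3 * er ((sgz w3 + sgz w4 + sgz w5 + sgz w6)%:~R / 8).
Proof.
move=> M N a c D2 ca MND c0.
have MN0 : M * N != 0 by apply: contraTneq MND => ->; rewrite mul0r ltxx.
have [M0 N0] : M != 0 /\ N != 0 by apply/andP; rewrite -negb_or -mulf_eq0.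
have [w30 w40] : w3 != 0 /\ w4 != 0 by apply/andP; rewrite -negb_or -mulf_eq0.
have [w50 w60] : w5 != 0 /\ w6 != 0 by apply/andP; rewrite -negb_or -mulf_eq0.
have D0 : D != 0 by rewrite -sqrf_eq0 D2.
have Dabs : absz D = 1%N.
  by apply/eqP; rewrite -(@eqn_exp2r _ _ 2) // exp1n -abszX D2.
have q3 : w3%:~R != 0 :> rat by rewrite intr_eq0.
have q4 : w4%:~R != 0 :> rat by rewrite intr_eq0.
have q5 : w5%:~R != 0 :> rat by rewrite intr_eq0.
have q6 : w6%:~R != 0 :> rat by rewrite intr_eq0.
have qc : c%:~R != 0 :> rat by rewrite intr_eq0.
(* The determinant D = +-1 is an integer combination of w3 and w4, of w5 and w6, and of N and c,
   which gives the three coprimality conditions. *)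
have bezout (u v r s : int) : u * r + v * s = D -> coprime `|u| `|v|.
  move=> E; apply/eqP/eqP; rewrite -dvdn1 -Dabs.
  rewrite -[X in (X %| _)%N]absz_nat -dvdzE -E rpredD // dvdz_mulr //.
    by rewrite dvdzE absz_nat dvdn_gcdl.
  by rewrite dvdzE absz_nat dvdn_gcdr.
have c34 : coprime `|w3| `|w4|.
  by apply: (bezout _ _ ((1 - w1 * w4) * a - w4 * N) a); move: ca; rewrite /c /M; lia.
have c56 : coprime `|w5| `|w6|.
  by apply: (bezout _ _ ((1 - w2 * w6) * c - w6 * M) c); move: ca; rewrite /a /N; lia.
have cNc : coprime `|N| `|c|.
  by apply: (bezout _ _ (- M) a); move: ca; lia.
have absE (w : int) : `|w|%N%:R = (sgz w)%:~R * w%:~R :> rat by rewrite -intrM -abszEsg.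
have intw (w : int) : w != 0 -> - w%:~R^-1 * `|w|%N%:R \is a @Num.int rat.
  move=> w0; rewrite absE mulrCA mulNr mulVf ?intr_eq0 // mulrN1.
  by rewrite rpredN; apply/intrP; exists (sgz w).
have abs0 (w : int) : w != 0 -> (0 < `|w|)%N by rewrite absz_gt0.
have crt34 x := quadsum_crt x (abs0 _ w30) (abs0 _ w40) c34 (intw _ w30) (intw _ w40).
have crt56 x := quadsum_crt x (abs0 _ w50) (abs0 _ w60) c56 (intw _ w50) (intw _ w60).
rewrite -!abszM -/M -/N in crt34 crt56.
have int56 : (- w5%:~R^-1 + - w6%:~R^-1) * `|N|%N%:R \is a @Num.int rat.
  rewrite abszM natrM mulrDl mulrA [X in _ + X]mulrCA.
  by rewrite rpredD // rpredM ?intw ?rpred_nat.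
have intMc : M%:~R / c%:~R * `|c|%N%:R \is a @Num.int rat.
  rewrite absE mulrCA divfK // -intrM; apply/intrP.
  by exists (sgz c * M).
have crtNc x := quadsum_crt x (abs0 _ N0) (abs0 _ c0) cNc int56 intMc.
set S := \sum_(x < K) _.
pose G w := gsum (w * K%:Z).
(* Each of the five reciprocity steps introduces one Gauss sum as a factor on the left; they are
   divided out at the end, once their values show that they are nonzero. *)
have key : S * (G w3 * G w4 * G w5 * G w6) * gsum (- (c * M) * K%:Z) =
    K%:R ^+ 4 * (K * `|M|)%:R * gsum (D * N * c * K%:Z).
  transitivity (\sum_(y < K) K%:R ^+ 4 * (quadphase w2%:~R y%:Z *
     quadsum (- w5%:~R^-1 + - w6%:~R^-1) `|N| y%:Z) *
     ((\sum_(x < K) quadphase w1%:~R x%:Z * er (x%:R * y%:R / K%:R) *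
       quadsum (- w3%:~R^-1 + - w4%:~R^-1) `|M| x%:Z) * gsum (- (c * M) * K%:Z))).
    rewrite /S exchange_big /= -mulrA mulr_suml; apply: eq_bigr => y _.
    rewrite [LHS]mulrA [RHS]mulrA; congr (_ * _).
    rewrite [LHS]mulr_suml [RHS]mulr_sumr; apply: eq_bigr => x _.
    rewrite -crt34 -crt56.
    have l3 := leafsum_recip x%:Z w30; have l4 := leafsum_recip x%:Z w40.
    have l5 := leafsum_recip y%:Z w50; have l6 := leafsum_recip y%:Z w60.
    set q := quadphase _ _ * quadphase _ _ * er _.
    transitivity (q * ((leafsum w3 x%:Z * G w3) * (leafsum w4 x%:Z * G w4) *
      (leafsum w5 y%:Z * G w5) * (leafsum w6 y%:Z * G w6))); first by ring.
    rewrite l3 l4 l5 l6 /q; ring.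
  have t34 : w1%:~R + (- w3%:~R^-1 + - w4%:~R^-1) = - (c%:~R / M%:~R) :> rat.
    by rewrite /c /M !(rmorphD, rmorphM, rmorphN) /=; field; rewrite q3 q4.
  have t56 : w2%:~R + (- w5%:~R^-1 + - w6%:~R^-1 + M%:~R / c%:~R) =
      - (D%:~R / (N%:~R * c%:~R)) :> rat.
    have qN : N%:~R != 0 :> rat by rewrite intr_eq0.
    have -> : D%:~R = c%:~R * a%:~R - M%:~R * N%:~R :> rat.
      by rewrite -!rmorphM -rmorphB ca addrAC subrr add0r.
    have aE : a%:~R = - w2%:~R * N%:~R + w5%:~R + w6%:~R :> rat.
      by rewrite /a /N !(rmorphD, rmorphM, rmorphN) /=; ring.
    rewrite aE /N rmorphM /=; field.
    by rewrite q5 q6 qc.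
  have inner y : (\sum_(x < K) quadphase w1%:~R x%:Z * er (x%:R * y%:R / K%:R) *
       quadsum (- w3%:~R^-1 + - w4%:~R^-1) `|M| x%:Z) * gsum (- (c * M) * K%:Z) =
      (K * `|M|)%:R * quadsum (M%:~R / c%:~R) `|c| y%:Z.
    rewrite -inner_recip //; congr (_ * _).
    pose A (x : int) := quadphase w1%:~R x * er (x%:~R * y%:R / K%:R).
    rewrite (@sum_quadsum A) => [|x n]; last first.
      rewrite /A quad_int_periodic; congr (_ * _); apply: (er_congr (n * y%:Z)).
      by rewrite !(rmorphD, rmorphM) /=; field.
    apply: eq_bigr => x _; rewrite /A.
    rewrite mulrAC.
    rewrite -[x%:Z%:~R]/(x%:R).
    congr (_ * _).
    by rewrite -quadD t34.
  under eq_bigr => y _ do rewrite inner.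
  rewrite -(final_gsum D2 N0 c0).
  pose B := quadphase w2%:~R.
  transitivity (K%:R ^+ 4 * (K * `|M|)%:R * \sum_(y < K) B y%:Z *
      quadsum (- w5%:~R^-1 + - w6%:~R^-1 + M%:~R / c%:~R) (`|N| * `|c|) y%:Z).
    rewrite mulr_sumr; apply: eq_bigr => y _; rewrite -crtNc /B; ring.
  congr (_ * _); rewrite sum_quadsum => [|x n]; last exact: quad_int_periodic.
  by apply: eq_bigr => y _; rewrite -quadD t56.
have gv w : w != 0 -> gsum (w * K%:Z) =
    (Num.sqrt `|w|%N%:R)%:C * (Num.sqrt K%:R)%:C * er (- ((sgz w)%:~R / 8)).
  move=> w0; rewrite gsum_val ?even_mulK ?mulf_neq0 //; last by rewrite eqz_nat -lt0n.
  rewrite abszM absz_nat natrM sqrtrM // rmorphM /= sgzM.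
  by rewrite (gtr0_sgz (_ : 0 < K%:Z)) ?mulr1.
have cM0 : - (c * M) != 0 by rewrite oppr_eq0 mulf_neq0.
have DNc0 : D * N * c != 0 by rewrite !mulf_neq0.
(* This is where M N D < 0 is used: the two Gauss sums not attached to leaves get the same phase and
   cancel, leaving the leaf signs only. *)
have sgE : sgz (- (c * M)) = sgz (D * N * c).
  have : 0 < - (c * M) * (D * N * c).
    have -> : - (c * M) * (D * N * c) = c ^+ 2 * (- (M * N * D)) by ring.
    by rewrite mulr_gt0 ?oppr_gt0 // exprn_even_gt0.
  move=> /gtr0_sgz; rewrite sgzM.
  by case: (sgzP (- (c * M))) => _; case: (sgzP (D * N * c)).
move: key; rewrite /G !gv // sgE !abszN !abszM Dabs mul1n !natrM !sqrtrM // !rmorphM /=.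
rewrite !rmorphD /= !mulrDl !erD !erN.
have sq (n : nat) : (n%:R : R[i]) = (Num.sqrt n%:R)%:C ^+ 2.
  by rewrite -rmorphXn sqr_sqrtr // rmorph_nat.
have sq0 (n : nat) : (0 < n)%N -> (Num.sqrt n%:R)%:C != 0 :> R[i].
  by move=> n0; rewrite -sqrf_eq0 -sq pnatr_eq0 -lt0n.
rewrite (sq K) (sq (absz w3)) (sq (absz w4)).
have := sq0 _ (abs0 _ w30); have := sq0 _ (abs0 _ w40).
have := sq0 _ (abs0 _ w50); have := sq0 _ (abs0 _ w60).
have := sq0 _ (abs0 _ c0); have := sq0 _ K_gt0.
set s3 := (Num.sqrt (absz w3)%:R)%:C; set s4 := (Num.sqrt (absz w4)%:R)%:C.
set s5 := (Num.sqrt (absz w5)%:R)%:C; set s6 := (Num.sqrt (absz w6)%:R)%:C.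
set sc := (Num.sqrt (absz c)%:R)%:C; set sK := (Num.sqrt K%:R)%:C.
have := er_neq0 R ((sgz w3)%:~R / 8); have := er_neq0 R ((sgz w4)%:~R / 8).
have := er_neq0 R ((sgz w5)%:~R / 8); have := er_neq0 R ((sgz w6)%:~R / 8).
have := er_neq0 R ((sgz (D * N * c))%:~R / 8).
set e0 := er _; set e6 := er _; set e5 := er _; set e4 := er _; set e3 := er _.
move: S {sq sq0 sgE gv}.
move=> S e00 e60 e50 e40 e30 sK0 sc0 s60 s50 s40 s30 E.
apply: (mulIf (x := (s3 * sK / e3 * (s4 * sK / e4) * (s5 * sK / e5) * (s6 * sK / e6)) *
  (sc * (s3 * s4) * sK / e0))); last by rewrite [LHS]mulrA E; field; rewrite e30 e40 e50 e60 e00.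
by rewrite !mulf_neq0 // invr_eq0.
Qed.

End QuadraticSums.

(** * Finite Fourier expansion of the theta exponents *)

Section CompleteSquare.
Variable R : realType.
Local Notation er := (@er R).
Variable K : nat.
Hypotheses (K_gt0 : (0 < K)%N) (K_even : ~~ odd K).
Local Notation quad := (@quadphase R K).
Local Notation leafsum := (@leafsum R K).

Let qK : K%:R != 0 :> rat. Proof. by rewrite pnatr_eq0 -lt0n. Qed.

Lemma leaf_term_periodic (w m x : int) :
  er ((w%:~R * (x + K%:Z)%:~R ^+ 2 + 2 * (x + K%:Z)%:~R * m%:~R) / (2 * K%:R)) =
  er ((w%:~R * x%:~R ^+ 2 + 2 * x%:~R * m%:~R) / (2 * K%:R)).
Proof.
have K_half : K./2%:~R = K%:R / 2 :> rat.
  by rewrite -[in RHS](even_halfK K_even) -muln2 natrM mulfK.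
apply: (er_congr (w * x + w * (K./2)%:Z + m)).
rewrite !(rmorphD, rmorphM) /= K_half.
by have -> : K%:~R = K%:R :> rat by []; field.
Qed.

Lemma leafsum_periodic (w m n : int) : leafsum w (m + K%:Z * n) = leafsum w m.
Proof.
apply: eq_bigr => x _; apply: (er_congr (x%:Z * n)).
rewrite !(rmorphD, rmorphM) /=.
by have -> : K%:~R = K%:R :> rat by []; field.
Qed.

Lemma leafsumN (w m : int) : leafsum w (- m) = leafsum w m.
Proof.
rewrite /leafsum -(sum_opp (leaf_term_periodic w m)).
apply: eq_bigr => x _; congr er; rewrite !rmorphN /= sqrrN; congr (_ / _).
by rewrite !mulrN mulNr.
Qed.

Lemma leafsum_shift (w m s : int) :
  leafsum w (m + w * s) =
  er (- ((w%:~R * s%:~R ^+ 2 + 2 * s%:~R * m%:~R) / (2 * K%:R))) * leafsum w m.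
Proof.
rewrite /leafsum -(sum_shift s (leaf_term_periodic w m)) mulr_sumr.
apply: eq_bigr => x _; rewrite -erD; congr er.
by rewrite !(rmorphD, rmorphM) /= -[x%:Z%:~R]/(x%:R); field.
Qed.

Variables (w1 w2 w3 w4 w5 w6 : int).

Definition core (x y : int) : R[i] :=
  quad w1%:~R x * quad w2%:~R y * er (x%:~R * y%:~R / K%:R).

(** The summand of the Gauss sum of W once the four leaves are summed out. Shifting by e_i the label
    seen by leaf i amounts to a linear term e_i l_i in the exponent. *)
Definition Hterm (e3 e4 e5 e6 x y : int) : R[i] :=
  core x y * (leafsum w3 (x + e3) * leafsum w4 (x + e4) *
              leafsum w5 (y + e5) * leafsum w6 (y + e6)).

Lemma coreC x y n : core (x + K%:Z * n) y = core x y.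
Proof.
rewrite /core quad_int_periodic //; congr (_ * _); apply: (er_congr (n * y)).
rewrite !(rmorphD, rmorphM) /=.
by have -> : K%:~R = K%:R :> rat by []; field.
Qed.

Lemma coreC2 x y n : core x (y + K%:Z * n) = core x y.
Proof.
rewrite /core quad_int_periodic //; congr (_ * _); apply: (er_congr (n * x)).
rewrite !(rmorphD, rmorphM) /=.
by have -> : K%:~R = K%:R :> rat by []; field.
Qed.

(** Translation of the label vector l by v: the linear terms are the entries of W v, those of the
    leaves appearing as shifts in [Hterm], and the constant left over is v W v, written row by
    row. *)
Lemma complete_square (v1 v2 v3 v4 v5 v6 : int) :
  \sum_(x < K) \sum_(y < K)
     Hterm (v1 + w3 * v3) (v1 + w4 * v4) (v2 + w5 * v5) (v2 + w6 * v6) x%:Z y%:Z *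
     er ((x%:R * (w1 * v1 + v2 + v3 + v4)%:~R + y%:R * (v1 + w2 * v2 + v5 + v6)%:~R) / K%:R) =
  er (- ((v1 * (w1 * v1 + v2 + v3 + v4) + v2 * (v1 + w2 * v2 + v5 + v6) +
       v3 * (v1 + w3 * v3) + v4 * (v1 + w4 * v4) + v5 * (v2 + w5 * v5) +
       v6 * (v2 + w6 * v6))%:~R / (2 * K%:R))) *
  \sum_(x < K) \sum_(y < K) Hterm 0 0 0 0 x%:Z y%:Z.
Proof.
pose F x y := Hterm 0 0 0 0 x y.
have F1 x y : F (x + K%:Z) y = F x y.
  rewrite /F /Hterm !addr0 -[K%:Z]mulr1 coreC.
  by rewrite !leafsum_periodic.
have F2 x y : F x (y + K%:Z) = F x y.
  rewrite /F /Hterm !addr0 -[K%:Z]mulr1 coreC2.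
  by rewrite !leafsum_periodic.
have -> : \sum_(x < K) \sum_(y < K) Hterm 0 0 0 0 x%:Z y%:Z =
    \sum_(x < K) \sum_(y < K) F (x%:Z + v1) (y%:Z + v2).
  rewrite (@sum_shift _ _ (fun x => \sum_(y < K) F x (y%:Z + v2)) v1) => [|x].
    by apply: eq_bigr => x _; rewrite (@sum_shift _ _ (F x)).
  by apply: eq_bigr => y _; rewrite F1.
rewrite mulr_sumr; apply: eq_bigr => x _; rewrite mulr_sumr; apply: eq_bigr => y _.
rewrite /F /Hterm !addr0 !addrA !leafsum_shift /core /quadphase.
set l3 := leafsum w3 _; set l4 := leafsum w4 _; set l5 := leafsum w5 _; set l6 := leafsum w6 _.
have mulE (e1 e2 e e' e3 e4 e5 e6 r r1 r2 r' : rat) :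
    e1 + e2 + e + e' + e3 + e4 + e5 + e6 = r + r1 + r2 + r' ->
  er e1 * er e2 * er e * (er e3 * l3 * (er e4 * l4) * (er e5 * l5) * (er e6 * l6)) * er e' =
  er r * (er r1 * er r2 * er r' * (l3 * l4 * l5 * l6)).
  move=> E.
  transitivity (er (e1 + e2 + e + e' + e3 + e4 + e5 + e6) * (l3 * l4 * l5 * l6)).
    by rewrite !erD; ring.
  by rewrite E !erD; ring.
apply: mulE.
rewrite !(rmorphD, rmorphM) /= -[x%:Z%:~R]/(x%:R) -[y%:Z%:~R]/(y%:R); field.
by [].
Qed.

Section Unimodular.
Variable D : int.
Let M := w3 * w4.
Let N := w5 * w6.
Let a := - w2 * w5 * w6 + w5 + w6.
Let c := - w1 * w3 * w4 + w3 + w4.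
Hypotheses (D2 : D ^+ 2 = 1) (caE : c * a = M * N + D).

(** The quadratic form of S; the matrix entries are those found in [SmxE]. *)
Definition Sform (x y : rat) : rat :=
  D%:~R * (M%:~R * a%:~R * x ^+ 2 + 2 * (M%:~R * N%:~R) * x * y + N%:~R * c%:~R * y ^+ 2).

(* The first two coordinates of [W^-1 b] are given by the matrix [-S]. *)
Lemma unimodular_solve (m n e3 e4 e5 e6 : int) :
  exists v1 v2 v3 v4 v5 v6 : int,
  [/\ w1 * v1 + v2 + v3 + v4 = m, v1 + w2 * v2 + v5 + v6 = n,
      v1 + w3 * v3 = e3 /\ v1 + w4 * v4 = e4, v2 + w5 * v5 = e5 /\ v2 + w6 * v6 = e6 &
      v1 = - D * (a * (M * m - e3 * w4 - e4 * w3) + M * (N * n - e5 * w6 - e6 * w5)) /\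
      v2 = - D * (N * (M * m - e3 * w4 - e4 * w3) + c * (N * n - e5 * w6 - e6 * w5))].
Proof.
have DE : D = c * a - M * N by rewrite caE addrAC subrr add0r.
have red z : z = D * (D * z) by rewrite mulrA -expr2 D2 mul1r.
(* Eliminating the leaves turns the first two rows into -c v1 + M v2 = p and N v1 - a v2 = q, a
   system of determinant c a - M N = D. The u_i solve the system with right-hand side multiplied by
   D; in u3, ..., u6 the division by the leaf weight has been carried out. *)
pose p := M * m - e3 * w4 - e4 * w3; pose q := N * n - e5 * w6 - e6 * w5.
pose u1 := - (a * p + M * q); pose u2 := - (N * p + c * q).
pose u3 := e3 * a * (1 - w1 * w4) - e3 * w4 * N + a * (w4 * m - e4) + w4 * q.
pose u4 := e4 * a * (1 - w1 * w3) - e4 * w3 * N + a * (w3 * m - e3) + w3 * q.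
pose u5 := e5 * c * (1 - w2 * w6) - e5 * w6 * M + c * (w6 * n - e6) + w6 * p.
pose u6 := e6 * c * (1 - w2 * w5) - e6 * w5 * M + c * (w5 * n - e5) + w5 * p.
exists (D * u1), (D * u2), (D * u3), (D * u4), (D * u5), (D * u6).
have E1 : w1 * u1 + u2 + u3 + u4 = D * m.
  by rewrite DE /u1 /u2 /u3 /u4 /p /q /a /c /M /N; ring.
have E2 : u1 + w2 * u2 + u5 + u6 = D * n.
  by rewrite DE /u1 /u2 /u5 /u6 /p /q /a /c /M /N; ring.
have E3 : u1 + w3 * u3 = D * e3 by rewrite DE /u1 /u3 /p /q /a /c /M /N; ring.
have E4 : u1 + w4 * u4 = D * e4 by rewrite DE /u1 /u4 /p /q /a /c /M /N; ring.
have E5 : u2 + w5 * u5 = D * e5 by rewrite DE /u2 /u5 /p /q /a /c /M /N; ring.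
have E6 : u2 + w6 * u6 = D * e6 by rewrite DE /u2 /u6 /p /q /a /c /M /N; ring.
split; [| | split | split | split].
- by rewrite [RHS]red -E1; ring.
- by rewrite [RHS]red -E2; ring.
- by rewrite [RHS]red -E3; ring.
- by rewrite [RHS]red -E4; ring.
- by rewrite [RHS]red -E5; ring.
- by rewrite [RHS]red -E6; ring.
- by rewrite /u1 /p /q; ring.
- by rewrite /u2 /p /q; ring.
Qed.

(** With b = (2 mu + 1, 2 nu + 1, -s3, ..., -s6) = W v, eliminating the leaves from b W^-1 b leaves
    the sum of the s_i^2 / w_i and minus the form S at b1 + s3/w3 + s4/w4 and b2 + s5/w5 + s6/w6.
    These two numbers are twice the arguments of [Sform], whence the factor 4. *)
Lemma Sform_dual (v1 v2 v3 v4 v5 v6 s3 s4 s5 s6 mu nu : int) :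
  w3 != 0 -> w4 != 0 -> w5 != 0 -> w6 != 0 ->
  v1 + w3 * v3 = - s3 -> v1 + w4 * v4 = - s4 -> v2 + w5 * v5 = - s5 -> v2 + w6 * v6 = - s6 ->
  v1 = - D * (a * (M * (2 * mu + 1) - - s3 * w4 - - s4 * w3) +
              M * (N * (2 * nu + 1) - - s5 * w6 - - s6 * w5)) ->
  v2 = - D * (N * (M * (2 * mu + 1) - - s3 * w4 - - s4 * w3) +
              c * (N * (2 * nu + 1) - - s5 * w6 - - s6 * w5)) ->
  4 * Sform (leaf_exp w3 w4 s3 s4 + mu%:~R) (leaf_exp w5 w6 s5 s6 + nu%:~R) =
  s3%:~R ^+ 2 / w3%:~R + s4%:~R ^+ 2 / w4%:~R + s5%:~R ^+ 2 / w5%:~R + s6%:~R ^+ 2 / w6%:~R -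
  (v1 * (2 * mu + 1) + v2 * (2 * nu + 1) + v3 * - s3 + v4 * - s4 + v5 * - s5 + v6 * - s6)%:~R.
Proof.
move=> w30 w40 w50 w60 E3 E4 E5 E6 V1 V2.
have q3 : w3%:~R != 0 :> rat by rewrite intr_eq0.
have q4 : w4%:~R != 0 :> rat by rewrite intr_eq0.
have q5 : w5%:~R != 0 :> rat by rewrite intr_eq0.
have q6 : w6%:~R != 0 :> rat by rewrite intr_eq0.
have solve (w v u s : int) : w%:~R != 0 :> rat -> v + w * u = - s ->
    u%:~R = (- s%:~R - v%:~R) / w%:~R :> rat.
  move=> w0 E; rewrite -rmorphN -E rmorphD rmorphM /=.
  by rewrite addrAC subrr add0r mulrAC divff ?mul1r.
rewrite !(rmorphD, rmorphM, rmorphN) /= (solve _ _ _ _ q3 E3) (solve _ _ _ _ q4 E4).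
rewrite (solve _ _ _ _ q5 E5) (solve _ _ _ _ q6 E6) V1 V2.
rewrite /Sform /leaf_exp /a /c /M /N.
by rewrite !(rmorphD, rmorphM, rmorphN) /=; field; rewrite q3 q4 q5 q6.
Qed.

(** [complete_square] at v = W^-1 b, an integer vector, with b as in [Sform_dual], which rewrites
    the phase of v W v in terms of S. *)
Lemma theta_fourier (s3 s4 s5 s6 mu nu : int) :
  w3 != 0 -> w4 != 0 -> w5 != 0 -> w6 != 0 ->
  s3 ^+ 2 = 1 -> s4 ^+ 2 = 1 -> s5 ^+ 2 = 1 -> s6 ^+ 2 = 1 ->
  er (2 * Sform (leaf_exp w3 w4 s3 s4 + mu%:~R) (leaf_exp w5 w6 s5 s6 + nu%:~R) / K%:R) *
    \sum_(x < K) \sum_(y < K) Hterm 0 0 0 0 x%:Z y%:Z =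
  er ((w3%:~R^-1 + w4%:~R^-1 + w5%:~R^-1 + w6%:~R^-1) / (2 * K%:R)) *
  \sum_(x < K) \sum_(y < K) Hterm (- s3) (- s4) (- s5) (- s6) x%:Z y%:Z *
     er ((x%:R * (2 * mu + 1)%:~R + y%:R * (2 * nu + 1)%:~R) / K%:R).
Proof.
move=> w30 w40 w50 w60 s32 s42 s52 s62.
have [v1 [v2 [v3 [v4 [v5 [v6 [Em En [E3 E4] [E5 E6] [V1 V2]]]]]]]] :=
  unimodular_solve (2 * mu + 1) (2 * nu + 1) (- s3) (- s4) (- s5) (- s6).
have := complete_square v1 v2 v3 v4 v5 v6.
rewrite Em En E3 E4 E5 E6 => ->; rewrite mulrA -erD; congr (er _ * _).
have sq (s : int) : s ^+ 2 = 1 -> s%:~R ^+ 2 = 1 :> rat by move=> s2; rewrite -rmorphXn /= s2.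
have := Sform_dual w30 w40 w50 w60 E3 E4 E5 E6 V1 V2.
rewrite (sq _ s32) (sq _ s42) (sq _ s52) (sq _ s62) !mul1r.
move=> E; rewrite -mulrBl -E.
by field.
Qed.

(** Other signs and other mu, nu change b by 2 W u with u integral, hence b W^-1 b by a multiple of
    4. This is why all theta exponents lie in one class modulo 1. *)
Lemma Sform_mod1 (d3 d4 d5 d6 mu nu : int) :
  w3 != 0 -> w4 != 0 -> w5 != 0 -> w6 != 0 ->
  (1 - 2 * d3) ^+ 2 = 1 -> (1 - 2 * d4) ^+ 2 = 1 ->
  (1 - 2 * d5) ^+ 2 = 1 -> (1 - 2 * d6) ^+ 2 = 1 ->
  exists z : int, Sform (leaf_exp w3 w4 (1 - 2 * d3) (1 - 2 * d4) + mu%:~R)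
      (leaf_exp w5 w6 (1 - 2 * d5) (1 - 2 * d6) + nu%:~R) =
    Sform (leaf_exp w3 w4 1 1 + 0%:~R) (leaf_exp w5 w6 1 1 + 0%:~R) + z%:~R.
Proof.
move=> w30 w40 w50 w60 s32 s42 s52 s62.
have [v1 [v2 [v3 [v4 [v5 [v6 [Em En [E3 E4] [E5 E6] [V1 V2]]]]]]]] :=
  unimodular_solve (2 * 0 + 1) (2 * 0 + 1) (- 1) (- 1) (- 1) (- 1).
have [u1 [u2 [u3 [u4 [u5 [u6 [Fm Fn [F3 F4] [F5 F6] [U1 U2]]]]]]]] :=
  unimodular_solve mu nu d3 d4 d5 d6.
exists (- (v1 * mu + v2 * nu + v3 * d3 + v4 * d4 + v5 * d5 + v6 * d6 +
  (u1 * mu + u2 * nu + u3 * d3 + u4 * d4 + u5 * d5 + u6 * d6))).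
have sq (s : int) : s ^+ 2 = 1 -> s%:~R ^+ 2 = 1 :> rat by move=> s2; rewrite -rmorphXn /= s2.
have comb (w v v' u u' d : int) : v + w * v' = - 1 -> u + w * u' = d ->
    v + 2 * u + w * (v' + 2 * u') = - (1 - 2 * d).
  by move=> e e'; rewrite -e' opprB -[1]opprK -e; ring.
have H := Sform_dual w30 w40 w50 w60 E3 E4 E5 E6 V1 V2.
have H' := @Sform_dual (v1 + 2 * u1) (v2 + 2 * u2) (v3 + 2 * u3) (v4 + 2 * u4)
  (v5 + 2 * u5) (v6 + 2 * u6) (1 - 2 * d3) (1 - 2 * d4) (1 - 2 * d5) (1 - 2 * d6) mu nu
  w30 w40 w50 w60 (comb _ _ _ _ _ _ E3 F3) (comb _ _ _ _ _ _ E4 F4)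
  (comb _ _ _ _ _ _ E5 F5) (comb _ _ _ _ _ _ E6 F6).
have {}H' := H' (ltac:(rewrite V1 U1; ring)) (ltac:(rewrite V2 U2; ring)).
rewrite !sq // in H'; rewrite !sq // in H.
apply: (mulfI (x := 4)) => //; rewrite H' [RHS]mulrDr H -[RHS]addrA; congr (_ + _).
rewrite (_ : 4 = 4%:Z%:~R :> rat) // -rmorphM -!rmorphN -rmorphD; congr _%:~R.
(* Symmetry of W: u . (W v) = v . (W u). *)
have sym : u1 * (w1 * v1 + v2 + v3 + v4) + u2 * (v1 + w2 * v2 + v5 + v6) +
    u3 * (v1 + w3 * v3) + u4 * (v1 + w4 * v4) + u5 * (v2 + w5 * v5) + u6 * (v2 + w6 * v6) =
    v1 * (w1 * u1 + u2 + u3 + u4) + v2 * (u1 + w2 * u2 + u5 + u6) +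
    v3 * (u1 + w3 * u3) + v4 * (u1 + w4 * u4) + v5 * (u2 + w5 * u5) + v6 * (u2 + w6 * u6).
  by ring.
rewrite Em En E3 E4 E5 E6 Fm Fn F3 F4 F5 F6 in sym.
apply/eqP; rewrite -subr_eq0; apply/eqP.
transitivity (2 * (v1 * mu + v2 * nu + v3 * d3 + v4 * d4 + v5 * d5 + v6 * d6 -
  (u1 * (2 * 0 + 1) + u2 * (2 * 0 + 1) + u3 * -1 + u4 * -1 + u5 * -1 + u6 * -1))).
  by ring.
by rewrite sym subrr mulr0.
Qed.

End Unimodular.

End CompleteSquare.

(** * Absolutely convergent series of complex numbers *)

Section ComplexSeries.
Variable R : realType.
Implicit Types (f g : nat -> R[i]) (C r : R).

Lemma norm_le_ReIm (z : R[i]) :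
  `|z| <= (`|complex.Re z| + `|complex.Im z|)%:C.
Proof.
rewrite [z in leLHS]complexE (le_trans (ler_normD _ _)) // rmorphD lerD //.
  by rewrite normc_def /= expr0n addr0 sqrtr_sqr.
rewrite normrM [`|'i%C|]normc_def /= expr0n expr1n add0r sqrtr1 mul1r.
by rewrite normc_def /= expr0n addr0 sqrtr_sqr.
Qed.

Lemma norm_ge_Im (z : R[i]) : `|complex.Im z|%:C <= `|z|.
Proof.
case: z => a b; rewrite normc_def /= lecR -sqrtr_sqr ler_wsqrtr // lerDr.
exact: sqr_ge0.
Qed.

Lemma cvg_complex (T : Type) (F : set_system T) {FF : Filter F} (f g : T -> R) (a b : R) :
  f @ F --> a -> g @ F --> b -> (fun t => f t +i* g t : R[i]^o) @ F --> (a +i* b : R[i]^o).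
Proof.
move=> /cvgrPdist_lt fa /cvgrPdist_lt gb; apply/cvgrPdist_lt => -[e e'].
rewrite ltcE /= => /andP[/eqP -> e0].
have e2 : 0 < e / 2 by rewrite divr_gt0.
near=> t.
rewrite (le_lt_trans (norm_le_ReIm _)) // ltcR /= [e]splitr ltrD //.
  by near: t; exact: fa.
by near: t; exact: gb.
Unshelve. all: by end_near. Qed.

Definition summ f : R[i] := limn (series f : nat -> R[i]^o).

Lemma summ_eq f (l : R[i]) : series f @ \oo --> (l : R[i]^o) -> summ f = l.
Proof. by apply: (@cvg_lim (R[i]^o)); apply: (@norm_hausdorff _ (R[i]^o)). Qed.

(** Every convergence statement rests on a geometric majorant; the rate r is kept apart from C since
    it survives sums, shifts and bounded factors. *)
Definition dom C r f := forall n, `|f n| <= (C * r ^+ n)%:C.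

Section Dominated.
Variable r : R.
Hypotheses (r0 : 0 <= r) (r1 : r < 1).

Lemma dom_ge0 C f : dom C r f -> 0 <= C.
Proof.
by move=> /(_ 0%N); rewrite expr0 mulr1 => /(le_trans (normr_ge0 _)); rewrite lecR.
Qed.

Lemma real_series_cvg C (u : nat -> R) : 0 <= C -> (forall n, `|u n| <= C * r ^+ n) ->
  cvgn (series u).
Proof.
move=> C0 uC; apply: normed_cvg.
apply: (@series_le_cvg _ _ (geometric C r)) => [n|n|n|].
- exact: normr_ge0.
- by rewrite /geometric mulr_ge0 // exprn_ge0.
- exact: uC.
- by apply: is_cvg_geometric_series; rewrite ger0_norm.
Qed.

Lemma series_complexE f n : series f n =
  series (@complex.Re R \o f) n +i* series (@complex.Im R \o f) n.
Proof.
rewrite /series /=; elim: n => [|n IH]; first by rewrite !big_geq.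
by rewrite !big_nat_recr //= IH; case: (f n).
Qed.

Lemma summ_cvg C f : dom C r f -> series f @ \oo --> (summ f : R[i]^o).
Proof.
move=> fC; have C0 := dom_ge0 fC.
have /cvg_ex[a Ra] : cvgn (series (@complex.Re R \o f)).
  apply: (real_series_cvg C0) => n; rewrite -lecR.
  exact: le_trans (normc_ge_Re _) (fC n).
have /cvg_ex[b Ib] : cvgn (series (@complex.Im R \o f)).
  apply: (real_series_cvg C0) => n; rewrite -lecR.
  exact: le_trans (norm_ge_Im _) (fC n).
have H : series f @ \oo --> (a +i* b : R[i]^o).
  have -> : series f = fun n => series (@complex.Re R \o f) n +i* series (@complex.Im R \o f) n.
    by apply/funext => n; rewrite series_complexE.
  exact: cvg_complex.
by rewrite (summ_eq H).
Qed.

Lemma lim_norm_le (u : nat -> R[i]) (l : R[i]) (B : R) :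
  u @ \oo --> (l : R[i]^o) -> (forall n, `|u n| <= B%:C) -> `|l| <= B%:C.
Proof.
move=> /(@cvgrPdist_lt _ (R[i]^o)) ul uB.
rewrite [`|l|]normc_def lecR; apply/ler_addgt0Pr => e e0.
rewrite -lecR -normc_def.
have [n _ /(_ n (leqnn n)) un] := ul e%:C (ltac:(by rewrite ltcR)).
rewrite -(subrK (u n) l) addrC rmorphD (le_trans (ler_normD _ _)) // lerD //.
exact: ltW.
Qed.

Lemma geo_le n : \sum_(i < n) r ^+ i <= (1 - r)^-1.
Proof.
have r1' : 0 < 1 - r by rewrite subr_gt0.
rewrite -[leRHS]mul1r ler_pdivlMr // mulrC -opprB mulNr -subrX1 opprB.
by rewrite gerBl exprn_ge0.
Qed.

Lemma norm_series C f n : dom C r f -> `|series f n| <= (C / (1 - r))%:C.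
Proof.
move=> fC; have C0 := dom_ge0 fC.
rewrite /series /= big_mkord (le_trans (ler_norm_sum _ _ _)) //.
apply: (@le_trans _ _ (\sum_(i < n) (C * r ^+ i)%:C)); first exact: ler_sum.
rewrite -rmorph_sum -mulr_sumr lecR ler_wpM2l //; exact: geo_le.
Qed.

Lemma norm_summ C f : dom C r f -> `|summ f| <= (C / (1 - r))%:C.
Proof.
move=> fC; apply: (lim_norm_le (summ_cvg fC)) => n; exact: norm_series.
Qed.

Lemma domD C C' f g : dom C r f -> dom C' r g -> dom (C + C') r (fun n => f n + g n).
Proof.
move=> fC gC n; rewrite mulrDl rmorphD (le_trans (ler_normD _ _)) // lerD //.
Qed.

Lemma domM C B f (w : nat -> R[i]) : 0 <= B -> (forall n, `|w n| <= B%:C) ->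
  dom C r f -> dom (B * C) r (fun n => w n * f n).
Proof. by move=> B0 wB fC n; rewrite normrM -mulrA rmorphM ler_pM. Qed.

Lemma dom_shift C f : dom C r f -> dom C r (fun n => f n.+1).
Proof.
move=> fC n; apply: le_trans (fC n.+1) _; rewrite lecR ler_wpM2l ?(dom_ge0 fC) //.
by rewrite exprS ler_piMl ?exprn_ge0 // ltW.
Qed.

Lemma summD C C' f g : dom C r f -> dom C' r g ->
  summ (fun n => f n + g n) = summ f + summ g.
Proof.
move=> fC gC; apply: summ_eq.
have -> : series (fun n => f n + g n) = (series f + series g : nat -> R[i]^o).
  by apply/funext => n; rewrite /series /= big_split.
exact: (@cvgD _ _ _ _ _ (series f : nat -> R[i]^o)) (summ_cvg fC) (summ_cvg gC).
Qed.

Lemma summZ C f (c : R[i]) : dom C r f -> summ (fun n => c * f n) = c * summ f.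
Proof.
move=> fC; apply: summ_eq.
have -> : series (fun n => c * f n) = fun n => c * series f n.
  by apply/funext => n; rewrite /series /= mulr_sumr.
exact: (@cvgMl_tmp R[i] _ _ _ (series f : nat -> R[i]^o)) (summ_cvg fC).
Qed.

Lemma summS C f : dom C r f -> summ f = f 0%N + summ (fun n => f n.+1).
Proof.
move=> fC; apply: summ_eq; rewrite -(@cvg_shiftS (R[i]^o) (series f)) /=.
have E : (fun n => series f n.+1) = (fun n => f 0%N + series (fun n => f n.+1) n).
  by apply/funext => n; rewrite /series /= big_nat_recl.
have := @cvgD R[i] R[i]^o _ _ _ (fun=> f 0%N) _ _ _ (cvg_cst _) (summ_cvg (dom_shift fC)).
rewrite -[X in X @ _]/(fun n => f 0%N + series (fun n => f n.+1) n) -E; exact.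
Qed.

End Dominated.
End ComplexSeries.

(** * Double series with a geometric majorant *)

Section DoubleSeries.
Variable R : realType.
Implicit Types (C r : R) (F : nat -> nat -> R[i]).

Lemma squeeze_norm (T : Type) (G : set_system T) {FG : Filter G}
    (u v : T -> R[i]) (l : R[i]) (B : T -> R) :
  (\forall t \near G, `|u t - v t| <= (B t)%:C) -> B @ G --> (0 : R) ->
  v @ G --> (l : R[i]^o) -> u @ G --> (l : R[i]^o).
Proof.
move=> uv /cvgr0Pnorm_lt B0 /(@cvgrPdist_lt _ (R[i]^o)) vl.
apply/(@cvgrPdist_lt _ (R[i]^o)) => -[e e'].
rewrite ltcE /= => /andP[/eqP -> e0].
have e2 : 0 < e / 2 by rewrite divr_gt0.
near=> t.
have -> : l - u t = (l - v t) - (u t - v t) by rewrite opprB addrA subrK.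
rewrite (le_lt_trans (ler_normB _ _)) // [e]splitr -[_ +i* 0]/(_%:C) rmorphD ltrD //.
  by near: t; apply: vl; rewrite ltcR.
apply: (@le_lt_trans _ _ (B t)%:C); first by near: t.
rewrite ltcR (le_lt_trans (ler_norm _)) //; near: t; exact: B0.
Unshelve. all: by end_near. Qed.

Definition dom2 C r F := forall m n, `|F m n| <= (C * r ^+ m * r ^+ n)%:C.

Section Dominated2.
Variable r : R.
Hypotheses (r0 : 0 <= r) (r1 : r < 1).

Lemma dom2_row C F m : dom2 C r F -> dom (C * r ^+ m) r (F m).
Proof. by move=> FC n; apply: FC. Qed.

Lemma dom2_summ C F : dom2 C r F -> dom (C / (1 - r)) r (fun m => summ (F m)).
Proof.
move=> FC m; rewrite mulrAC.
exact: norm_summ (dom2_row m FC).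
Qed.

Lemma summ_tail C (f : nat -> R[i]) K : dom C r f ->
  `|summ f - series f K| <= (C * r ^+ K / (1 - r))%:C.
Proof.
move=> fC.
suff [dK ->] : dom (C * r ^+ K) r (fun n => f (n + K)%N) /\
    summ f = series f K + summ (fun n => f (n + K)%N).
  by rewrite addrAC subrr add0r; exact: norm_summ.
elim: K => [|K [dK IH]].
  rewrite expr0 mulr1 /series /= big_geq // add0r.
  have -> : (fun n => f (n + 0)%N) = f by apply/funext => n; rewrite addn0.
  by [].
split.
  move=> n; have := fC (n + K.+1)%N.
  by rewrite addnC exprD mulrA.
rewrite IH (summS r0 r1 dK) add0n addrA; congr (_ + _).
  by rewrite /series /= big_nat_recr.
by congr summ; apply/funext => n; rewrite addnS.
Qed.

(** The sum over the square of side K differs from K complete rows by the row tails, which together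
    are at most a constant times r^K. *)
Lemma square_cvg C F : dom2 C r F ->
  (fun K => \sum_(m < K) \sum_(n < K) F m n : R[i]^o) @ \oo -->
    (summ (fun m => summ (F m)) : R[i]^o).
Proof.
move=> FC.
have C0 : 0 <= C.
  by have := FC 0%N 0%N; rewrite !mulr1 => /(le_trans (normr_ge0 _)); rewrite lecR.
pose B := C / (1 - r) / (1 - r).
apply: (@squeeze_norm _ _ _ _ (series (fun m => summ (F m))) _ (geometric B r)).
- near=> K.
  rewrite /series /= big_mkord -sumrB (le_trans (ler_norm_sum _ _ _)) //.
  apply: (@le_trans _ _ (\sum_(m < K) (C / (1 - r) * r ^+ K * r ^+ m)%:C)).
    apply: ler_sum => m _; rewrite distrC.
    have := summ_tail K (dom2_row m FC).
    rewrite /series /= big_mkord => /le_trans -> //.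
    by rewrite lecR le_eqVlt; apply/orP; left; apply/eqP; ring.
  rewrite -rmorph_sum -mulr_sumr lecR /geometric /= /B.
  have -> : C / (1 - r) / (1 - r) * r ^+ K = C / (1 - r) * r ^+ K * (1 - r)^-1 by ring.
  by rewrite ler_wpM2l ?geo_le // mulr_ge0 ?exprn_ge0 // divr_ge0 // subr_ge0 ltW.
- by apply: cvg_geometric; rewrite ger0_norm.
- exact: summ_cvg (dom2_summ FC).
Unshelve. all: by end_near. Qed.

Lemma dsumE C F : dom2 C r F -> dsum F = summ (fun m => summ (F m)).
Proof.
move=> FC; apply: (@cvg_lim (R[i]^o)); first exact: (@norm_hausdorff _ (R[i]^o)).
exact: square_cvg FC.
Qed.

Lemma esum_geometric C : 0 <= C ->
  (\esum_(n in [set: nat]) (C * r ^+ n)%:E <= (C / (1 - r))%:E)%E.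
Proof.
move=> C0; have ge0 n : (0 <= (C * r ^+ n)%:E)%E by rewrite lee_fin mulr_ge0 ?exprn_ge0.
rewrite -nneseries_esumT //; apply: lime_le; first exact: is_cvg_nneseries.
apply: nearW => n; rewrite sumEFin lee_fin -mulr_sumr big_mkord.
by rewrite ler_wpM2l ?geo_le.
Qed.

Lemma dom2_summable C F : dom2 C r F -> dsummable F.
Proof.
move=> FC.
have C0 : 0 <= C.
  by have := FC 0%N 0%N; rewrite !mulr1 => /(le_trans (normr_ge0 _)); rewrite lecR.
have r1' : 0 < 1 - r by rewrite subr_gt0.
have g0 i j : 0 <= C * r ^+ i * r ^+ j by rewrite !mulr_ge0 ?exprn_ge0.
apply: (@le_lt_trans _ _ (C / (1 - r) / (1 - r))%:E); last exact: ltry.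
have -> : [set: nat * nat] = [set: nat] `*`` (fun=> [set: nat]) by apply/seteqP; split.
apply: (@le_trans _ _
  (\esum_(p in [set: nat] `*`` (fun=> [set: nat])) (C * r ^+ p.1 * r ^+ p.2)%:E)%E).
  apply: le_esum => p _; rewrite abse_EFin lee_fin.
  have -> : complex.Re `|F p.1 p.2| =
      Num.sqrt (complex.Re (F p.1 p.2) ^+ 2 + complex.Im (F p.1 p.2) ^+ 2).
    by rewrite normc_def.
  by rewrite ger0_norm ?sqrtr_ge0 // -lecR -normc_def.
rewrite -(@esum_esum R nat nat [set: nat] (fun=> [set: nat])
  (fun i j => (C * r ^+ i * r ^+ j)%:E)); last by move=> i j _ _; rewrite lee_fin.
apply: (@le_trans _ _ (\esum_(i in [set: nat]) (C / (1 - r) * r ^+ i)%:E)%E).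
  apply: le_esum => i _; rewrite mulrAC; apply: esum_geometric.
  by rewrite mulr_ge0 ?exprn_ge0.
by apply: esum_geometric; rewrite divr_ge0 // ltW.
Qed.

End Dominated2.
End DoubleSeries.

(** * Abel summation *)

Section AbelSummation.
Variable R : realType.
Implicit Types (C s : R) (w : R[i]).

(* Every difference, up to order d, gains a factor s. *)
Fixpoint disc1 s C (d p : nat) (f : nat -> R) : Prop :=
  (forall n, `|f n| <= C * s ^+ p * expR (- s) ^+ n) /\
  if d is d'.+1 then disc1 s C d' p.+1 (fun n => f n.+1 - f n) else True.

Fixpoint disc2 s C (d p : nat) (f : nat -> nat -> R) : Prop :=
  (forall m n, `|f m n| <= C * s ^+ p * expR (- s) ^+ m * expR (- s) ^+ n) /\
  if d is d'.+1 then
    disc2 s C d' p.+1 (fun m n => f m.+1 n - f m n) /\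
    disc2 s C d' p.+1 (fun m n => f m n.+1 - f m n)
  else True.

Lemma disc2_row s C d p f m : 0 <= C -> 0 < s -> disc2 s C d p f -> disc1 s C d p (f m).
Proof.
move=> C0 s0; elim: d p f => [|d IH] p f [fC H]; split=> //.
- move=> n; apply: le_trans (fC m n) _.
  rewrite ler_wpM2r ?exprn_ge0 ?expR_ge0 // -[leRHS]mulr1.
  rewrite ler_wpM2l ?exprn_ile1 ?expR_ge0 ?mulr_ge0 ?exprn_ge0 // 1?ltW //.
  by rewrite -expR0 ltr_expR oppr_lt0.
- move=> n; apply: le_trans (fC m n) _.
  rewrite ler_wpM2r ?exprn_ge0 ?expR_ge0 // -[leRHS]mulr1.
  rewrite ler_wpM2l ?exprn_ile1 ?expR_ge0 ?mulr_ge0 ?exprn_ge0 // 1?ltW //.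
  by rewrite -expR0 ltr_expR oppr_lt0.
- by case: H => _ /IH.
Qed.

Lemma disc2_col s C d p f n : 0 <= C -> 0 < s -> disc2 s C d p f ->
  disc1 s C d p (f^~ n).
Proof.
move=> C0 s0; elim: d p f => [|d IH] p f [fC H]; split=> //.
- move=> m; apply: le_trans (fC m n) _; rewrite mulrAC.
  rewrite ler_wpM2r ?exprn_ge0 ?expR_ge0 // -[leRHS]mulr1.
  rewrite ler_wpM2l ?exprn_ile1 ?expR_ge0 ?mulr_ge0 ?exprn_ge0 // 1?ltW //.
  by rewrite -expR0 ltr_expR oppr_lt0.
- move=> m; apply: le_trans (fC m n) _; rewrite mulrAC.
  rewrite ler_wpM2r ?exprn_ge0 ?expR_ge0 // -[leRHS]mulr1.
  rewrite ler_wpM2l ?exprn_ile1 ?expR_ge0 ?mulr_ge0 ?exprn_ge0 // 1?ltW //.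
  by rewrite -expR0 ltr_expR oppr_lt0.
- by case: H => /IH.
Qed.

Definition S1 w (f : nat -> R[i]) : R[i] := summ (fun n => w ^+ n * f n).

Section Rate.
Variable r : R.
Hypotheses (r0 : 0 <= r) (r1 : r < 1).

Lemma dom_char C w f : `|w| = 1 -> dom C r f -> dom C r (fun n => w ^+ n * f n).
Proof. by move=> w1 fC n; rewrite normrM normrX w1 expr1n mul1r. Qed.

Lemma norm_S1 C w f : `|w| = 1 -> dom C r f -> `|S1 w f| <= (C / (1 - r))%:C.
Proof. move=> w1 fC; exact: norm_summ (dom_char w1 fC). Qed.

Lemma dom_diff C f : dom C r f -> dom (C + C) r (fun n => f n.+1 - f n).
Proof.
move=> fC; have := domD (dom_shift r0 r1 fC) (domM (w := fun=> -1) ler01 _ fC).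
rewrite mul1r => H n; have := H _ n; rewrite mulN1r; apply=> _.
by rewrite normrN normr1.
Qed.

Lemma S1D C C' w f g : `|w| = 1 -> dom C r f -> dom C' r g ->
  S1 w (fun n => f n + g n) = S1 w f + S1 w g.
Proof.
move=> w1 fC gC; rewrite /S1 -(summD r0 r1 (dom_char w1 fC) (dom_char w1 gC)).
by congr summ; apply/funext => n; rewrite mulrDr.
Qed.

Lemma S1Z C w f (c : R[i]) : `|w| = 1 -> dom C r f ->
  S1 w (fun n => c * f n) = c * S1 w f.
Proof.
move=> w1 fC; rewrite /S1 -(summZ r0 r1 _ (dom_char w1 fC)).
by congr summ; apply/funext => n; rewrite mulrCA.
Qed.

Lemma S1_shift C w f : `|w| = 1 -> dom C r f ->
  S1 w f = f 0%N + w * S1 w (fun n => f n.+1).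
Proof.
move=> w1 fC; rewrite /S1 (summS r0 r1 (dom_char w1 fC)) expr0 mul1r; congr (_ + _).
rewrite -(summZ r0 r1 _ (dom_char w1 (dom_shift r0 r1 fC))).
by congr summ; apply/funext => n; rewrite exprS mulrA.
Qed.

(** Summation by parts. When w != 1, dividing by 1 - w replaces f by its difference and so gains an
    order in s. *)
Lemma abel_summation C w f : `|w| = 1 -> dom C r f ->
  (1 - w) * S1 w f = f 0%N + w * S1 w (fun n => f n.+1 - f n).
Proof.
move=> w1 fC; have E := S1_shift w1 fC.
have : S1 w (fun n => f n.+1) = S1 w (fun n => f n.+1 - f n) + S1 w f.
  rewrite -(S1D w1 (dom_diff fC) fC); congr S1.
  by apply/funext => n; rewrite subrK.
move=> E'; rewrite mulrBl mul1r {1}E E'; ring.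
Qed.

End Rate.

Lemma rate_ge0 s : 0 <= expR (- s). Proof. exact: expR_ge0. Qed.

Lemma rate_lt1 s : 0 < s -> expR (- s) < 1.
Proof. by move=> s0; rewrite -expR0 ltr_expR oppr_lt0. Qed.

(** Each summation thus costs at most a factor 2/s. The restriction s <= 1 gives 1 - exp(-s) >=
    s/2. *)
Lemma rate_bound s : 0 < s <= 1 -> (1 - expR (- s))^-1 <= 2 / s.
Proof.
move=> /andP[s0 s1]; have e1 := rate_lt1 s0.
rewrite -[2 / s]invrK lef_pV2 ?posrE ?invr_gt0 ?subr_gt0 ?divr_gt0 // invf_div.
have : 1 + s <= expR s by apply: expR_ge1Dx.
rewrite expRN => H; have E0 := expR_gt0 s.
have : (expR s)^-1 <= (1 + s)^-1 by rewrite lef_pV2 ?posrE // addr_gt0.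
have : (1 + s)^-1 <= 1 - s / 2; last by lra.
rewrite -[leLHS]mul1r ler_pdivrMr ?addr_gt0 //.
by nra.
Qed.

Definition nrm (z : R[i]) : R := Num.sqrt (complex.Re z ^+ 2 + complex.Im z ^+ 2).

Lemma nrmE z : `|z| = (nrm z)%:C. Proof. exact: normc_def. Qed.

Lemma nrm_gt0 z : z != 0 -> 0 < nrm z.
Proof. by rewrite -normr_gt0 nrmE ltcR. Qed.

Lemma solve_bound w (T g D : R[i]) (x y : R) : `|w| = 1 -> w != 1 ->
  (1 - w) * T = g + w * D -> `|g| <= x%:C -> `|D| <= y%:C ->
  `|T| <= ((x + y) / nrm (1 - w))%:C.
Proof.
move=> w1 wn1 E gx Dy.
have n0 : 0 < nrm (1 - w) by apply: nrm_gt0; rewrite subr_eq0 eq_sym.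
rewrite rmorphM fmorphV /= ler_pdivlMr ?ltcR // -nrmE mulrC -normrM E.
by rewrite rmorphD (le_trans (ler_normD _ _)) // lerD // normrM w1 mul1r.
Qed.

Lemma norm_real (x : R) : `|x%:C| = `|x|%:C.
Proof. by rewrite normc_def /= expr0n addr0 sqrtr_sqr. Qed.

Definition S2 w w' (f : nat -> nat -> R) : R[i] := S1 w (fun m => S1 w' (fun n => (f m n)%:C)).

Section Estimates.
Variables (s C : R).
Hypotheses (s01 : 0 < s <= 1) (C0 : 0 <= C).

Let s0 : 0 < s. Proof. by case/andP: s01. Qed.
Let r0 := rate_ge0 s.
Let r1 := rate_lt1 s0.

Lemma disc1_dom d p f : disc1 s C d p f -> dom (C * s ^+ p) (expR (- s)) (fun n => (f n)%:C).
Proof. by case: d => [|d] [fC _] n; rewrite norm_real lecR. Qed.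

Lemma disc2_dom2 d p f : disc2 s C d p f ->
  dom2 (C * s ^+ p) (expR (- s)) (fun m n => (f m n)%:C).
Proof. by case: d => [|d] [fC _] m n; rewrite norm_real lecR. Qed.

Lemma rate_div x p : 0 <= x -> x * s ^+ p.+1 / (1 - expR (- s)) <= 2 * x * s ^+ p.
Proof.
move=> x0; apply: (@le_trans _ _ (x * s ^+ p.+1 * (2 / s))).
  by rewrite ler_wpM2l ?rate_bound // mulr_ge0 // exprn_ge0 // ltW.
rewrite exprS; have := lt0r_neq0 s0 => sn0.
by rewrite le_eqVlt; apply/orP; left; apply/eqP; field.
Qed.

Lemma S1_small w d p f : `|w| = 1 -> disc1 s C d p.+1 f ->
  `|S1 w (fun n => (f n)%:C)| <= (2 * C * s ^+ p)%:C.
Proof.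
move=> w1 /disc1_dom fC; apply: le_trans (norm_S1 r0 r1 w1 fC) _.
by rewrite lecR rate_div.
Qed.

Lemma dom2_S1 d p w f : `|w| = 1 -> disc2 s C d p f ->
  dom (C * s ^+ p / (1 - expR (- s))) (expR (- s)) (fun m => S1 w (fun n => (f m n)%:C)).
Proof.
move=> w1 /disc2_dom2 fC m; rewrite mulrAC.
by apply: (norm_S1 r0 r1 w1) => n; apply: fC.
Qed.

Lemma S2_small w w' d p f : `|w| = 1 -> `|w'| = 1 -> disc2 s C d p.+2 f ->
  `|S2 w w' f| <= (4 * C * s ^+ p)%:C.
Proof.
move=> w1 w1' fC; apply: le_trans (norm_S1 r0 r1 w1 (dom2_S1 w1' fC)) _.
rewrite lecR; have c2 : 0 <= 2 * C by rewrite mulr_ge0.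
have -> : 4 * C = 2 * (2 * C) by ring.
apply: le_trans (rate_div p c2); rewrite ler_wpM2r ?invr_ge0 ?subr_ge0 ?(ltW r1) //.
exact: rate_div.
Qed.

(** Counting orders: a bare sum loses one power of s, and an Abel step with w != 1 wins it back. The
    constant 3 is 1 for the boundary term plus 2 for the sum of differences. *)
Lemma S1_order1 w d f : `|w| = 1 -> w != 1 -> disc1 s C d.+1 1 f ->
  `|S1 w (fun n => (f n)%:C)| <= (3 / nrm (1 - w) * (C * s))%:C.
Proof.
move=> w1 wn1 fC; have [f0 Df] := fC.
have := abel_summation r0 r1 w1 (disc1_dom fC).
have -> : (fun n => (f n.+1)%:C - (f n)%:C) = (fun n => (f n.+1 - f n)%:C).
  by apply/funext => n; rewrite rmorphB.
move=> /(solve_bound w1 wn1) H.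
have -> : 3 / nrm (1 - w) * (C * s) = (C * s + 2 * C * s) / nrm (1 - w) by ring.
apply: H; last by rewrite -[s in X in _ <= X]expr1; exact: S1_small Df.
by rewrite norm_real lecR; have := f0 0%N; rewrite expr0 mulr1 expr1.
Qed.

Lemma S1_order0 w d f : `|w| = 1 -> w != 1 -> disc1 s C d.+2 0 f ->
  `|(1 - w) * S1 w (fun n => (f n)%:C) - (f 0%N)%:C| <= (3 / nrm (1 - w) * (C * s))%:C.
Proof.
move=> w1 wn1 fC; have [f0 Df] := fC.
rewrite (abel_summation r0 r1 w1 (disc1_dom fC)) addrAC subrr add0r normrM w1 mul1r.
have -> : (fun n => (f n.+1)%:C - (f n)%:C) = (fun n => (f n.+1 - f n)%:C).
  by apply/funext => n; rewrite rmorphB.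
exact: S1_order1 Df.
Qed.

Lemma abel_y w w' d p f : `|w| = 1 -> `|w'| = 1 -> disc2 s C d p f ->
  (1 - w') * S2 w w' f = S1 w (fun m => (f m 0%N)%:C) +
    w' * S2 w w' (fun m n => f m n.+1 - f m n).
Proof.
move=> w1 w1' fC; have fd := disc2_dom2 fC.
have rowd m : dom (C * s ^+ p * expR (- s) ^+ m) (expR (- s)) (fun n => (f m n)%:C).
  by move=> n; apply: fd.
rewrite /S2 -(S1Z r0 r1 _ w1 (dom2_S1 w1' fC)).
have E m : (1 - w') * S1 w' (fun n => (f m n)%:C) =
    (f m 0%N)%:C + w' * S1 w' (fun n => (f m n.+1 - f m n)%:C).
  rewrite (abel_summation r0 r1 w1' (rowd m)); congr (_ + _ * S1 _ _).
  by apply/funext => n; rewrite rmorphB.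
rewrite (_ : (fun m => (1 - w') * _) = (fun m => (f m 0%N)%:C +
    w' * S1 w' (fun n => (f m n.+1 - f m n)%:C))); last exact/funext.
have d1 : dom (C * s ^+ p) (expR (- s)) (fun m => (f m 0%N)%:C).
  by move=> m; have := fd m 0%N; rewrite expr0 mulr1.
have d2 : dom ((C * s ^+ p + C * s ^+ p) / (1 - expR (- s))) (expR (- s))
    (fun m => S1 w' (fun n => (f m n.+1 - f m n)%:C)).
  move=> m; have := norm_S1 r0 r1 w1' (dom_diff r0 r1 (rowd m)).
  have -> : (fun n => (f m n.+1)%:C - (f m n)%:C) = (fun n => (f m n.+1 - f m n)%:C).
    by apply/funext => n; rewrite rmorphB.
  by rewrite -mulrDl mulrAC.
have d3 := domM (w := fun=> w') ler01 _ d2.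
rewrite (S1D r0 r1 w1 d1 (d3 _)) => [|n]; last by rewrite w1'.
by rewrite (S1Z r0 r1 _ w1 d2).
Qed.

Lemma abel_x w w' d p f : `|w| = 1 -> `|w'| = 1 -> disc2 s C d p f ->
  (1 - w) * S2 w w' f = S1 w' (fun n => (f 0%N n)%:C) +
    w * S2 w w' (fun m n => f m.+1 n - f m n).
Proof.
move=> w1 w1' fC; have fd := disc2_dom2 fC.
have rowd m : dom (C * s ^+ p * expR (- s) ^+ m) (expR (- s)) (fun n => (f m n)%:C).
  by move=> n; apply: fd.
rewrite /S2 (abel_summation r0 r1 w1 (dom2_S1 w1' fC)); congr (_ + _ * S1 _ _).
apply/funext => m; rewrite -mulN1r -(S1Z r0 r1 _ w1' (rowd m)).
have d3 := domM (w := fun=> -1) ler01 _ (rowd m).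
rewrite -(S1D r0 r1 w1' (rowd m.+1) (d3 _)) => [|n]; last by rewrite normrN normr1.
by congr S1; apply/funext => n; rewrite mulN1r rmorphB.
Qed.

(** The estimate for w = 1: order 2 pays for both summations, and the Abel step in n supplies the
    remaining factor s. The constant 6 is 2 for the boundary sum plus 4 for the double sum. *)
Lemma S2_order2_y w w' d f : `|w| = 1 -> `|w'| = 1 -> w' != 1 -> disc2 s C d.+1 2 f ->
  `|S2 w w' f| <= (6 / nrm (1 - w') * (C * s))%:C.
Proof.
move=> w1 w1' wn1 fC; have [_ [_ Df]] := fC.
have := abel_y w1 w1' fC => /(solve_bound w1' wn1) H.
have -> : 6 / nrm (1 - w') * (C * s) = (2 * C * s + 4 * C * s) / nrm (1 - w') by ring.
apply: H; rewrite -[s in X in _ <= X]expr1.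
  exact: S1_small w1 (disc2_col 0%N C0 s0 fC).
exact: S2_small Df.
Qed.

Lemma S2_order1 w w' d f : `|w| = 1 -> `|w'| = 1 -> w != 1 -> w' != 1 ->
  disc2 s C d.+2 1 f ->
  `|S2 w w' f| <= ((3 / nrm (1 - w) + 6 / nrm (1 - w')) / nrm (1 - w') * (C * s))%:C.
Proof.
move=> w1 w1' wn1 wn1' fC; have [_ [_ Df]] := fC.
have := abel_y w1 w1' fC => /(solve_bound w1' wn1') H.
rewrite mulrAC mulrDl; apply: H; last exact: S2_order2_y Df.
exact: S1_order1 w1 wn1 (disc2_col 0%N C0 s0 fC).
Qed.

(** An Abel step in m leaves a boundary sum over n, whose main term is f(0, 0), and a double sum of
    order 1, which is O(s) by [S2_order1]. *)
Lemma S2_order0 w w' d f : `|w| = 1 -> `|w'| = 1 -> w != 1 -> w' != 1 ->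
  disc2 s C d.+3 0 f ->
  `|(1 - w) * (1 - w') * S2 w w' f - (f 0%N 0%N)%:C| <=
  ((3 / nrm (1 - w') + (3 / nrm (1 - w) + 6 / nrm (1 - w'))) * (C * s))%:C.
Proof.
move=> w1 w1' wn1 wn1' fC; have [_ [Df _]] := fC.
have n0 : nrm (1 - w') != 0.
  by apply/eqP => z; have := @nrm_gt0 (1 - w'); rewrite z ltxx subr_eq0 eq_sym => /(_ wn1').
have -> : (1 - w) * (1 - w') * S2 w w' f - (f 0%N 0%N)%:C =
   ((1 - w') * S1 w' (fun n => (f 0%N n)%:C) - (f 0%N 0%N)%:C) +
   w * ((1 - w') * S2 w w' (fun m n => f m.+1 n - f m n)).
  rewrite [_ * (1 - w')]mulrC -mulrA (abel_x w1 w1' fC); ring.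
rewrite (le_trans (ler_normD _ _)) // [X in _ <= X%:C]mulrDl rmorphD lerD //.
  exact: S1_order0 w1' wn1' (disc2_row 0%N C0 s0 fC).
rewrite normrM w1 mul1r normrM.
have H := S2_order1 w1 w1' wn1 wn1' Df.
apply: le_trans (ler_wpM2l (normr_ge0 _) H) _.
rewrite nrmE -rmorphM lecR le_eqVlt; apply/orP; left; apply/eqP.
set A := 3 / _ + 6 / _; by field.
Qed.

End Estimates.

End AbelSummation.

(** * Derivatives of scaled Gaussians *)

Section SmoothDecay.
Variable R : realType.
Implicit Types (s C x y h : R) (F G : R -> R -> R).

(* The smooth counterpart of disc2: every derivative gains a factor s. *)
Fixpoint nice s C (n p : nat) F : Prop :=
  (forall x y, 0 <= x -> 0 <= y -> `|F x y| <= C * s ^+ p * expR (- (s * (x + y)))) /\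
  if n is n'.+1 then
    exists Fx Fy, [/\ forall x y, is_derive x 1 (F^~ y) (Fx x y),
      forall x y, is_derive y 1 (F x) (Fy x y), nice s C n' p.+1 Fx & nice s C n' p.+1 Fy]
  else True.

Lemma nice_le s C C' n p F : 0 <= s -> C <= C' -> nice s C n p F -> nice s C' n p F.
Proof.
move=> s0 CC; elim: n p F => [|n IH] p F [FC H].
  split=> // x y x0 y0; apply: le_trans (FC x y x0 y0) _.
  by rewrite ler_wpM2r ?expR_ge0 // ler_wpM2r ?exprn_ge0.
split=> [x y x0 y0|].
  apply: le_trans (FC x y x0 y0) _.
  by rewrite ler_wpM2r ?expR_ge0 // ler_wpM2r ?exprn_ge0.
by case: H => Fx [Fy [dx dy Nx Ny]]; exists Fx, Fy; split => //; exact: IH.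
Qed.

(** Three terms, because the derivative of a Gaussian monomial has three. *)
Lemma nice_comb3 s (a1 a2 a3 C1 C2 C3 : R) n p (F1 F2 F3 : R -> R -> R) :
  nice s C1 n p F1 -> nice s C2 n p F2 -> nice s C3 n p F3 ->
  nice s (`|a1| * C1 + `|a2| * C2 + `|a3| * C3) n p
    (fun x y => a1 * F1 x y + a2 * F2 x y + a3 * F3 x y).
Proof.
have bound (q : nat) (G1 G2 G3 : R -> R -> R) :
   (forall x y, 0 <= x -> 0 <= y -> `|G1 x y| <= C1 * s ^+ q * expR (- (s * (x + y)))) ->
   (forall x y, 0 <= x -> 0 <= y -> `|G2 x y| <= C2 * s ^+ q * expR (- (s * (x + y)))) ->
   (forall x y, 0 <= x -> 0 <= y -> `|G3 x y| <= C3 * s ^+ q * expR (- (s * (x + y)))) ->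
   forall x y, 0 <= x -> 0 <= y -> `|a1 * G1 x y + a2 * G2 x y + a3 * G3 x y| <=
     (`|a1| * C1 + `|a2| * C2 + `|a3| * C3) * s ^+ q * expR (- (s * (x + y))).
  move=> B1 B2 B3 x y x0 y0; rewrite !mulrDl.
  apply: le_trans (ler_normD _ _) _; apply: lerD; last first.
    by rewrite normrM -!mulrA ler_wpM2l // mulrA B3.
  apply: le_trans (ler_normD _ _) _.
  by rewrite !normrM -!mulrA lerD // ler_wpM2l // mulrA ?B1 ?B2.
elim: n p F1 F2 F3 => [|n IH] p F1 F2 F3 [N1 H1] [N2 H2] [N3 H3].
  by split=> //; exact: bound.
split; first exact: bound.
case: H1 => F1x [F1y [d1x d1y N1x N1y]]; case: H2 => F2x [F2y [d2x d2y N2x N2y]].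
case: H3 => F3x [F3y [d3x d3y N3x N3y]].
exists (fun x y => a1 * F1x x y + a2 * F2x x y + a3 * F3x x y).
exists (fun x y => a1 * F1y x y + a2 * F2y x y + a3 * F3y x y).
split; [move=> x y|move=> x y|exact: IH|exact: IH].
  exact: (is_deriveD (is_deriveD (is_deriveZ a1 (d1x x y)) (is_deriveZ a2 (d2x x y)))
    (is_deriveZ a3 (d3x x y))).
exact: (is_deriveD (is_deriveD (is_deriveZ a1 (d1y x y)) (is_deriveZ a2 (d2y x y)))
  (is_deriveZ a3 (d3y x y))).
Qed.

Lemma is_derive_translate (f : R -> R) (df a x : R) :
  is_derive (x + a) 1 f df -> is_derive x 1 (fun u => f (u + a)) df.
Proof.
move=> fd; have g := is_deriveD (is_derive_id x (1 : R)) (is_derive_cst a x (1 : R)).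
have := @is_derive1_comp R f _ x _ _ fd g.
by rewrite addr0 mulr1.
Qed.

Lemma nice_shift s C n p F (a b : R) : 0 <= s -> 0 <= C -> 0 <= a -> 0 <= b ->
  nice s C n p F -> nice s C n p (fun x y => F (x + a) (y + b)).
Proof.
move=> s0 C0 a0 b0; elim: n p F => [|n IH] p F [FC H].
  split=> // x y x0 y0; apply: le_trans (FC _ _ (addr_ge0 x0 a0) (addr_ge0 y0 b0)) _.
  rewrite ler_wpM2l ?mulr_ge0 ?exprn_ge0 // ler_expR lerN2 ler_wpM2l //.
  by rewrite lerD // lerDl.
split=> [x y x0 y0|].
  apply: le_trans (FC _ _ (addr_ge0 x0 a0) (addr_ge0 y0 b0)) _.
  rewrite ler_wpM2l ?mulr_ge0 ?exprn_ge0 // ler_expR lerN2 ler_wpM2l //.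
  by rewrite lerD // lerDl.
case: H => Fx [Fy [dx dy Nx Ny]].
exists (fun x y => Fx (x + a) (y + b)), (fun x y => Fy (x + a) (y + b)).
split=> [x y|x y| |]; [|exact: is_derive_translate|exact: IH|exact: IH].
exact: (@is_derive_translate (F^~ (y + b))).
Qed.

Lemma norm_increment (f df : R -> R) (a h B : R) : 0 <= h ->
  (forall x, is_derive x 1 f (df x)) ->
  (forall x, a <= x <= a + h -> `|df x| <= B) -> `|f (a + h) - f a| <= h * B.
Proof.
move=> h0 fd dB.
have [||c] := @MVT_segment R f df a (a + h) _ (fun x _ => fd x); first by rewrite lerDl.

- by apply: derivable_within_continuous => x _; case: (fd x).
rewrite in_itv /= => /dB cB ->; rewrite [a + h]addrC addrK normrM (ger0_norm h0) mulrC.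
exact: ler_wpM2l.
Qed.

(** Mean value theorem: the derivative carries one more factor s, and with h >= 0 the exponential at
    the intermediate point is at most its value at x. *)
Lemma nice_diffx s C n p F h : 0 <= s -> 0 <= C -> 0 <= h ->
  nice s C n.+1 p F -> nice s (h * C) n p.+1 (fun x y => F (x + h) y - F x y).
Proof.
move=> s0 C0 h0; elim: n p F => [|n IH] p F [FC [Fx [Fy [dx dy [NxB Nx] Ny]]]];
  (split=> [x y x0 y0|//]; first (
    rewrite -!mulrA;
    apply: (@norm_increment (F^~ y) (Fx^~ y)) => // u /andP[xu _];
    apply: le_trans (NxB _ _ (le_trans x0 xu) y0) _;
    by rewrite mulrA ler_wpM2l ?mulr_ge0 ?exprn_ge0 // ler_expR lerN2 ler_wpM2l // lerD2r)).
exists (fun x y => Fx (x + h) y - Fx x y), (fun x y => Fy (x + h) y - Fy x y).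
split=> [x y|x y| |].
- exact: (is_deriveB (@is_derive_translate (F^~ y) _ _ _ (dx _ _)) (dx x y)).
- exact: (is_deriveB (dy (x + h) y) (dy x y)).
- exact: (IH p.+1 Fx).
- exact: (IH p.+1 Fy).
Qed.

Lemma nice_swap s C n p F : nice s C n p F -> nice s C n p (fun x y => F y x).
Proof.
elim: n p F => [|n IH] p F [FC H].
  by split=> // x y x0 y0; rewrite addrC; exact: FC.
split=> [x y x0 y0|]; first by rewrite addrC; exact: FC.
case: H => Fx [Fy [dx dy Nx Ny]].
by exists (fun x y => Fy y x), (fun x y => Fx y x); split => // *; apply: IH.
Qed.

Lemma nice_diffy s C n p F h : 0 <= s -> 0 <= C -> 0 <= h ->
  nice s C n.+1 p F -> nice s (h * C) n p.+1 (fun x y => F x (y + h) - F x y).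
Proof.
move=> s0 C0 h0 /nice_swap/(nice_diffx s0 C0 h0)/nice_swap; exact.
Qed.

Lemma nice_disc2 s C n p F : 0 <= s -> 0 <= C ->
  nice s C n p F -> disc2 s C n p (fun i j => F i%:R j%:R).
Proof.
move=> s0 C0.
have B (q : nat) (G : R -> R -> R) :
    (forall x y, 0 <= x -> 0 <= y -> `|G x y| <= C * s ^+ q * expR (- (s * (x + y)))) ->
    forall i j : nat, `|G i%:R j%:R| <= C * s ^+ q * expR (- s) ^+ i * expR (- s) ^+ j.
  move=> GC i j; apply: le_trans (GC _ _ (ler0n _ _) (ler0n _ _)) _.
  by rewrite mulrDr opprD expRD -!mulNr !expRM_natr mulrA.
elim: n p F => [|n IH] p F NF.
  by case: NF => FC _; split=> //; exact: B.
split; first by case: NF => FC _; exact: B.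
have Dx := nice_diffx s0 C0 ler01 NF; have Dy := nice_diffy s0 C0 ler01 NF.
rewrite mul1r in Dx Dy; split.
  have := IH _ _ Dx; congr disc2; apply/funext => i; apply/funext => j.
  by rewrite natr1.
have := IH _ _ Dy; congr disc2; apply/funext => i; apply/funext => j.
by rewrite natr1.
Qed.

Lemma is_derive_mono (s k a b c u : R) (i : nat) :
  is_derive u 1 (fun v => (s * v) ^+ i * k * expR (- (a * v ^+ 2 + b * v + c)))
   ((i%:R * s * (s * u) ^+ i.-1 - (s * u) ^+ i * (2 * a * u + b)) * k *
    expR (- (a * u ^+ 2 + b * u + c))).
Proof.
have d1 : is_derive u 1 (fun v : R => (s * v) ^+ i * k) (i%:R * s * (s * u) ^+ i.-1 * k).
  have -> : (fun v : R => (s * v) ^+ i * k) = horner ((k * s ^+ i) *: 'X^i).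
    by apply/funext => v; rewrite !hornerE exprMn mulrC mulrA.
  apply: is_derive_eq; rewrite derivZ derivXn hornerZ hornerMn hornerXn.
  case: i => [|i]; first by rewrite mulr0n mulr0 !mul0r.
  rewrite /= exprS exprMn -mulr_natr; ring.
have d2 : is_derive u 1 (fun v : R => a * v ^+ 2 + b * v + c) (2 * a * u + b).
  have -> : (fun v : R => a * v ^+ 2 + b * v + c) = horner (a *: 'X^2 + b *: 'X + c%:P).
    by apply/funext => v; rewrite !hornerE.
  apply: is_derive_eq; rewrite derivD derivD !derivZ derivXn derivX derivC !hornerE; ring.
have dE := @is_derive1_comp R expR _ u _ _ (is_derive_expR _) (is_deriveN d2).
apply: (is_derive_eq (is_deriveM d1 dE)).
rewrite /GRing.scale /=. ring.
Qed.

Section Gaussian.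
Variables A B C' : R.
Hypotheses (A0 : 0 < A) (B0 : 0 <= B) (C0' : 0 < C').

(** Monomials in the rescaled variables s x and s y: a derivative is s times a combination of
    functions of the same shape, so the family is closed under differentiation with the right
    gain. *)
Definition gauss_mono s (i j : nat) x y : R :=
  (s * x) ^+ i * (s * y) ^+ j *
  expR (- (s ^+ 2 * (A * x ^+ 2 + 2 * B * x * y + C' * y ^+ 2))).

Lemma expn_le_expR (i : nat) x : 0 <= x -> x ^+ i <= i`!%:R * expR x.
Proof.
move=> x0; case: i => [|i]; first by rewrite expr0 mul1r -expR0 ler_expR.
rewrite mulrC -ler_pdivrMr ?ltr0n ?fact_gt0 //.
by apply: le_trans (expR_ge1Dxn i x0); rewrite lerDr.
Qed.

(** On the quadrant the cross term only helps. With X = s x, Y = s y, the inequality A X^2 >= 2 X -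
    1/A yields exp(-2 X): one exp(-X) absorbs X^i <= i! exp(X), the other is the announced decay.
    The form itself may be indefinite. *)
Lemma gauss_mono_bound (i j : nat) : exists2 C, 0 <= C & forall s x y,
  0 < s -> 0 <= x -> 0 <= y -> `|gauss_mono s i j x y| <= C * expR (- (s * (x + y))).
Proof.
exists (i`!%:R * j`!%:R * expR (A^-1 + C'^-1)).
  by rewrite mulr_ge0 ?expR_ge0 // mulr_ge0 ?ler0n.
move=> s x y s0 x0 y0; rewrite /gauss_mono.
set X := s * x; set Y := s * y.
have X0 : 0 <= X by rewrite mulr_ge0 // ltW.
have Y0 : 0 <= Y by rewrite mulr_ge0 // ltW.
rewrite ger0_norm ?mulr_ge0 ?exprn_ge0 ?expR_ge0 //.
have sq (a t : R) : 0 < a -> 2 * t <= a * t ^+ 2 + a^-1.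
  move=> a0; rewrite -subr_ge0.
  have -> : a * t ^+ 2 + a^-1 - 2 * t = a * (t - a^-1) ^+ 2.
    by field; rewrite lt0r_neq0.
  by rewrite mulr_ge0 ?sqr_ge0 // ltW.
have -> : s * (x + y) = X + Y by rewrite /X /Y; ring.
have -> : s ^+ 2 * (A * x ^+ 2 + 2 * B * x * y + C' * y ^+ 2) =
   A * X ^+ 2 + 2 * B * X * Y + C' * Y ^+ 2 by rewrite /X /Y; ring.
apply: (@le_trans _ _ ((i`!%:R * expR X) * (j`!%:R * expR Y) *
  expR (- (A * X ^+ 2 + 2 * B * X * Y + C' * Y ^+ 2)))).
  rewrite ler_wpM2r ?expR_ge0 // ler_pM ?exprn_ge0 //; exact: expn_le_expR.
rewrite mulrACA -!mulrA ler_wpM2l ?ler0n // ler_wpM2l ?ler0n //.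
rewrite -!expRD ler_expR.
have := sq A X A0; have := sq C' Y C0'.
have : 0 <= 2 * B * X * Y := mulr_ge0 (mulr_ge0 (mulr_ge0 (ler0n _ 2) B0) X0) Y0.
have -> : 2 * (B * (s * (x * Y))) = 2 * B * X * Y by rewrite /X; ring.
move: (A * X ^+ 2) (C' * Y ^+ 2) (2 * B * X * Y) (A^-1) (C'^-1) => p q u v w.
lra.
Qed.

Lemma gauss_mono_dx s (i j : nat) x y :
  is_derive x 1 ((gauss_mono s i j)^~ y)
    (s * (i%:R * gauss_mono s i.-1 j x y + (- 2 * A) * gauss_mono s i.+1 j x y +
      (- 2 * B) * gauss_mono s i j.+1 x y)).
Proof.
have := is_derive_mono s ((s * y) ^+ j) (s ^+ 2 * A) (s ^+ 2 * (2 * B * y))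
  (s ^+ 2 * (C' * y ^+ 2)) x i.
have E v : s ^+ 2 * A * v ^+ 2 + s ^+ 2 * (2 * B * y) * v + s ^+ 2 * (C' * y ^+ 2) =
  s ^+ 2 * (A * v ^+ 2 + 2 * B * v * y + C' * y ^+ 2) by ring.
rewrite (_ : (fun v => _) = (gauss_mono s i j)^~ y); last first.
  by apply/funext => v; rewrite E.
move=> /is_derive_eq; apply; rewrite E /gauss_mono !exprS; ring.
Qed.

Lemma gauss_mono_dy s (i j : nat) x y :
  is_derive y 1 (gauss_mono s i j x)
    (s * (j%:R * gauss_mono s i j.-1 x y + (- 2 * C') * gauss_mono s i j.+1 x y +
      (- 2 * B) * gauss_mono s i.+1 j x y)).
Proof.
have := is_derive_mono s ((s * x) ^+ i) (s ^+ 2 * C') (s ^+ 2 * (2 * B * x))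
  (s ^+ 2 * (A * x ^+ 2)) y j.
have E v : s ^+ 2 * C' * v ^+ 2 + s ^+ 2 * (2 * B * x) * v + s ^+ 2 * (A * x ^+ 2) =
  s ^+ 2 * (A * x ^+ 2 + 2 * B * x * v + C' * v ^+ 2) by ring.
rewrite (_ : (fun v => _) = gauss_mono s i j x); last first.
  by apply/funext => v; rewrite E /gauss_mono; congr (_ * _); rewrite mulrC.
move=> /is_derive_eq; apply; rewrite E /gauss_mono !exprS; ring.
Qed.

(** The constant is chosen before s and p: it must be uniform in s, which tends to 0, and s^p
    records the derivatives already taken. *)
Lemma gauss_mono_nice (n i j : nat) : exists2 C, 0 <= C & forall s p, 0 < s ->
  nice s C n p (fun x y => s ^+ p * gauss_mono s i j x y).
Proof.
have zero s p C (i' j' : nat) : 0 < s -> 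
  (forall s x y, 0 < s -> 0 <= x -> 0 <= y ->
     `|gauss_mono s i' j' x y| <= C * expR (- (s * (x + y)))) ->
  forall x y, 0 <= x -> 0 <= y ->
  `|s ^+ p * gauss_mono s i' j' x y| <= C * s ^+ p * expR (- (s * (x + y))).
  move=> s0 H x y x0 y0; rewrite normrM ger0_norm; last by rewrite exprn_ge0 // ltW.
  by rewrite (mulrC C) -[leRHS]mulrA ler_wpM2l ?exprn_ge0 ?H // ltW.
elim: n i j => [|n IH] i j.
  have [C C0 H] := gauss_mono_bound i j; exists C => // s p s0; split=> //.
  exact: zero.
have [C C0 H] := gauss_mono_bound i j.
have [C1 C10 H1] := IH i.-1 j; have [C2 C20 H2] := IH i.+1 j.
have [C3 C30 H3] := IH i j.+1; have [C4 C40 H4] := IH i j.-1.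
pose Cx := `|i%:R| * C1 + `|- 2 * A| * C2 + `|- 2 * B| * C3.
pose Cy := `|j%:R| * C4 + `|- 2 * C'| * C3 + `|- 2 * B| * C2.
have Cx0 : 0 <= Cx by apply: addr_ge0; [apply: addr_ge0|]; apply: mulr_ge0.
have Cy0 : 0 <= Cy by apply: addr_ge0; [apply: addr_ge0|]; apply: mulr_ge0.
exists (C + Cx + Cy); first by apply: addr_ge0 => //; apply: addr_ge0.
move=> s p s0; split.
  apply: zero => // s' x y s'0 x0 y0; apply: le_trans (H _ _ _ s'0 x0 y0) _.
  by rewrite ler_wpM2r ?expR_ge0 // -addrA lerDl addr_ge0.
pose m i j x y := s ^+ p.+1 * gauss_mono s i j x y.
exists (fun x y => i%:R * m i.-1 j x y + (- 2 * A) * m i.+1 j x y + (- 2 * B) * m i j.+1 x y).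
exists (fun x y => j%:R * m i j.-1 x y + (- 2 * C') * m i j.+1 x y + (- 2 * B) * m i.+1 j x y).
split.
- move=> x y; have := is_deriveZ (s ^+ p) (gauss_mono_dx s i j x y).
  by move=> /is_derive_eq; apply; rewrite /m exprS /GRing.scale /=; ring.
- move=> x y; have := is_deriveZ (s ^+ p) (gauss_mono_dy s i j x y).
  by move=> /is_derive_eq; apply; rewrite /m exprS /GRing.scale /=; ring.
- apply: (nice_le (ltW s0) _ (nice_comb3 _ _ _ (H1 s p.+1 s0) (H2 s p.+1 s0) (H3 s p.+1 s0))).
  by rewrite -/Cx addrAC lerDr addr_ge0.
- apply: (nice_le (ltW s0) _ (nice_comb3 _ _ _ (H4 s p.+1 s0) (H3 s p.+1 s0) (H2 s p.+1 s0))).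
  by rewrite -/Cy lerDr addr_ge0.
Qed.

End Gaussian.

End SmoothDecay.

(** * Limits of shifted Gaussian sums *)

Section BlockLimit.
Variable R : realType.
Variables (A B C' : R) (w w' : R[i]).
Hypotheses (A0 : 0 < A) (B0 : 0 <= B) (C0' : 0 < C') (w1 : `|w| = 1) (w1' : `|w'| = 1).

Definition gauss (s x y : R) : R := expR (- (s ^+ 2 * (A * x ^+ 2 + 2 * B * x * y + C' * y ^+ 2))).

Definition shifted_sum (s a b : R) : R[i] :=
  S2 w w' (fun m n => gauss s (m%:R + a) (n%:R + b)).

Lemma gauss_nice n : exists2 C, 0 <= C & forall s, 0 < s -> nice s C n 0 (gauss s).
Proof.
have [C C0 H] := gauss_mono_nice A0 B0 C0' n 0 0; exists C => // s s0.
have := H s 0%N s0; congr (nice s C n 0%N); apply/funext => x; apply/funext => y.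
by rewrite /gauss_mono !expr0 !mul1r.
Qed.

Lemma S2B (s C1 C2 : R) n1 p1 n2 p2 (F G : R -> R -> R) : 0 < s <= 1 -> 0 <= C1 -> 0 <= C2 ->
  nice s C1 n1 p1 F -> nice s C2 n2 p2 G ->
  S2 w w' (fun i j => F i%:R j%:R - G i%:R j%:R) =
  S2 w w' (fun i j => F i%:R j%:R) - S2 w w' (fun i j => G i%:R j%:R).
Proof.
move=> s01 C10 C20 NF NG; have /andP[s0 _] := s01.
have r0 := rate_ge0 s; have r1 := rate_lt1 s0.
have dF := nice_disc2 (ltW s0) C10 NF; have dG := nice_disc2 (ltW s0) C20 NG.
have rowF m : dom (C1 * s ^+ p1 * expR (- s) ^+ m) (expR (- s)) (fun n => (F m%:R n%:R)%:C).
  by move=> n; apply: (disc2_dom2 dF).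
have rowG m : dom (C2 * s ^+ p2 * expR (- s) ^+ m) (expR (- s)) (fun n => (G m%:R n%:R)%:C).
  by move=> n; apply: (disc2_dom2 dG).
have DF := dom2_S1 s01 w1' dF; have DG := dom2_S1 s01 w1' dG.
rewrite /S2 -[- S1 w _]mulN1r -(S1Z r0 r1 _ w1 DG).
have DG' := domM (w := fun=> -1) ler01 (fun=> _) DG.
rewrite -(S1D r0 r1 w1 DF (DG' _)); last by rewrite normrN normr1.
congr S1; apply/funext => m; rewrite -(S1Z r0 r1 _ w1' (rowG m)).
have rowG' := domM (w := fun=> -1) ler01 (fun=> _) (rowG m).
rewrite -(S1D r0 r1 w1' (rowF m) (rowG' _)); last by rewrite normrN normr1.
by congr S1; apply/funext => n; rewrite mulN1r rmorphB.
Qed.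

Definition diff2 (f : R -> R[i]) (x d d' : R) : R[i] :=
  (f (x + d + d') - f (x + d)) - (f (x + d') - f x).

(** A second difference in the shift a is the sum of a second difference of F in x, hence of a
    function two orders smaller. *)
Lemma S2_diff2 (s C : R) n p (F : R -> R -> R) (a b d d' : R) : 0 < s <= 1 -> 0 <= C ->
  0 <= a -> 0 <= b -> 0 <= d -> 0 <= d' -> nice s C n.+2 p F ->
  exists2 G : R -> R -> R, nice s (d * (d' * C)) n p.+2 G &
    diff2 (fun a => S2 w w' (fun i j => F (i%:R + a) (j%:R + b))) a d d' =
    S2 w w' (fun i j => G i%:R j%:R).
Proof.
move=> s01 C0 a0 b0 d0 d0' NF; have /andP[s0 _] := s01; have s0' := ltW s0.
pose H x y := F (x + a) (y + b).
have NH : nice s C n.+2 p H := nice_shift s0' C0 a0 b0 NF.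
have NH1 := nice_diffx s0' C0 d0' NH.
have NH2 := nice_diffx s0' (mulr_ge0 d0' C0) d0 NH1.
exists (fun x y => (H (x + d + d') y - H (x + d) y) - (H (x + d') y - H x y)) => //.
have sub a' : 0 <= a' -> nice s C n.+2 p (fun x y => F (x + a') (y + b)).
  by move=> a'0; exact: nice_shift.
have ad := addr_ge0 a0 d0; have ad' := addr_ge0 a0 d0'.
have add := addr_ge0 ad d0'.
have N1 : nice s (d' * C) n.+1 p.+1 (fun x y => H (x + d + d') y - H (x + d) y).
  have := nice_shift s0' (mulr_ge0 d0' C0) d0 (lexx 0) NH1.
  by congr (nice s _ n.+1 p.+1); apply/funext => x; apply/funext => y; rewrite addr0.
rewrite (S2B s01 _ _ N1 NH1) ?mulr_ge0 // /diff2.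
rewrite -(S2B s01 C0 C0 (sub _ add) (sub _ ad)) -(S2B s01 C0 C0 (sub _ ad') (sub _ a0)).
congr (S2 w w' _ - S2 w w' _); apply/funext => i; apply/funext => j; rewrite /H.
  by congr (F _ _ - F _ _); ring.
by congr (F _ _ - F _ _); ring.
Qed.

(** The Abel steps give the value of the Gaussian at (a, b) as main term; it differs from 1 by at
    most K2 s^2 <= K2 s. *)
Lemma shifted_sum_limit (a b : R) : 0 <= a -> 0 <= b -> w != 1 -> w' != 1 ->
  exists K, forall s, 0 < s <= 1 ->
    `|shifted_sum s a b - (1 - w)^-1 * (1 - w')^-1| <= (K * s)%:C.
Proof.
move=> a0 b0 wn1 wn1'; have [C C0 H] := gauss_nice 3.
pose K1 := (3 / nrm (1 - w') + (3 / nrm (1 - w) + 6 / nrm (1 - w'))) * C.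
pose K2 := A * a ^+ 2 + 2 * B * a * b + C' * b ^+ 2.
have K20 : 0 <= K2.
  rewrite /K2 !addr_ge0 // ?mulr_ge0 ?sqr_ge0 // ?ltW //.
have n0 : 1 - w != 0 by rewrite subr_eq0 eq_sym.
have n0' : 1 - w' != 0 by rewrite subr_eq0 eq_sym.
exists ((K1 + K2) / (nrm (1 - w) * nrm (1 - w'))) => s s01.
have /andP[s0 s1] := s01.
have Nab := nice_shift (ltW s0) C0 a0 b0 (H s s0).
have := S2_order0 s01 C0 w1 w1' wn1 wn1' (nice_disc2 (ltW s0) C0 Nab).
rewrite -/(shifted_sum s a b) !add0r mulrA -/K1 => E.
have g1 : `|1 - gauss s a b| <= K2 * s.
  rewrite /gauss -/K2; set z := s ^+ 2 * K2.
  have z0 : 0 <= z by rewrite mulr_ge0 ?sqr_ge0.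
  have e1 : expR (- z) <= 1 by rewrite -expR0 ler_expR oppr_le0.
  rewrite ger0_norm ?subr_ge0 //.
  apply: (@le_trans _ _ z); first by have := expR_ge1Dx (- z); lra.
  by rewrite /z mulrC ler_wpM2l // expr2 ler_piMl // ltW.
have -> : shifted_sum s a b - (1 - w)^-1 * (1 - w')^-1 =
   ((1 - w) * (1 - w') * shifted_sum s a b - (gauss s a b)%:C - (1 - gauss s a b)%:C) /
   ((1 - w) * (1 - w')).
  by rewrite rmorphB rmorph1; field; rewrite n0 n0'.
have np := nrm_gt0 n0; have np' := nrm_gt0 n0'.
have nY : `|(1 - w) * (1 - w')| = (nrm (1 - w) * nrm (1 - w'))%:C.
  by rewrite normrM (nrmE (1 - w)) (nrmE (1 - w')) rmorphM.
rewrite normrM normfV nY ler_pdivrMr ?ltcR ?mulr_gt0 // -rmorphM.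
have -> : (K1 + K2) / (nrm (1 - w) * nrm (1 - w')) * s * (nrm (1 - w) * nrm (1 - w')) =
    K1 * s + K2 * s by field; rewrite ?lt0r_neq0.
rewrite [leRHS]rmorphD (le_trans (ler_normB _ _)) // lerD //.
by rewrite norm_real lecR.
Qed.

(** Of the three derivatives, two go to the second difference and one to the Abel step in n. *)
Lemma diff2_x_small (a b d d' : R) : 0 <= a -> 0 <= b -> 0 <= d -> 0 <= d' -> w' != 1 ->
  exists K, forall s, 0 < s <= 1 ->
    `|diff2 (fun a => shifted_sum s a b) a d d'| <= (K * s)%:C.
Proof.
move=> a0 b0 d0 d0' wn1'; have [C C0 H] := gauss_nice 3.
exists (6 / nrm (1 - w') * (d * (d' * C))) => s s01; have /andP[s0 _] := s01.
have [G NG ->] := S2_diff2 s01 C0 a0 b0 d0 d0' (H s s0).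
have C20 : 0 <= d * (d' * C) by rewrite !mulr_ge0.
have := S2_order2_y s01 C20 w1 w1' wn1' (nice_disc2 (ltW s0) C20 NG).
by rewrite -[6 / _ * _ * s]mulrA.
Qed.

(** The estimate for w = w' = 1, where no Abel step can help: one increment in b on top of the
    second difference in a gives order 3, two of which pay for the sums. *)
Lemma diff2_xy_small (a b d d' h : R) : 0 <= a -> 0 <= b -> 0 <= d -> 0 <= d' -> 0 <= h ->
  exists K, forall s, 0 < s <= 1 ->
    `|diff2 (fun a => shifted_sum s a (b + h)) a d d' -
      diff2 (fun a => shifted_sum s a b) a d d'| <= (K * s)%:C.
Proof.
move=> a0 b0 d0 d0' h0; have [C C0 H] := gauss_nice 3.
exists (4 * (d * (d' * (h * C)))) => s s01; have /andP[s0 _] := s01.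
have s0' := ltW s0.
have Nh := nice_diffy s0' C0 h0 (H s s0).
have hC0 : 0 <= h * C by rewrite mulr_ge0.
have C20 : 0 <= d * (d' * (h * C)) by rewrite !mulr_ge0.
have [G NG] := S2_diff2 s01 hC0 a0 b0 d0 d0' Nh.
rewrite -[s in X in _ <= X]expr1.
have := S2_small s01 C20 w1 w1' (nice_disc2 s0' C20 NG).
move=> HG E; move: HG; rewrite -E.
have sum_sub a' : 0 <= a' -> S2 w w' (fun i j => gauss s (i%:R + a') (j%:R + b + h) -
      gauss s (i%:R + a') (j%:R + b)) = shifted_sum s a' (b + h) - shifted_sum s a' b.
  move=> a'0; rewrite /shifted_sum.
  have N1 := nice_shift s0' C0 a'0 (addr_ge0 b0 h0) (H s s0).
  have N2 := nice_shift s0' C0 a'0 b0 (H s s0).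
  rewrite -(S2B s01 C0 C0 N1 N2); congr S2; apply/funext => i; apply/funext => j.
  by rewrite addrA.
have ad := addr_ge0 a0 d0; have ad' := addr_ge0 a0 d0'; have add := addr_ge0 ad d0'.
have regroup (p q r t p' q' r' t' : R[i]) : (p - p') - (q - q') - ((r - r') - (t - t')) =
  (p - q) - (r - t) - ((p' - q') - (r' - t')) by ring.
rewrite /diff2.
rewrite (sum_sub _ add) (sum_sub _ ad) (sum_sub _ ad') (sum_sub _ a0).
move: (shifted_sum s (a + d + d') (b + h)) (shifted_sum s (a + d + d') b)
  (shifted_sum s (a + d) (b + h)) (shifted_sum s (a + d) b)
  (shifted_sum s (a + d') (b + h)) (shifted_sum s (a + d') b)
  (shifted_sum s a (b + h)) (shifted_sum s a b) => p p' q q' r r' t t'.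
by rewrite regroup.
Qed.

End BlockLimit.

(** * Alternating sums over the leaf signs *)

Section Block.
Variable R : realType.

Lemma S2_dsum (w w' : R[i]) (s C : R) d p (f : nat -> nat -> R) :
  0 < s -> `|w| = 1 -> `|w'| = 1 -> disc2 s C d p f ->
  dsum (fun m n => w ^+ m * w' ^+ n * (f m n)%:C) = S2 w w' f.
Proof.
move=> s0 w1 w1' fC; have fd := disc2_dom2 fC.
have r0 := rate_ge0 s; have r1 := rate_lt1 s0.
rewrite (dsumE r0 r1 (C := C * s ^+ p)); last first.
  by move=> m n; rewrite !normrM !normrX w1 w1' !expr1n !mul1r; apply: fd.
rewrite /S2 /S1; congr summ; apply/funext => m.
have rowd : dom (C * s ^+ p * expR (- s) ^+ m) (expR (- s)) (fun n => w' ^+ n * (f m n)%:C).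
  by apply: dom_char => // n; apply: fd.
rewrite -(summZ r0 r1 _ rowd); congr summ; apply/funext => n.
by rewrite mulrA.
Qed.

Lemma dsum_swap (F : nat -> nat -> R[i]) : dsum F = dsum (fun m n => F n m).
Proof.
have E : (fun K => \sum_(m < K) \sum_(n < K) F m n : R[i]^o) =
    (fun K => \sum_(m < K) \sum_(n < K) F n m).
  by apply/funext => K; rewrite exchange_big.
by rewrite /dsum E.
Qed.

(** The iterated sums are exchanged by way of [dsum], whose partial sums over squares are symmetric
    in m and n. *)
Lemma shifted_sum_swap A B C' (w w' : R[i]) (s a b : R) :
  0 < A -> 0 <= B -> 0 < C' -> `|w| = 1 -> `|w'| = 1 -> 0 < s -> 0 <= a -> 0 <= b ->
  shifted_sum A B C' w w' s a b = shifted_sum C' B A w' w s b a.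
Proof.
move=> A0 B0 C0' w1 w1' s0 a0 b0.
have [C C0 H] := gauss_nice A0 B0 C0' 0; have [D D0 H'] := gauss_nice C0' B0 A0 0.
have N1 := nice_disc2 (ltW s0) C0 (nice_shift (ltW s0) C0 a0 b0 (H s s0)).
have N2 := nice_disc2 (ltW s0) D0 (nice_shift (ltW s0) D0 b0 a0 (H' s s0)).
rewrite /shifted_sum -(S2_dsum s0 w1 w1' N1) -(S2_dsum s0 w1' w1 N2) dsum_swap.
congr dsum; apply/funext => m; apply/funext => n; rewrite [w ^+ _ * _]mulrC.
by congr (_ * _%:C); rewrite /gauss; congr expR; ring.
Qed.

Definition Os (f : R -> R[i]) := exists K, forall s, 0 < s <= 1 -> `|f s| <= (K * s)%:C.

Lemma Os_eq f g : (forall s, 0 < s <= 1 -> f s = g s) -> Os f -> Os g.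
Proof. by move=> fg [K H]; exists K => s s01; rewrite -fg // H. Qed.

Lemma OsD f g : Os f -> Os g -> Os (fun s => f s + g s).
Proof.
move=> [K H] [K' H']; exists (K + K') => s s01; rewrite mulrDl rmorphD.
by rewrite (le_trans (ler_normD _ _)) // lerD // ?H ?H'.
Qed.

Lemma OsZ c f : Os f -> Os (fun s => c * f s).
Proof.
move=> [K H]; exists (nrm c * K) => s s01; rewrite normrM nrmE -mulrA rmorphM.
by rewrite ler_wpM2l ?ler0c ?sqrtr_ge0 // H.
Qed.

Lemma Os_sum (I : eqType) (r : seq I) (F : I -> R -> R[i]) :
  (forall i, i \in r -> Os (F i)) -> Os (fun s => \sum_(i <- r) F i s).
Proof.
elim: r => [|i r IH] FO.
  by exists 0 => s _; rewrite big_nil normr0 mul0r.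
apply: (Os_eq _ (OsD (FO i (mem_head i r)) (IH _))) => [s _|j jr]; first by rewrite big_cons.
by apply: FO; rewrite inE jr orbT.
Qed.

Local Notation signs := [:: 1; -1 : int].

(** The second difference starts at the smallest of the four points so that its steps are
    non-negative; this costs the sign u of h h', which is independent of g. *)
Lemma sign_sum_diff2 (h h' : R) : exists u : R[i], forall g : R -> R[i],
  \sum_(s <- signs) \sum_(t <- signs) (s * t)%:~R * g (1/2 + s%:~R * h + t%:~R * h') =
  u * diff2 g (1/2 - `|h| - `|h'|) (2 * `|h|) (2 * `|h'|).
Proof.
have e (g : R -> R[i]) : \sum_(s <- signs) \sum_(t <- signs) (s * t)%:~R *
    g (1/2 + s%:~R * h + t%:~R * h') =
    g (1/2 + h + h') - g (1/2 + h - h') - g (1/2 - h + h') + g (1/2 - h - h').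
  rewrite !big_cons !big_nil !rmorphM /= !rmorphN !rmorph1 !mul1r !mulN1r; ring.
exists (if (0 <= h) == (0 <= h') then 1 else -1) => g; rewrite e /diff2.
have E1 (k k' : R) : 1/2 - k - k' + 2 * k + 2 * k' = 1/2 + k + k' by field.
have E2 (k k' : R) : 1/2 - k - k' + 2 * k = 1/2 + k - k' by field.
have E3 (k k' : R) : 1/2 - k - k' + 2 * k' = 1/2 - k + k' by field.
rewrite E1 E2 E3.
have [h0|h0] := ger0P h; have [h0'|h0'] := ger0P h'; rewrite /= ?opprK;
  set p := g _; set q := g _; set r := g _; set t := g _; ring.
Qed.

Lemma diff2Z (u : R[i]) (f : R -> R[i]) x d d' :
  diff2 (fun b => u * f b) x d d' = u * diff2 f x d d'.
Proof. by rewrite /diff2 -!mulrBr. Qed.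

Section Limit.
Variables (A B C' : R) (w w' : R[i]) (h3 h4 h5 h6 : R) (c3 c4 c5 c6 : int -> R[i]).
Hypotheses (A0 : 0 < A) (B0 : 0 <= B) (C0' : 0 < C') (w1 : `|w| = 1) (w1' : `|w'| = 1).
Hypotheses (h34 : `|h3| + `|h4| <= 1/2) (h56 : `|h5| + `|h6| <= 1/2).
Hypothesis c34 : w = 1 -> c3 (-1) = c3 1 /\ c4 (-1) = c4 1.
Hypothesis c56 : w' = 1 -> c5 (-1) = c5 1 /\ c6 (-1) = c6 1.

Local Notation V := (shifted_sum A B C' w w').
Let x0 := 1/2 - `|h3| - `|h4|.
Let y0 := 1/2 - `|h5| - `|h6|.

Definition block (s : R) : R[i] :=
  \sum_(s3 <- signs) \sum_(s4 <- signs) \sum_(s5 <- signs) \sum_(s6 <- signs)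
    (s3 * s4 * s5 * s6)%:~R * (c3 s3 * c4 s4 * c5 s5 * c6 s6) *
    V s (1/2 + s3%:~R * h3 + s4%:~R * h4) (1/2 + s5%:~R * h5 + s6%:~R * h6).

Let x00 : 0 <= x0. Proof. by rewrite /x0 -addrA -opprD subr_ge0. Qed.
Let y00 : 0 <= y0. Proof. by rewrite /y0 -addrA -opprD subr_ge0. Qed.

Let arg0 (h h' : R) (s t : int) : `|h| + `|h'| <= 1/2 -> s \in signs -> t \in signs ->
  0 <= 1/2 + s%:~R * h + t%:~R * h'.
Proof.
move=> hh; have := ler_norm h; have := ler_norm h'.
have := ler_norm (- h); have := ler_norm (- h'); rewrite !normrN => n1 n2 n3 n4.
rewrite !inE => /orP[] /eqP -> /orP[] /eqP ->; rewrite ?rmorphN ?rmorph1 ?mulN1r ?mul1r; lra.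
Qed.

Lemma Vx_small b : 0 <= b -> w' != 1 ->
  Os (fun s => diff2 (fun a => V s a b) x0 (2 * `|h3|) (2 * `|h4|)).
Proof.
by move=> b0 wn1'; apply: diff2_x_small => //; rewrite mulr_ge0.
Qed.

Lemma Vy_small a : 0 <= a -> w != 1 ->
  Os (fun s => diff2 (fun b => V s a b) y0 (2 * `|h5|) (2 * `|h6|)).
Proof.
move=> a0 wn1.
have H : Os (fun s => diff2 (fun b => shifted_sum C' B A w' w s b a) y0 (2 * `|h5|) (2 * `|h6|)).
  by apply: diff2_x_small => //; rewrite mulr_ge0.
apply: Os_eq H => s /andP[s0 _].
have d0 : 0 <= 2 * `|h5| by rewrite mulr_ge0.
have d0' : 0 <= 2 * `|h6| by rewrite mulr_ge0.
have swap b : 0 <= b -> shifted_sum C' B A w' w s b a = V s a b.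
  by move=> b0; rewrite (shifted_sum_swap A0 B0 C0' w1 w1' s0 a0 b0).
have yd := addr_ge0 y00 d0; have yd' := addr_ge0 y00 d0'; have ydd := addr_ge0 yd d0'.
by rewrite /diff2 (swap _ ydd) (swap _ yd) (swap _ yd') (swap _ y00).
Qed.

Lemma Vxy_small :
  Os (fun s => diff2 (fun b => diff2 (fun a => V s a b) x0 (2 * `|h3|) (2 * `|h4|))
    y0 (2 * `|h5|) (2 * `|h6|)).
Proof.
have d3 : 0 <= 2 * `|h3| by rewrite mulr_ge0.
have d4 : 0 <= 2 * `|h4| by rewrite mulr_ge0.
have d5 : 0 <= 2 * `|h5| by rewrite mulr_ge0.
have d6 : 0 <= 2 * `|h6| by rewrite mulr_ge0.
pose D b s := diff2 (fun a => V s a b) x0 (2 * `|h3|) (2 * `|h4|).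
have inc b h : 0 <= b -> 0 <= h -> Os (fun s => D (b + h) s - D b s).
  by move=> b0 h0; apply: diff2_xy_small.
have H1 := inc _ _ (addr_ge0 y00 d5) d6; have H2 := OsZ (-1) (inc _ _ y00 d6).
by apply: Os_eq (OsD H1 H2) => s _; rewrite mulN1r.
Qed.

Let expand (G : int -> int -> int -> int -> R[i]) : R[i] :=
  \sum_(s3 <- signs) \sum_(s4 <- signs) \sum_(s5 <- signs) \sum_(s6 <- signs)
    (s3 * s4 * s5 * s6)%:~R * (c3 s3 * c4 s4 * c5 s5 * c6 s6) * G s3 s4 s5 s6.

Let big_signs (F : int -> R[i]) : \sum_(s <- signs) F s = F 1 + F (-1).
Proof. by rewrite !big_cons big_nil addr0. Qed.

(* If w = 1 then c3 and c4 factor out of the sums over s3 and s4, leaving a second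
   difference of the shifted sum; similarly for w'. Here (1 - 1)^-1 = 0. *)
Lemma block_limit : Os (fun s => block s -
  (c3 1 - c3 (-1)) * (c4 1 - c4 (-1)) * (c5 1 - c5 (-1)) * (c6 1 - c6 (-1)) *
  ((1 - w)^-1 * (1 - w')^-1)).
Proof.
have [wE|wn] := eqVneq w 1; have [wE'|wn'] := eqVneq w' 1.
- have [e3 e4] := c34 wE; have [e5 e6] := c56 wE'.
  have E G : expand G = c3 1 * c4 1 * c5 1 * c6 1 *
      \sum_(s5 <- signs) \sum_(s6 <- signs) (s5 * s6)%:~R *
      \sum_(s3 <- signs) \sum_(s4 <- signs) (s3 * s4)%:~R * G s3 s4 s5 s6.
    by rewrite /expand !big_signs e3 e4 e5 e6 !rmorphM !rmorphN !rmorph1; ring.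
  have [u Hu] := sign_sum_diff2 h3 h4; have [v Hv] := sign_sum_diff2 h5 h6.
  apply: Os_eq (OsZ (c3 1 * c4 1 * c5 1 * c6 1 * v * u) Vxy_small) => s _.
  rewrite e3 subrr !mul0r subr0 /block.
  rewrite [RHS](E (fun s3 s4 s5 s6 =>
    V s (1/2 + s3%:~R * h3 + s4%:~R * h4) (1/2 + s5%:~R * h5 + s6%:~R * h6))).
  under [in RHS]eq_bigr => s5 _ do under eq_bigr => s6 _ do
    rewrite (Hu (fun a => V s a (1/2 + s5%:~R * h5 + s6%:~R * h6))).
  rewrite (Hv (fun b => u * diff2 (fun a => V s a b) (1/2 - `|h3| - `|h4|) (2 * `|h3|) (2 * `|h4|))).
  by rewrite -/x0 -/y0 diff2Z !mulrA.
- have [e3 e4] := c34 wE.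
  have E G : expand G = \sum_(s5 <- signs) \sum_(s6 <- signs)
      (c3 1 * c4 1 * c5 s5 * c6 s6 * (s5 * s6)%:~R) *
      \sum_(s3 <- signs) \sum_(s4 <- signs) (s3 * s4)%:~R * G s3 s4 s5 s6.
    by rewrite /expand !big_signs e3 e4 !rmorphM !rmorphN !rmorph1; ring.
  have [u Hu] := sign_sum_diff2 h3 h4.
  apply: (@Os_eq (fun s => \sum_(s5 <- signs) \sum_(s6 <- signs)
      (c3 1 * c4 1 * c5 s5 * c6 s6 * (s5 * s6)%:~R) *
      (u * diff2 (fun a => V s a (1/2 + s5%:~R * h5 + s6%:~R * h6)) x0 (2 * `|h3|) (2 * `|h4|)))).
    move=> s _; rewrite e3 subrr !mul0r subr0 /block.
    rewrite [RHS](E (fun s3 s4 s5 s6 =>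
      V s (1/2 + s3%:~R * h3 + s4%:~R * h4) (1/2 + s5%:~R * h5 + s6%:~R * h6))).
    by under [in RHS]eq_bigr => s5 _ do under eq_bigr => s6 _ do
      rewrite (Hu (fun a => V s a (1/2 + s5%:~R * h5 + s6%:~R * h6))).
  apply: Os_sum => s5 i5; apply: Os_sum => s6 i6; apply: OsZ; apply: OsZ.
  by apply: Vx_small => //; apply: arg0.
- have [e5 e6] := c56 wE'.
  have E G : expand G = \sum_(s3 <- signs) \sum_(s4 <- signs)
      (c3 s3 * c4 s4 * c5 1 * c6 1 * (s3 * s4)%:~R) *
      \sum_(s5 <- signs) \sum_(s6 <- signs) (s5 * s6)%:~R * G s3 s4 s5 s6.
    by rewrite /expand !big_signs e5 e6 !rmorphM !rmorphN !rmorph1; ring.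
  have [u Hu] := sign_sum_diff2 h5 h6.
  apply: (@Os_eq (fun s => \sum_(s3 <- signs) \sum_(s4 <- signs)
      (c3 s3 * c4 s4 * c5 1 * c6 1 * (s3 * s4)%:~R) *
      (u * diff2 (fun b => V s (1/2 + s3%:~R * h3 + s4%:~R * h4) b) y0 (2 * `|h5|) (2 * `|h6|)))).
    move=> s _; rewrite e5 [_ * (c5 1 - _)]mulrC subrr !mul0r subr0 /block.
    rewrite [RHS](E (fun s3 s4 s5 s6 =>
      V s (1/2 + s3%:~R * h3 + s4%:~R * h4) (1/2 + s5%:~R * h5 + s6%:~R * h6))).
    by under [in RHS]eq_bigr => s3 _ do under eq_bigr => s4 _ do
      rewrite (Hu (fun b => V s (1/2 + s3%:~R * h3 + s4%:~R * h4) b)).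
  apply: Os_sum => s3 i3; apply: Os_sum => s4 i4; apply: OsZ; apply: OsZ.
  by apply: Vy_small => //; apply: arg0.
- have E G l : expand (fun s3 s4 s5 s6 => G s3 s4 s5 s6 - l) = expand G -
      (c3 1 - c3 (-1)) * (c4 1 - c4 (-1)) * (c5 1 - c5 (-1)) * (c6 1 - c6 (-1)) * l.
    by rewrite /expand !big_signs !rmorphM !rmorphN !rmorph1; ring.
  apply: (@Os_eq (fun s => expand (fun s3 s4 s5 s6 =>
    V s (1/2 + s3%:~R * h3 + s4%:~R * h4) (1/2 + s5%:~R * h5 + s6%:~R * h6) -
    (1 - w)^-1 * (1 - w')^-1))); first by move=> s _; rewrite E.
  apply: Os_sum => s3 i3; apply: Os_sum => s4 i4; apply: Os_sum => s5 i5.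
  apply: Os_sum => s6 i6; apply: OsZ.
  by apply: shifted_sum_limit => //; apply: arg0.
Qed.

End Limit.

End Block.

(** * Power series in q *)

Section PowerSeries.
Variable R : realType.

(* When m + n <= N m n + 1, the level set {N = j} lies in the square of side j + 2. *)
Definition level_count (N : nat -> nat -> nat) (j : nat) : nat :=
  \sum_(m < j.+2) \sum_(n < j.+2) (N m n == j).

Lemma level_countE (N : nat -> nat -> nat) (j K : nat) :
  (forall m n, m + n <= (N m n).+1)%N -> (j.+2 <= K)%N ->
  level_count N j = (\sum_(m < K) \sum_(n < K) (N m n == j))%N.
Proof.
move=> NN jK.
have vanish m n : (j.+2 <= m + n)%N -> (N m n == j) = false.
  by move=> mn; apply/eqP => E; have := NN m n; rewrite E; lia.
rewrite /level_count (big_ord_widen K (fun m => \sum_(n < j.+2) (N m n == j))%N jK).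
rewrite big_mkcond; apply: eq_bigr => m _.
case: ltnP => mj; last first.
  by rewrite big1 // => n _; rewrite vanish // (leq_trans mj) // leq_addr.
rewrite (big_ord_widen K (fun n => (N m n == j) : nat) jK) big_mkcond.
apply: eq_bigr => n _; case: ltnP => // nj.
by rewrite vanish // (leq_trans nj) // leq_addl.
Qed.

(** The J-th partial sum of the power series collects the (m, n) with N m n < J, all of which lie in
    the square of side J + 1; the rest of that square is negligible. *)
Lemma power_series_cvg (N : nat -> nat -> nat) (z : R[i]) (rho : R) :
  (forall m n, m + n <= (N m n).+1)%N -> 0 < rho < 1 -> `|z| = rho%:C ->
  series (fun j => (level_count N j)%:R * z ^+ j : R[i]^o) @ \oo -->
    (dsum (fun m n => z ^+ N m n) : R[i]^o).
Proof.
move=> NN /andP[rho0 rho1] zr.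
(* The decay rho^N is split as sg^N sg^N: one half is at most sg^J when N >= J, the other is
   summable over m and n. *)
pose sg := Num.sqrt rho.
have sg0 : 0 < sg by rewrite sqrtr_gt0.
have sg2 : sg ^+ 2 = rho by rewrite sqr_sqrtr // ltW.
have sg1 : sg < 1 by rewrite -(@ltr_pXn2r _ 2) ?nnegrE ?ltW // sg2 expr1n.
have sgN m n : sg ^+ (N m n) <= sg^-1 * sg ^+ m * sg ^+ n.
  rewrite -mulrA -exprD -ler_pdivrMl ?invr_gt0 // invrK -exprS.
  by rewrite ler_wiXn2l ?NN // ltW.
have D2 : dom2 sg^-1 sg (fun m n => z ^+ N m n).
  move=> m n; rewrite normrX zr -rmorphXn lecR -sg2 -exprM mulnC exprM.
  apply: le_trans (sgN m n); rewrite expr2 ler_piMl ?exprn_ge0 ?exprn_ile1 // ltW //.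
have sq := square_cvg (ltW sg0) sg1 D2.
rewrite -(dsumE (ltW sg0) sg1 D2) in sq.
have level J : series (fun j => (level_count N j)%:R * z ^+ j) J =
    \sum_(m < J.+1) \sum_(n < J.+1 | (N m n < J)%N) z ^+ N m n.
  rewrite /series /= big_mkord.
  transitivity (\sum_(j < J) \sum_(m < J.+1) \sum_(n < J.+1) (N m n == j)%:R * z ^+ j).
    apply: eq_bigr => j _; rewrite (@level_countE N j J.+1) ?ltnS ?ltn_ord //.
    rewrite natr_sum mulr_suml; apply: eq_bigr => m _.
    by rewrite natr_sum mulr_suml.
  rewrite exchange_big; apply: eq_bigr => m _ /=.
  rewrite exchange_big [RHS]big_mkcond; apply: eq_bigr => n _ /=.
  case: ltnP => NJ.
    rewrite (bigD1 (Ordinal NJ)) //= eqxx mul1r big1 ?addr0 // => j jN.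
    by rewrite (_ : _ == _ = false) ?mul0r //; apply: contra_neqF jN => /eqP E; apply: val_inj.
  rewrite big1 // => j _; rewrite (_ : _ == _ = false) ?mul0r //.
  by apply/eqP => E; have := ltn_ord j; rewrite -E ltnNge NJ.
pose B := sg^-1 * (1 - sg)^-1 * (1 - sg)^-1.
apply: (@squeeze_norm R nat _ _ _ (fun J => \sum_(m < J.+1) \sum_(n < J.+1) z ^+ N m n) _
  (geometric B sg)).
- near=> J; rewrite level -sumrB (le_trans (ler_norm_sum _ _ _)) //.
  apply: (@le_trans _ _ (\sum_(m < J.+1) (sg ^+ J * sg^-1 * (1 - sg)^-1 * sg ^+ m)%:C)).
    apply: ler_sum => m _.
    rewrite [X in `|X - _|]big_mkcond -sumrB (le_trans (ler_norm_sum _ _ _)) //.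
    apply: (@le_trans _ _ (\sum_(n < J.+1) (sg ^+ J * sg^-1 * sg ^+ m * sg ^+ n)%:C)).
      apply: ler_sum => n _; case: ltnP => NJ.
        by rewrite subrr normr0 ler0c !mulr_ge0 ?invr_ge0 ?exprn_ge0 // ltW.
      rewrite sub0r normrN normrX zr -rmorphXn lecR -sg2 -exprM mulnC exprM expr2.
      rewrite -!mulrA ler_pM ?exprn_ge0 ?(ltW sg0) //.
        by rewrite ler_wiXn2l // ltW.
      by rewrite mulrA sgN.
    rewrite -rmorph_sum -mulr_sumr lecR.
    rewrite [leRHS]mulrAC ler_wpM2l ?geo_le ?ltW //.
    by rewrite !mulr_gt0 ?invr_gt0 ?exprn_gt0.
  rewrite -rmorph_sum -mulr_sumr lecR /geometric /= /B.
  rewrite (_ : _ * sg ^+ J = sg ^+ J * sg^-1 * (1 - sg)^-1 * (1 - sg)^-1); last by ring.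
  rewrite ler_wpM2l ?geo_le ?ltW // !mulr_gt0 ?invr_gt0 ?exprn_gt0 ?subr_gt0 //.
- by apply: cvg_geometric; rewrite ger0_norm ?ltW.
- move: sq; rewrite -(@cvg_shiftS (R[i]^o)); exact.
Unshelve. all: by end_near. Qed.

Lemma qpowE (x y : R) (r : rat) :
  qpow (x +i* y) r = (expR (- (2 * pi * (ratr r * y))))%:C *
    (cos (2 * pi * (ratr r * x)) +i* sin (2 * pi * (ratr r * x))).
Proof.
rewrite /qpow ratrC; have -> : (ratr r)%:C * (x +i* y) = (ratr r * x) +i* (ratr r * y).
  by simpc.
exact: eeE.
Qed.

Lemma norm_qpow (tau : R[i]) (r : rat) :
  `|qpow tau r| = (expR (- (2 * pi * (ratr r * complex.Im tau))))%:C.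
Proof.
case: tau => x y; rewrite /qpow ratrC.
have -> : (ratr r)%:C * (x +i* y) = (ratr r * x) +i* (ratr r * y) by simpc.
exact: norm_ee.
Qed.

Lemma qpowD (tau : R[i]) (r s : rat) : qpow tau (r + s) = qpow tau r * qpow tau s.
Proof. by rewrite /qpow rmorphD mulrDl eeD. Qed.

Lemma qpow_nat (tau : R[i]) (n : nat) : qpow tau n%:R = qpow tau 1 ^+ n.
Proof.
elim: n => [|n IH]; first by rewrite /qpow rmorph0 mul0r ee0.
by rewrite -natr1 qpowD IH exprSr.
Qed.

Definition is_qseries (F : R[i] -> R[i]) := exists u : nat -> R[i], forall tau,
  0 < complex.Im tau ->
  series (fun j => u j * qpow tau j%:R : R[i]^o) @ \oo --> (F tau : R[i]^o).

Lemma qseries_scale c F : is_qseries F -> is_qseries (fun tau => c * F tau).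
Proof.
move=> [u Hu]; exists (fun j => c * u j) => tau t0.
have -> : series (fun j => c * u j * qpow tau j%:R : R[i]^o) =
    (fun n => c * series (fun j => u j * qpow tau j%:R) n).
  by apply/funext => n; rewrite /series /= mulr_sumr; apply: eq_bigr => i _; rewrite mulrA.
exact: (@cvgMl_tmp R[i] _ _ _ (series (fun j => u j * qpow tau j%:R) : nat -> R[i]^o)) (Hu _ t0).
Qed.

Lemma qseries_add F G : is_qseries F -> is_qseries G -> is_qseries (fun tau => F tau + G tau).
Proof.
move=> [u Hu] [v Hv]; exists (fun j => u j + v j) => tau t0.
have -> : series (fun j => (u j + v j) * qpow tau j%:R : R[i]^o) =
    (series (fun j => u j * qpow tau j%:R) + series (fun j => v j * qpow tau j%:R) : nat -> R[i]^o).
  apply/funext => n; rewrite /series /=.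
  by under eq_bigr do rewrite mulrDl; rewrite big_split.
exact: (@cvgD _ _ _ _ _ (series (fun j => u j * qpow tau j%:R) : nat -> R[i]^o)) (Hu _ t0) (Hv _ t0).
Qed.

Lemma qseries_sum (I : eqType) (r : seq I) (F : I -> R[i] -> R[i]) :
  (forall i, i \in r -> is_qseries (F i)) -> is_qseries (fun tau => \sum_(i <- r) F i tau).
Proof.
elim: r => [|i r IH] HF.
  have -> : (fun tau => \sum_(i <- [::]) F i tau) = (fun=> 0).
    by apply/funext => tau; rewrite big_nil.
  exists (fun=> 0) => tau _.
  have -> : series (fun j => 0 * qpow tau j%:R : R[i]^o) = (fun=> 0).
    by apply/funext => n; rewrite /series /= big1 // => j _; rewrite mul0r.
  exact: cvg_cst.
have -> : (fun tau => \sum_(j <- i :: r) F j tau) = (fun tau => F i tau + \sum_(j <- r) F j tau).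
  by apply/funext => tau; rewrite big_cons.
apply: qseries_add; first by apply: HF; exact: mem_head.
by apply: IH => j jr; apply: HF; rewrite inE jr orbT.
Qed.

Lemma qseries_dsum (N : nat -> nat -> nat) : (forall m n, m + n <= (N m n).+1)%N ->
  is_qseries (fun tau => dsum (fun m n => qpow tau (N m n)%:R)).
Proof.
move=> NN; exists (fun j => (level_count N j)%:R) => tau t0.
have -> : (fun m n => qpow tau (N m n)%:R) = (fun m n => qpow tau 1 ^+ N m n).
  by apply/funext => m; apply/funext => n; rewrite qpow_nat.
have -> : (fun j => (level_count N j)%:R * qpow tau j%:R : R[i]^o) =
    (fun j => (level_count N j)%:R * qpow tau 1 ^+ j).
  by apply/funext => j; rewrite qpow_nat.
apply: power_series_cvg NN _ (norm_qpow tau 1).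
rewrite expR_gt0 -expR0 ltr_expR oppr_lt0 rmorph1 mul1r.
by rewrite !mulr_gt0 ?pi_gt0.
Qed.

End PowerSeries.

(** * The weight matrix of an H-graph *)

Section Determinant.
Variable A : comNzRingType.

(* A form of the determinant that reduces on concrete sizes. *)
Fixpoint laplace (n : nat) (f : nat -> nat -> A) : A :=
  if n is n'.+1 then
    foldr (fun j acc => f 0%N j * ((-1) ^+ j * laplace n' (fun r s => f r.+1 (bump j s))) + acc)
      0 (iota 0 n)
  else 1.

Lemma det_laplace n (f : nat -> nat -> A) : \det (\matrix_(i < n, j < n) f i j) = laplace n f.
Proof.
elim: n f => [|n IH] f; first by rewrite det_mx00.
rewrite (expand_det_row _ ord0).
have E (F : nat -> A) m l : foldr (fun j acc => F j + acc) 0 (iota m l) =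
    \sum_(m <= j < m + l) F j.
  elim: l m => [|l IHl] m /=; first by rewrite addn0 big_geq.
  by rewrite IHl [RHS]big_ltn ?addSnnS // -addSnnS leq_addr.
pose F j := f 0%N j * ((-1) ^+ j * laplace n (fun r s => f r.+1 (bump j s))).
apply: etrans (esym (E F 0%N n.+1)).
rewrite add0n big_mkord; apply: eq_bigr => j _; rewrite mxE; congr (_ * _).
rewrite /cofactor -IH add0n; congr (_ * \det _).
by apply/matrixP => r s; rewrite !mxE.
Qed.

End Determinant.

Section WeightMatrix.
Variable G : Hgraph.

Definition Wentry (i j : nat) : int :=
  if i == j then nth 0 [:: w1 G; w2 G; w3 G; w4 G; w5 G; w6 G] i
  else (((i, j) \in Hedges) || ((j, i) \in Hedges))%:R.

Lemma WmxE : Wmx G = \matrix_(i, j) Wentry i j.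
Proof. by apply/matrixP => i j; rewrite !mxE. Qed.

Lemma det_Wmx : \det (Wmx G) = Hc0 G * Ha G - HM G * HN G.
Proof.
rewrite WmxE det_laplace /= /Wentry /= /Hc0 /Ha /HM /HN.
ring.
Qed.

Lemma quad_form_Wmx (v : 'cV[int]_6) (x : nat -> int) : (forall i : 'I_6, v i 0 = x i) ->
  (v^T *m Wmx G *m v) 0 0 =
  w1 G * x 0%N ^+ 2 + w2 G * x 1%N ^+ 2 + 2 * x 0%N * x 1%N +
  (w3 G * x 2%N ^+ 2 + 2 * x 2%N * x 0%N) + (w4 G * x 3%N ^+ 2 + 2 * x 3%N * x 0%N) +
  (w5 G * x 4%N ^+ 2 + 2 * x 4%N * x 1%N) + (w6 G * x 5%N ^+ 2 + 2 * x 5%N * x 1%N).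
Proof.
move=> vx; rewrite WmxE mxE.
under eq_bigr => j _.
  rewrite mxE vx.
  under eq_bigr => i _ do rewrite !mxE vx.
  over.
rewrite !big_ord_recl !big_ord0 /= /bump /= /Wentry /=.
ring.
Qed.

Lemma mul_Wmx (v : 'cV[int]_6) (x : nat -> int) : (forall i : 'I_6, v i 0 = x i) ->
  Wmx G *m v = \col_(i < 6) nth 0
    [:: w1 G * x 0%N + x 1%N + x 2%N + x 3%N; x 0%N + w2 G * x 1%N + x 4%N + x 5%N;
        x 0%N + w3 G * x 2%N; x 0%N + w4 G * x 3%N; x 1%N + w5 G * x 4%N; x 1%N + w6 G * x 5%N] i.
Proof.
move=> vx; apply/colP => i; rewrite WmxE !mxE.
under eq_bigr => j _ do rewrite mxE vx.
rewrite !big_ord_recl !big_ord0 /= /bump /= /Wentry.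
case: i => [[|[|[|[|[|[|//]]]]]] ?] /=; ring.
Qed.

Lemma HdegE (i : 'I_6) : Hdeg i = if (i < 2)%N then 3 else 1.
Proof.
rewrite /Hdeg -sum1_card big_mkcond !big_ord_recl !big_ord0 /= /Hadj /in_mem /= /Hadj /=.
by case: i => [[|[|[|[|[|[|//]]]]]] ?].
Qed.

End WeightMatrix.

(** * Sums over label vectors as iterated sums *)

Section FinfunSums.
Variables (T : finType) (V : nmodType).

Definition fcons n (x : T) (l : {ffun 'I_n -> T}) : {ffun 'I_n.+1 -> T} :=
  [ffun i => if unlift ord0 i is Some j then l j else x].

Lemma fcons0 n x (l : {ffun 'I_n -> T}) : fcons x l ord0 = x.
Proof. by rewrite ffunE unlift_none. Qed.

Lemma fconsS n x (l : {ffun 'I_n -> T}) j : fcons x l (lift ord0 j) = l j.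
Proof. by rewrite ffunE liftK. Qed.

Lemma sum_fcons n (F : {ffun 'I_n.+1 -> T} -> V) :
  \sum_l F l = \sum_x \sum_(l : {ffun 'I_n -> T}) F (fcons x l).
Proof.
rewrite pair_big /= (reindex (fun p : T * {ffun 'I_n -> T} => fcons p.1 p.2)) //=.
exists (fun l => (l ord0, [ffun j => l (lift ord0 j)])) => [[x l] _|l _] /=.
  by rewrite fcons0; congr pair; apply/ffunP => j; rewrite ffunE fconsS.
by apply/ffunP => i; rewrite ffunE; case: unliftP => [j ->|->] //; rewrite ffunE.
Qed.

Lemma sum_ffun0 (F : {ffun 'I_0 -> T} -> V) (l0 : {ffun 'I_0 -> T}) : \sum_l F l = F l0.
Proof.
rewrite (bigD1 l0) //= big1 ?addr0 // => l; apply: contraNeq => _.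
by apply/eqP/ffunP => -[].
Qed.

Lemma sum_ffun6 (F : {ffun 'I_6 -> T} -> V) (H : T -> T -> T -> T -> T -> T -> V) :
  (forall l : {ffun 'I_6 -> T}, F l = H (l (inord 0)) (l (inord 1)) (l (inord 2)) (l (inord 3))
     (l (inord 4)) (l (inord 5))) ->
  \sum_l F l = \sum_a \sum_b \sum_c \sum_d \sum_e \sum_f H a b c d e f.
Proof.
move=> FH; rewrite sum_fcons; apply: eq_bigr => a _.
rewrite sum_fcons; apply: eq_bigr => b _; rewrite sum_fcons; apply: eq_bigr => c _.
rewrite sum_fcons; apply: eq_bigr => d _; rewrite sum_fcons; apply: eq_bigr => e _.
rewrite sum_fcons; apply: eq_bigr => f _.
have l0 : {ffun 'I_0 -> T} by apply: finfun => -[].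
rewrite (sum_ffun0 _ l0) FH.
have i0 : inord 0 = ord0 :> 'I_6 by apply: val_inj; rewrite /= inordK.
have i1 : inord 1 = lift ord0 ord0 :> 'I_6 by apply: val_inj; rewrite /= inordK.
have i2 : inord 2 = lift ord0 (lift ord0 ord0) :> 'I_6 by apply: val_inj; rewrite /= inordK.
have i3 : inord 3 = lift ord0 (lift ord0 (lift ord0 ord0)) :> 'I_6.
  by apply: val_inj; rewrite /= inordK.
have i4 : inord 4 = lift ord0 (lift ord0 (lift ord0 (lift ord0 ord0))) :> 'I_6.
  by apply: val_inj; rewrite /= inordK.
have i5 : inord 5 = lift ord0 (lift ord0 (lift ord0 (lift ord0 (lift ord0 ord0)))) :> 'I_6.
  by apply: val_inj; rewrite /= inordK.
by rewrite i0 i1 i2 i3 i4 i5 !fconsS !fcons0.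
Qed.

End FinfunSums.

Lemma det2 (A : comNzRingType) (M : 'M[A]_2) : \det M = M 0 0 * M 1 1 - M 0 1 * M 1 0.
Proof.
pose f (i j : nat) := M (inord i) (inord j).
have -> : M = \matrix_(i, j) f i j by apply/matrixP => i j; rewrite mxE /f !inord_val.
rewrite det_laplace /= !mxE /bump /=; ring.
Qed.

(** * Indefinite symmetric matrices of size two *)

Section IndefiniteBlock.
Variable R : realType.
Implicit Type S : 'M[R]_2.

Lemma mup_root2 (x y : R) : x != y -> mup x (('X - x%:P) * ('X - y%:P)) = 1%N.
Proof.
move=> xy; rewrite mupMl; last by rewrite root_XsubC.
by rewrite -['X - _]expr1 mup_XsubCX eqxx.
Qed.

(** A negative determinant makes the discriminant of the characteristic polynomial positive and its
    two real roots of opposite sign. *)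
Lemma signature_indefinite S : \det S < 0 -> signature S = 0.
Proof.
move=> S0; pose T := S 0 0 + S 1 1; pose d := T ^+ 2 - 4 * \det S.
have d0 : 0 < d.
  have : 0 <= T ^+ 2 by apply: sqr_ge0.
  by rewrite /d; lra.
have sd2 : Num.sqrt d ^+ 2 = d by rewrite sqr_sqrtr // ltW.
have sd0 : 0 < Num.sqrt d by rewrite sqrtr_gt0.
pose x := (T + Num.sqrt d) / 2; pose y := (T - Num.sqrt d) / 2.
have xyE : x * y = \det S.
  transitivity ((T ^+ 2 - Num.sqrt d ^+ 2) / 4); first by rewrite /x /y; field.
  by rewrite sd2 /d; field.
have xyT : x + y = T by rewrite /x /y; field.
have yx : y < x by rewrite /x /y; lra.
have [y0 x0] : y < 0 /\ 0 < x.
  have [y0|y0] := ltP y 0; have [x0|x0] := ltP 0 x => //.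
  - have : 0 <= x * y by rewrite mulr_le0 // ltW.
    by rewrite xyE leNgt S0.
  - have : 0 <= x * y by rewrite mulr_ge0 // ltW.
    by rewrite xyE leNgt S0.
  - by move: yx; rewrite ltNge (le_trans x0).
have pE : char_poly S = ('X - y%:P) * ('X - x%:P).
  rewrite /char_poly det2 !mxE /= !mulr1n !mulr0n !sub0r mulrNN.
  have prod (u v : R) : ('X - v%:P) * ('X - u%:P) = 'X ^+ 2 - (u + v)%:P * 'X + (u * v)%:P.
    by rewrite polyCD polyCM; ring.
  rewrite prod xyE xyT det2 /T polyCB polyCD !polyCM.
  by ring.
have p0 : char_poly S != 0 by rewrite monic_neq0 // char_poly_monic.
have perm : perm_eq (rootsR (char_poly S)) [:: y; x].
  apply: uniq_perm; first exact: uniq_roots.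
    by rewrite /= inE lt_eqF.
  move=> z; have := roots_on_rootsR p0 z; rewrite in_itv /= => <-.
  by rewrite pE rootM !root_XsubC !inE.
have xy : x != y by rewrite gt_eqF.
have yx' : y != x by rewrite eq_sym.
rewrite /signature !(perm_big _ perm) /= !big_cons !big_nil x0 y0 /=.
rewrite [0 < y]ltNge (ltW y0) [x < 0]ltNge (ltW x0) /= !addn0 pE.
by rewrite (mup_root2 yx') mulrC (mup_root2 xy) subrr.
Qed.

Lemma indefinite_det S : S 0 1 = S 1 0 -> \det S != 0 -> indefinite S -> \det S < 0.
Proof.
move=> sym d0 [[x xpos] [y yneg]]; rewrite lt_neqAle d0 leNgt; apply/negP => dpos.
have q (z : 'rV[R]_2) : (z *m S *m z^T) 0 0 =
    S 0 0 * z 0 0 ^+ 2 + 2 * S 0 1 * z 0 0 * z 0 1 + S 1 1 * z 0 1 ^+ 2.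
  rewrite mxE !big_ord_recl big_ord0 !mxE !big_ord_recl !big_ord0.
  have -> : lift ord0 ord0 = 1 :> 'I_2 by apply: val_inj.
  rewrite -[ord0]/(0 : 'I_2) -sym; ring.
rewrite !q in xpos yneg; rewrite det2 -sym in dpos.
move: xpos yneg dpos; move: (x 0 0) (x 0 1) (y 0 0) (y 0 1) (S 0 0) (S 0 1) (S 1 1).
move=> a b c d p r t xpos yneg dpos.
(* Completing the square: if the determinant were positive, the form would have the sign of its
   first coefficient p everywhere. *)
have id (u v : R) : p * (p * u ^+ 2 + 2 * r * u * v + t * v ^+ 2) =
    (p * u + r * v) ^+ 2 + (p * t - r * r) * v ^+ 2 by ring.
have pos (u v : R) : 0 <= p * (p * u ^+ 2 + 2 * r * u * v + t * v ^+ 2).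
  by rewrite id addr_ge0 ?sqr_ge0 // mulr_ge0 ?sqr_ge0 // ltW.
have := pos a b; have := pos c d.
have [p0|p0|p0] := ltrgtP p 0.
- by rewrite nmulr_rge0 // nmulr_rge0 // => _; rewrite leNgt xpos.
- by rewrite !pmulr_rge0 //; rewrite leNgt yneg.
- move: dpos; rewrite p0 mul0r sub0r oppr_gt0 => rr.
  by have := sqr_ge0 r; rewrite expr2 leNgt rr.
Qed.

End IndefiniteBlock.

(** * Consequences of the hypotheses on the weights *)

Section HgraphFacts.
Variables (R : realType) (G : Hgraph).
Hypothesis det_W : \det (Wmx G) = 1 \/ \det (Wmx G) = -1.
Hypothesis indef_S : indefinite (Smx R G).
Hypotheses (w3_neq : w3 G <> 1 /\ w3 G <> -1) (w4_neq : w4 G <> 1 /\ w4 G <> -1).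
Hypotheses (w5_neq : w5 G <> 1 /\ w5 G <> -1) (w6_neq : w6 G <> 1 /\ w6 G <> -1).

Local Notation D := (\det (Wmx G)).
Local Notation M := (HM G).
Local Notation N := (HN G).
Local Notation a := (Ha G).
Local Notation c := (Hc0 G).

Lemma D_sqr : D ^+ 2 = 1.
Proof. by case: det_W => ->. Qed.

Lemma ca_eq : c * a = M * N + D.
Proof. by rewrite det_Wmx addrCA subrr addr0. Qed.

Lemma WmxR_unit : WmxR R G \in unitmx.
Proof.
rewrite unitmxE /WmxR det_map_mx unitfE intr_eq0 -sqrf_eq0 D_sqr //.
Qed.

(** A column of the inverse is read off from an integer solution of W v = e_j, so no inverse matrix
    is ever computed. *)
Lemma inv_WmxR (v : nat -> int) (j : 'I_6) :
  (forall i : 'I_6, nth 0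
    [:: w1 G * v 0%N + v 1%N + v 2%N + v 3%N; v 0%N + w2 G * v 1%N + v 4%N + v 5%N;
        v 0%N + w3 G * v 2%N; v 0%N + w4 G * v 3%N; v 1%N + w5 G * v 4%N; v 1%N + w6 G * v 5%N] i =
    (i == j)%:R) ->
  forall i : 'I_6, invmx (WmxR R G) i j = (v i)%:~R.
Proof.
move=> vj i; pose x : 'cV[int]_6 := \col_i v i.
have E : WmxR R G *m map_mx intr x = delta_mx j 0.
  rewrite -map_mxM (@mul_Wmx _ _ v) => [|r]; last by rewrite mxE.
  by apply/colP => r; rewrite !mxE vj eqxx andbT; case: (r == j).
have := congr1 (fun z => (invmx (WmxR R G) *m z) i 0) E.
rewrite mulmxA mulVmx ?WmxR_unit // mul1mx -colE !mxE => <-.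
by [].
Qed.

Lemma SmxE : [/\ Smx R G 0 0 = (D * (M * a))%:~R, Smx R G 0 1 = (D * (M * N))%:~R,
  Smx R G 1 0 = (D * (M * N))%:~R & Smx R G 1 1 = (D * (N * c))%:~R].
Proof.
have solve := unimodular_solve D_sqr ca_eq.
have [u1 [u2 [u3 [u4 [u5 [u6 [E1 E2 [E3 E4] [E5 E6] [U1 U2]]]]]]]] := solve 1 0 0 0 0 0.
have [v1 [v2 [v3 [v4 [v5 [v6 [F1 F2 [F3 F4] [F5 F6] [V1 V2]]]]]]]] := solve 0 1 0 0 0 0.
pose j0 : 'I_6 := lshift 4 (0 : 'I_2); pose j1 : 'I_6 := lshift 4 (1 : 'I_2).
have H0 : forall i, invmx (WmxR R G) i j0 = (nth 0 [:: u1; u2; u3; u4; u5; u6] i)%:~R.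
  apply: (inv_WmxR (v := fun i => nth 0 [:: u1; u2; u3; u4; u5; u6] i)).
  by case=> [[|[|[|[|[|[|//]]]]]] ?] /=; rewrite ?E1 ?E2 ?E3 ?E4 ?E5 ?E6.
have H1 : forall i, invmx (WmxR R G) i j1 = (nth 0 [:: v1; v2; v3; v4; v5; v6] i)%:~R.
  apply: (inv_WmxR (v := fun i => nth 0 [:: v1; v2; v3; v4; v5; v6] i)).
  by case=> [[|[|[|[|[|[|//]]]]]] ?] /=; rewrite ?F1 ?F2 ?F3 ?F4 ?F5 ?F6.
rewrite /Smx; split.
- rewrite !mxE (H0 j0) /= U1 -rmorphN; congr _%:~R; rewrite /HM /HN /Ha; ring.
- rewrite !mxE (H1 j0) /= V1 -rmorphN; congr _%:~R; rewrite /HM /HN /Ha; ring.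
- rewrite !mxE (H0 j1) /= U2 -rmorphN; congr _%:~R; rewrite /HM /HN /Hc0; ring.
- rewrite !mxE (H1 j1) /= V2 -rmorphN; congr _%:~R; rewrite /HM /HN /Hc0; ring.
Qed.

Lemma det_Smx : \det (Smx R G) = (M * N * D)%:~R.
Proof.
have [S00 S01 S10 S11] := SmxE; rewrite det2 S00 S01 S10 S11 -!rmorphM -rmorphB.
congr _%:~R.
transitivity (D ^+ 2 * (M * N * (c * a - M * N))); first by ring.
by rewrite D_sqr mul1r ca_eq addrAC subrr add0r.
Qed.

Lemma mul_neq_unit (x y : int) : x <> 1 /\ x <> -1 -> x * y <> 1 /\ x * y <> -1.
Proof.
move=> [x1 x2].
have H : `|x|%N != 1%N by apply/eqP => E; have := abszE x; rewrite E; lia.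
by split=> E; move: (congr1 absz E); rewrite abszM => /eqP; rewrite muln_eq1 (negbTE H).
Qed.

(** If M = 0 then c a = D = +-1, while c reduces to one of w3, w4, the other being zero; this
    contradicts w3, w4 != +-1. *)
Lemma M_neq0 : M != 0.
Proof.
apply/eqP => M0; have := det_Wmx G; rewrite M0 mul0r subr0 => DE.
have : c = w3 G + w4 G.
  rewrite /Hc0 -[- w1 G * _ * _]mulrA; move: M0; rewrite /HM => ->.
  by rewrite mulr0 add0r.
move: M0 => /eqP; rewrite /HM mulf_eq0 => /orP[] /eqP z; rewrite z ?add0r ?addr0 => cE.
  by case: (@mul_neq_unit (w4 G) a w4_neq) => n1 n2; case: det_W => E;
    rewrite E cE in DE; [case: n1|case: n2].
by case: (@mul_neq_unit (w3 G) a w3_neq) => n1 n2; case: det_W => E;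
    rewrite E cE in DE; [case: n1|case: n2].
Qed.

Lemma N_neq0 : N != 0.
Proof.
apply/eqP => N0; have := det_Wmx G; rewrite N0 mulr0 subr0 mulrC => DE.
have : a = w5 G + w6 G.
  rewrite /Ha -[- w2 G * _ * _]mulrA; move: N0; rewrite /HN => ->.
  by rewrite mulr0 add0r.
move: N0 => /eqP; rewrite /HN mulf_eq0 => /orP[] /eqP z; rewrite z ?add0r ?addr0 => aE.
  by case: (@mul_neq_unit (w6 G) c w6_neq) => n1 n2; case: det_W => E;
    rewrite E aE in DE; [case: n1|case: n2].
by case: (@mul_neq_unit (w5 G) c w5_neq) => n1 n2; case: det_W => E;
    rewrite E aE in DE; [case: n1|case: n2].
Qed.

Lemma weights_neq0 : [/\ w3 G != 0, w4 G != 0, w5 G != 0 & w6 G != 0].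
Proof.
have := M_neq0; have := N_neq0; rewrite /HM /HN !mulf_eq0 !negb_or.
by move=> /andP[-> ->] /andP[-> ->].
Qed.

Lemma MND_lt0 : M * N * D < 0.
Proof.
have [S00 S01 S10 S11] := SmxE.
have D0 : D != 0 by rewrite -sqrf_eq0 D_sqr.
have := indefinite_det _ _ indef_S; rewrite det_Smx S01 S10 ltrz0; apply=> //.
by rewrite intr_eq0 mulf_neq0 // mulf_neq0 ?M_neq0 ?N_neq0.
Qed.

Lemma sigmaS_eq0 : sigmaS R G = 0.
Proof. by apply: signature_indefinite; rewrite det_Smx ltrz0 MND_lt0. Qed.

Lemma MN_neq1 : M * N <> 1 /\ M * N <> -1.
Proof. by apply: mul_neq_unit; apply: mul_neq_unit. Qed.

(** The integers c a and M N differ by 1 and |M N| >= 2, so they have the same sign. Hence a and c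
    are nonzero, and M a and N c have the same sign. *)
Lemma ca_MN_gt0 : 0 < c * a * (M * N).
Proof.
rewrite ca_eq; have := MND_lt0; have := MN_neq1; move: (M * N) => p [p1 p2].
have [E|E] := det_W; rewrite E ?mulr1 ?mulrN1 => p0.
  by rewrite nmulr_rgt0 //; lia.
by rewrite pmulr_lgt0; lia.
Qed.

Lemma a_neq0 : a != 0.
Proof. by apply: contraTneq ca_MN_gt0 => ->; rewrite mulr0 mul0r ltxx. Qed.

Lemma c_neq0 : c != 0.
Proof. by apply: contraTneq ca_MN_gt0 => ->; rewrite !mul0r ltxx. Qed.

Lemma sgn_sqr x : sgn x ^+ 2 = 1.
Proof. by rewrite /sgn; case: ifP. Qed.

Lemma sgn_norm x : sgn x * x = `|x|.
Proof.
rewrite /sgn; case: (leP 0 x) => x0; first by rewrite mul1r ger0_norm.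
by rewrite mulN1r ltr0_norm.
Qed.

Lemma norm_sgn x : sgn x * `|x| = x.
Proof. by rewrite -sgn_norm mulrA -expr2 sgn_sqr mul1r. Qed.

Lemma sgn_sgz x : x != 0 -> sgn x = sgz x.
Proof.
move=> xn0; rewrite /sgn; have [x0|x0|x0] := sgzP x.
- by rewrite x0 eqxx in xn0.
- by [].
- by [].
Qed.

Lemma sgnM x y : x != 0 -> y != 0 -> sgn (x * y) = sgn x * sgn y.
Proof. by move=> x0 y0; rewrite !sgn_sgz ?mulf_neq0 // sgzM. Qed.

Lemma eps_sqr : eps G ^+ 2 = 1.
Proof. by rewrite /eps exprMn sgn_sqr mul1r D_sqr. Qed.

(** Since M a and N c share their sign, the factor eps turns both absolute values of the squared
    terms into entries of S; the cross term keeps the relative sign of M a and M N, which is sgn(N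
    a). *)
Lemma Qform_Sform (x y : rat) :
  (eps G)%:~R * Qform G x y =
  Sform (w1 G) (w2 G) (w3 G) (w4 G) (w5 G) (w6 G) D x ((sgn (N * a))%:~R * y).
Proof.
have M0 := M_neq0; have N0 := N_neq0; have a0 := a_neq0; have c0 := c_neq0.
have E1 : eps G * `|M * a| = D * (M * a).
  by rewrite /eps mulrAC norm_sgn mulrC.
have E2 : eps G * `|M * N| = D * (M * N) * sgn (N * a).
  rewrite /eps -sgn_norm (sgnM M0 a0) (sgnM M0 N0) (sgnM N0 a0).
  transitivity (D * (M * N) * (sgn N * sgn a) * sgn M ^+ 2); first by ring.
  by rewrite sgn_sqr mulr1.
have E3 : eps G * `|N * c| = D * (N * c).
  rewrite /eps; have -> : sgn (M * a) = sgn (N * c).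
    rewrite (sgn_sgz (mulf_neq0 M0 a0)) (sgn_sgz (mulf_neq0 N0 c0)).
    have : 0 < (M * a) * (N * c) 
      by rewrite (_ : M * a * (N * c) = c * a * (M * N)) ?ca_MN_gt0 //; ring.
    move=> /gtr0_sgz; rewrite sgzM.
    by case: (sgzP (M * a)) => _; case: (sgzP (N * c)).
  by rewrite mulrAC norm_sgn mulrC.
transitivity ((eps G * `|M * a|)%:~R * x ^+ 2 + 2 * (eps G * `|M * N|)%:~R * x * y +
  (eps G * `|N * c|)%:~R * y ^+ 2).
  by rewrite /Qform !(rmorphM _ (eps G)) /=; ring.
have s2 : (sgn (N * a))%:~R ^+ 2 = 1 :> rat by rewrite -rmorphXn /= sgn_sqr.
rewrite E1 E2 E3 /Sform exprMn s2 mul1r -/(HM G) -/(HN G) -/(Ha G) -/(Hc0 G).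
by rewrite !(rmorphM) /=; ring.
Qed.

End HgraphFacts.

(** * The theta series *)

Section DoubleSums.
Variable R : realType.
Implicit Types (F : nat -> nat -> R[i]) (l : R[i]).

Definition dsums F l :=
  (fun K => \sum_(m < K) \sum_(n < K) F m n : R[i]^o) @ \oo --> (l : R[i]^o).

Lemma dsum_eq F l : dsums F l -> dsum F = l.
Proof. by move=> Fl; apply: (@cvg_lim (R[i]^o)) => //; exact: (@norm_hausdorff _ (R[i]^o)). Qed.

Lemma dsums_scale c F l : dsums F l -> dsums (fun m n => c * F m n) (c * l).
Proof.
move=> Fl; rewrite /dsums.
have -> : (fun K => \sum_(m < K) \sum_(n < K) c * F m n : R[i]^o) =
    (fun K => c * (\sum_(m < K) \sum_(n < K) F m n)).
  by apply/funext => K; rewrite mulr_sumr; apply: eq_bigr => m _; rewrite mulr_sumr.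
exact: (@cvgMl_tmp R[i] _ _ _ (fun K => \sum_(m < K) \sum_(n < K) F m n : R[i]^o)) Fl.
Qed.

Lemma dsums_sum (I : Type) (r : seq I) (F : I -> nat -> nat -> R[i]) (l : I -> R[i]) :
  (forall i, dsums (F i) (l i)) ->
  dsums (fun m n => \sum_(i <- r) F i m n) (\sum_(i <- r) l i).
Proof.
move=> Fl; rewrite /dsums.
have -> : (fun K => \sum_(m < K) \sum_(n < K) \sum_(i <- r) F i m n : R[i]^o) =
    (fun K => \sum_(i <- r) \sum_(m < K) \sum_(n < K) F i m n).
  apply/funext => K; rewrite [RHS]exchange_big; apply: eq_bigr => m _.
  by rewrite [RHS]exchange_big.
elim: r => [|i r IH].
  have -> : (fun K => \sum_(i <- [::]) \sum_(m < K) \sum_(n < K) F i m n : R[i]^o) = (fun=> 0).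
    by apply/funext => K; rewrite big_nil.
  by rewrite big_nil; exact: cvg_cst.
have -> : (fun K => \sum_(j <- i :: r) \sum_(m < K) \sum_(n < K) F j m n : R[i]^o) =
    (fun K => \sum_(m < K) \sum_(n < K) F i m n : R[i]^o) +
    (fun K => \sum_(j <- r) \sum_(m < K) \sum_(n < K) F j m n : R[i]^o).
  by apply/funext => K; rewrite big_cons.
rewrite big_cons.
exact: (@cvgD _ _ _ _ _ (fun K => \sum_(m < K) \sum_(n < K) F i m n : R[i]^o)) (Fl i) IH.
Qed.

Lemma dom2_dsums (r C : R) F : 0 <= r -> r < 1 -> dom2 C r F -> dsums F (dsum F).
Proof.
by move=> r0 r1 FC; have := square_cvg r0 r1 FC; rewrite -(dsumE r0 r1 FC).
Qed.

End DoubleSums.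

(** * Sums over leaf exponents *)

Section LeafExponents.
Local Notation signs := [:: 1; -1 : int].

(** Sign pairs with the same exponent are merged in the duplicate-free list, but their coefficients
    add up, so the sum over exponents is the sum over all sign pairs. *)
Lemma undup_sum (T : eqType) (V : comPzRingType) (g : int -> int -> T) (f : T -> V) :
  \sum_(x <- undup [seq g s t | s <- signs, t <- signs])
    (\sum_(s <- signs) \sum_(t <- signs | x == g s t) (s * t))%:~R * f x =
  \sum_(s <- signs) \sum_(t <- signs) (s * t)%:~R * f (g s t).
Proof.
set L := undup _.
transitivity (\sum_(x <- L) \sum_(s <- signs) \sum_(t <- signs)
    (if x == g s t then (s * t)%:~R * f x else 0)).
  apply: eq_bigr => x _; rewrite rmorph_sum mulr_suml; apply: eq_bigr => s _.
  by rewrite rmorph_sum mulr_suml -big_mkcond.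
rewrite exchange_big; apply: eq_big_seq => s ss.
rewrite exchange_big; apply: eq_big_seq => t ts /=.
rewrite -big_mkcond -big_filter.
have -> : [seq i <- L | i == g s t] = [:: g s t].
  apply: perm_small_eq => //; apply: uniq_perm => //.
    by rewrite filter_uniq // undup_uniq.
  move=> x; rewrite mem_filter inE; case: eqP => //= ->.
  by rewrite mem_undup; apply/allpairsP; exists (s, t).
by rewrite big_seq1.
Qed.

Lemma leaf_sum (V : comPzRingType) (u v : int) (f : rat -> V) :
  \sum_(al <- leaf_exps u v) (leaf_coef u v al)%:~R * f al =
  \sum_(s <- signs) \sum_(t <- signs) (s * t)%:~R * f (leaf_exp u v s t).
Proof. exact: undup_sum. Qed.

Lemma leaf_expsP (u v : int) al : al \in leaf_exps u v ->
  exists s t, [/\ s \in signs, t \in signs & al = leaf_exp u v s t].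
Proof. by rewrite mem_undup => /allpairsP[[s t] [/= ss ts ->]]; exists s, t. Qed.

(** With w != +-1 each leaf moves an exponent away from 1/2 by at most 1/4, so two leaves keep it in
    [0, 1]. *)
Lemma half_inv_le (w : int) : w != 0 -> w <> 1 /\ w <> -1 -> `|(2 * w%:~R)^-1| <= 1 / 4 :> rat.
Proof.
move=> w0 [w1 w2]; have w2' : (2 <= `|w|)%R by lia.
have {}w2' : 2 <= `|w%:~R| :> rat by rewrite -intr_norm (_ : 2 = 2%:~R) // ler_int.
have w4 : 4 <= `|2 * w%:~R| :> rat by rewrite normrM ger0_norm //; lra.
by rewrite normfV div1r lef_pV2 ?posrE // (lt_le_trans _ w4).
Qed.

Lemma leaf_exp_ge0 (u v : int) s t : u != 0 -> v != 0 ->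
  u <> 1 /\ u <> -1 -> v <> 1 /\ v <> -1 -> s \in signs -> t \in signs ->
  0 <= leaf_exp u v s t.
Proof.
move=> u0 v0 u1 v1 ss ts.
have := half_inv_le u0 u1; have := half_inv_le v0 v1; rewrite !ler_norml /leaf_exp.
move: ((2 * u%:~R)^-1) ((2 * v%:~R)^-1) ss ts => p q; rewrite !inE.
by move=> /orP[] /eqP -> /orP[] /eqP -> /andP[? ?] /andP[? ?]; rewrite ?rmorphN ?rmorph1; lra.
Qed.

End LeafExponents.

(** * Convergence and integrality of the theta series *)

Section Theta.
Variables (R : realType) (G : Hgraph).
Hypothesis det_W : \det (Wmx G) = 1 \/ \det (Wmx G) = -1.
Hypothesis indef_S : indefinite (Smx R G).
Hypotheses (w3_neq : w3 G <> 1 /\ w3 G <> -1) (w4_neq : w4 G <> 1 /\ w4 G <> -1).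
Hypotheses (w5_neq : w5 G <> 1 /\ w5 G <> -1) (w6_neq : w6 G <> 1 /\ w6 G <> -1).

Local Notation D := (\det (Wmx G)).
Local Notation signs := [:: 1; -1 : int].

(** The coefficients of the squares are nonzero integers, and i <= i^2. A linear lower bound is all
    that the majorants and the count of exponents require. *)
Lemma Qform_ge (x y : rat) (m n : nat) : 0 <= x -> 0 <= y ->
  (m + n)%:R <= Qform G (x + m%:R) (y + n%:R).
Proof.
move=> x0 y0.
have M0 := M_neq0 det_W w3_neq w4_neq w5_neq w6_neq.
have N0 := N_neq0 det_W w3_neq w4_neq w5_neq w6_neq.
have a0 := a_neq0 det_W indef_S w3_neq w4_neq w5_neq w6_neq.
have c0 := c_neq0 det_W indef_S w3_neq w4_neq w5_neq w6_neq.
have sq (z : rat) (i : nat) (w : int) : 0 <= z -> w != 0 -> i%:R <= `|w|%:~R * (z + i%:R) ^+ 2.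
  move=> z0 w0; apply: (@le_trans _ _ (i%:R ^+ 2)).
    by case: i => [|i]; rewrite ?expr0n // expr2 ler_peMl ?ler0n // ler1n.
  apply: (@le_trans _ _ ((z + i%:R) ^+ 2)).
    by rewrite ler_pXn2r ?nnegrE ?ler0n ?addr_ge0 ?ler0n // lerDr.
  by rewrite ler_peMl ?sqr_ge0 // -[1]/(1%:~R) ler_int -gtz0_ge1 normr_gt0.
have := sq x m _ x0 (mulf_neq0 M0 a0); have := sq y n _ y0 (mulf_neq0 N0 c0).
have : 0 <= 2 * `|HM G * HN G|%:~R * (x + m%:R) * (y + n%:R).
  by rewrite !mulr_ge0 ?addr_ge0 ?ler0n // ler0z normr_ge0.
rewrite natrD /Qform; lra.
Qed.

Lemma theta_term_dom2 (tau : R[i]) al be : 0 < complex.Im tau -> 0 <= al -> 0 <= be ->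
  dom2 1 (expR (- (2 * pi * complex.Im tau))) (theta_term G tau al be).
Proof.
move=> t0 al0 be0 m n; rewrite /theta_term norm_qpow lecR mul1r -exprD -expRM_natr.
rewrite ler_expR mulNr lerN2 mulrA [leRHS]mulrAC ler_wpM2l //.
  by rewrite !mulr_ge0 ?pi_ge0 // ltW.
by rewrite -(ratr_nat R) ler_rat Qform_ge.
Qed.

Lemma rate_tau (tau : R[i]) : 0 < complex.Im tau ->
  0 <= expR (- (2 * pi * complex.Im tau)) /\ expR (- (2 * pi * complex.Im tau)) < 1.
Proof.
move=> t0; split; first exact: expR_ge0.
by rewrite -expR0 ltr_expR oppr_lt0 !mulr_gt0 ?pi_gt0.
Qed.

Lemma leaf34_ge0 al : al \in leaf_exps (w3 G) (w4 G) -> 0 <= al.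
Proof.
have [w30 w40 _ _] := weights_neq0 det_W w3_neq w4_neq w5_neq w6_neq.
by move=> /leaf_expsP[s [t [ss ts ->]]]; apply: leaf_exp_ge0.
Qed.

Lemma leaf56_ge0 be : be \in leaf_exps (w5 G) (w6 G) -> 0 <= be.
Proof.
have [_ _ w50 w60] := weights_neq0 det_W w3_neq w4_neq w5_neq w6_neq.
by move=> /leaf_expsP[s [t [ss ts ->]]]; apply: leaf_exp_ge0.
Qed.

Lemma theta_summable (tau : R[i]) (al be : rat) : 0 < complex.Im tau ->
  al \in leaf_exps (w3 G) (w4 G) -> be \in leaf_exps (w5 G) (w6 G) ->
  dsummable (theta_term G tau al be).
Proof.
move=> t0 /leaf34_ge0 al0 /leaf56_ge0 be0; have [r0 r1] := rate_tau t0.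
have dF := theta_term_dom2 t0 al0 be0; exact: (dom2_summable r0 r1 dF).
Qed.


Lemma Qform_class : exists B : rat, forall s3 s4 s5 s6 (m n : nat),
  s3 \in signs -> s4 \in signs -> s5 \in signs -> s6 \in signs ->
  exists z : int, Qform G (leaf_exp (w3 G) (w4 G) s3 s4 + m%:R)
    (leaf_exp (w5 G) (w6 G) s5 s6 + n%:R) = B + z%:~R.
Proof.
have [w30 w40 w50 w60] := weights_neq0 det_W w3_neq w4_neq w5_neq w6_neq.
pose B0 := Sform (w1 G) (w2 G) (w3 G) (w4 G) (w5 G) (w6 G) D
  (leaf_exp (w3 G) (w4 G) 1 1 + 0%:~R) (leaf_exp (w5 G) (w6 G) 1 1 + 0%:~R).
exists ((eps G)%:~R * B0) => s3 s4 s5 s6 m n.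
have sgnE s : s \in signs -> exists2 d : int, s = 1 - 2 * d & (1 - 2 * d) ^+ 2 = 1.
  by rewrite !inE => /orP[] /eqP ->; [exists 0; rewrite mulr0 subr0 ?expr1n|exists 1].
have sgnEN s : s \in signs -> exists2 d : int, - s = 1 - 2 * d & (1 - 2 * d) ^+ 2 = 1.
  by rewrite !inE => /orP[] /eqP ->; [exists 1|exists 0; rewrite mulr0 subr0 ?expr1n ?opprK].
move=> i3 i4 i5 i6; have [d3 e3 q3] := sgnE _ i3; have [d4 e4 q4] := sgnE _ i4.
have E (x : rat) : x = (eps G)%:~R * ((eps G)%:~R * x).
  by rewrite mulrA -rmorphM -expr2 eps_sqr // mul1r.
rewrite [Qform _ _ _]E (Qform_Sform det_W indef_S w3_neq w4_neq w5_neq w6_neq).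
rewrite e3 e4 -[m%:R]/(m%:Z%:~R).
have mod1 := Sform_mod1 (D_sqr det_W) (ca_eq G).
have descend y : (exists z : int, Sform (w1 G) (w2 G) (w3 G) (w4 G) (w5 G) (w6 G) D
    (leaf_exp (w3 G) (w4 G) (1 - 2 * d3) (1 - 2 * d4) + m%:Z%:~R) y = B0 + z%:~R) ->
  exists z : int, (eps G)%:~R * Sform (w1 G) (w2 G) (w3 G) (w4 G) (w5 G) (w6 G) D
    (leaf_exp (w3 G) (w4 G) (1 - 2 * d3) (1 - 2 * d4) + m%:Z%:~R) y = (eps G)%:~R * B0 + z%:~R.
  by case=> z ->; exists (eps G * z); rewrite mulrDr (intrM _ (eps G) z).
apply: descend; rewrite /sgn; case: ifP => _.
  have [d5 e5 q5] := sgnE _ i5; have [d6 e6 q6] := sgnE _ i6.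
  by rewrite mul1r e5 e6 -[n%:R]/(n%:Z%:~R); apply: mod1.
have [d5 e5 q5] := sgnEN _ i5; have [d6 e6 q6] := sgnEN _ i6.
(* Reversing both leaf signs sends an exponent be to 1 - be, so -(be + n) is the reversed exponent
   plus -1 - n. *)
have -> : (-1)%:~R * (leaf_exp (w5 G) (w6 G) s5 s6 + n%:R) =
    leaf_exp (w5 G) (w6 G) (- s5) (- s6) + (- 1 - n%:Z)%:~R.
  rewrite (intrB _ (- 1) n) /leaf_exp !intrN -[n%:~R]/(n%:R); field.
  by rewrite !intr_eq0 w50 w60.
by rewrite e5 e6; apply: mod1.
Qed.

Lemma theta_qseries : exists c : rat, forall al be,
  al \in leaf_exps (w3 G) (w4 G) -> be \in leaf_exps (w5 G) (w6 G) ->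
  exists2 F : R[i] -> R[i], is_qseries F &
    forall tau, 0 < complex.Im tau -> dsum (theta_term G tau al be) = qpow tau c * F tau.
Proof.
have [B HB] := Qform_class; pose c := B - (Num.floor B)%:~R.
have /andP[c0 c1] : 0 <= c < 1.
  rewrite subr_ge0 Num.Theory.floor_le_tmp ltrBlDl.
  by rewrite -[X in _ + X]/(1%:~R) -rmorphD Num.Theory.floorD1_gt.
exists c => al be ial ibe.
have al0 := leaf34_ge0 ial; have be0 := leaf56_ge0 ibe.
have [s3 [s4 [i3 i4 alE]]] := leaf_expsP ial; have [s5 [s6 [i5 i6 beE]]] := leaf_expsP ibe.
(* The common class modulo 1 is represented by c in [0, 1), so the exponent minus c is an integer
   greater than m + n - 1, hence at least m + n. *)
pose N m n := absz (Num.floor (Qform G (al + m%:R) (be + n%:R) - c)).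
have QN m n : Qform G (al + m%:R) (be + n%:R) = c + (N m n)%:R /\ (m + n <= N m n)%N.
  have [z Qz] := HB s3 s4 s5 s6 m n i3 i4 i5 i6; rewrite -alE -beE in Qz.
  have Qc : Qform G (al + m%:R) (be + n%:R) - c = (z + Num.floor B)%:~R.
    by rewrite Qz /c rmorphD; ring.
  have ge : (m + n)%:Z <= z + Num.floor B.
    rewrite -ltzD1 -(ltr_int rat) [X in _ < X]intrD -Qc.
    by have := Qform_ge m n al0 be0; rewrite -[(m + n)%:Z%:~R]/((m + n)%:R); lra.
  rewrite /N Qc intrKfloor; split; last by lia.
  have -> : (absz (z + Num.floor B))%:R = (z + Num.floor B)%:~R :> rat.
    by rewrite -[LHS]/((absz (z + Num.floor B))%:Z%:~R) gez0_abs //; lia.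
  by rewrite -Qc [RHS]addrC subrK.
exists (fun tau => dsum (fun m n => qpow tau (N m n)%:R)).
  by apply: qseries_dsum => m n; have [_ /leqW] := QN m n.
move=> tau t0; have [r0 r1] := rate_tau t0.
have dF := theta_term_dom2 t0 al0 be0.
have H := dsum_eq (dsums_scale (c := qpow tau (- c)) (dom2_dsums r0 r1 dF)).
have -> : (fun m n => qpow tau (N m n)%:R) =
    (fun m n => qpow tau (- c) * theta_term G tau al be m n).
  apply/funext => m; apply/funext => n; rewrite /theta_term -qpowD.
  by have [-> _] := QN m n; rewrite addKr.
by rewrite H mulrA -qpowD subrr /qpow rmorph0 mul0r ee0 mul1r.
Qed.

Lemma Zhat_in_qC : exists c : rat, in_qC c (@Zhat R G).
Proof.
have [c Hc] := theta_qseries; exists (delta R G + c).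
pose e := @ee R ((sigmaW' R G)%:~R / 8) * (sgn (HN G * Ha G))%:~R.
pose T al be (F : R[i] -> R[i]) := is_qseries F /\ forall tau, 0 < complex.Im tau ->
  dsum (theta_term G tau al be) = qpow tau c * F tau.
(* Extended by zero outside the leaf exponents, so that [choice] gives one family F for all
   pairs. *)
have {}Hc al be : exists F : R[i] -> R[i],
    al \in leaf_exps (w3 G) (w4 G) -> be \in leaf_exps (w5 G) (w6 G) -> T al be F.
  case ial: (al \in leaf_exps (w3 G) (w4 G)); last by exists (fun=> 0).
  case ibe: (be \in leaf_exps (w5 G) (w6 G)); last by exists (fun=> 0).
  by have [F F1 F2] := Hc _ _ ial ibe; exists F.
have [F HF] := choice (fun p : rat * rat => Hc p.1 p.2).
pose Z tau := e * \sum_(al <- leaf_exps (w3 G) (w4 G)) \sum_(be <- leaf_exps (w5 G) (w6 G))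
    (leaf_coef (w3 G) (w4 G) al * leaf_coef (w5 G) (w6 G) be)%:~R * F (al, be) tau.
have [u Hu] : is_qseries Z.
  apply: qseries_scale; apply: qseries_sum => al ial; apply: qseries_sum => be ibe.
  by apply: qseries_scale; have [] := HF (al, be) ial ibe.
exists u => tau t0; exists (Z tau); first exact: Hu.
rewrite qpowD /Zhat -2!mulrA -[RHS]mulrA [ee _ * (_ * _)]mulrA -/e.
congr (_ * _); rewrite /Z [RHS]mulrCA; congr (_ * _).
rewrite mulr_sumr; apply: eq_big_seq => al ial.
rewrite mulr_sumr; apply: eq_big_seq => be ibe.
by rewrite mulrCA; have [_ ->] := HF (al, be) ial ibe.
Qed.

End Theta.

(** * The radial limit *)

Lemma S2_dsums (R : realType) (w w' : R[i]) (s C : R) d p (f : nat -> nat -> R) :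
  0 < s -> `|w| = 1 -> `|w'| = 1 -> disc2 s C d p f ->
  dsums (fun m n => w ^+ m * w' ^+ n * (f m n)%:C) (S2 w w' f).
Proof.
move=> s0 w1 w1' fC; rewrite -(S2_dsum s0 w1 w1' fC).
apply: (@dom2_dsums R (expR (- s)) (C * s ^+ p)); rewrite ?rate_lt1 ?rate_ge0 //.
by move=> m n; rewrite !normrM !normrX w1 w1' !expr1n !mul1r; apply: (disc2_dom2 fC).
Qed.

Lemma cvg_expR_mul (R : realType) (d : R) (f : R -> R[i]) (l : R[i]) :
  f t @[t --> 0^'+] --> (l : R[i]^o) ->
  (expR (- (2 * pi * (d * t))))%:C * f t @[t --> 0^'+] --> (l : R[i]^o).
Proof.
move=> fl; pose P t : R := expR (- (2 * pi * (d * t))).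
have P1 : (fun t => (P t)%:C : R[i]^o) @ (0 : R)^'+ --> (1 : R[i]^o).
  apply: cvg_complex; last exact: cvg_cst.
  apply: cvg_at_right_filter.
  have H : P t @[t --> (0 : R)] --> P 0.
    apply: (@continuous_cvg _ _ _ _ _ (fun t => - (2 * pi * (d * t))) expR).
      exact: continuous_expR.
    by apply: cvgN; apply: cvgMl_tmp; apply: cvgMl_tmp; exact: cvg_id.
  by rewrite /P !mulr0 oppr0 expR0 in H.
have := @cvgM R[i] R _ (at_right_proper_filter 0) (fun t => (P t)%:C) _ _ _ P1 fl.
by rewrite mul1r.
Qed.

Section Radial.
Variables (R : realType) (G : Hgraph).
Hypothesis det_W : \det (Wmx G) = 1 \/ \det (Wmx G) = -1.
Hypothesis indef_S : indefinite (Smx R G).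
Hypotheses (w3_neq : w3 G <> 1 /\ w3 G <> -1) (w4_neq : w4 G <> 1 /\ w4 G <> -1).
Hypotheses (w5_neq : w5 G <> 1 /\ w5 G <> -1) (w6_neq : w6 G <> 1 /\ w6 G <> -1).
Variables (k : nat) (k_gt0 : (0 < k)%N).

Local Notation D := (\det (Wmx G)).
Local Notation signs := [:: 1; -1 : int].
Local Notation er := (@er R).
Local Notation K := (2 * k)%N.
Local Notation sg := (sgn (HN G * Ha G)).

Let qk : k%:R != 0 :> rat. Proof. by rewrite pnatr_eq0 -lt0n. Qed.
Let KE : K%:R = 2 * k%:R :> rat. Proof. by rewrite natrM. Qed.
Let half_div (q : rat) : q / k%:R = 2 * q / K%:R.
Proof. by rewrite KE; field. Qed.
Let K_gt0 : (0 < K)%N. Proof. by rewrite muln_gt0. Qed.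
Let K_even : ~~ odd K. Proof. by rewrite mul2n odd_double. Qed.

Definition xleaf (w x e : int) : R[i] := leafsum R K w (x - e).
(** The factor sg is the sign of y in [Qform_Sform]; it reverses the leaf signs at vertex 2. *)
Definition yleaf (w y e : int) : R[i] := leafsum R K w (y - sg * e).
Definition xchar (x : int) : R[i] := er (x%:~R / k%:R).
Definition ychar (y : int) : R[i] := er (sg%:~R * y%:~R / k%:R).
(** The characters of [theta_fourier] at 2m+1 and sg (2n+1) split as e(x/K) e(x/k)^m and likewise
    for y; the factors free of m and n are collected here. *)
Definition weight (x y : int) : R[i] :=
  core R K (w1 G) (w2 G) x y * (er (x%:~R / K%:R) * er (sg%:~R * y%:~R / K%:R)).
Definition total : R[i] := \sum_(x < K) \sum_(y < K)
  Hterm R K (w1 G) (w2 G) (w3 G) (w4 G) (w5 G) (w6 G) 0 0 0 0 x%:Z y%:Z.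
Definition leaf_inv : rat := (w3 G)%:~R^-1 + (w4 G)%:~R^-1 + (w5 G)%:~R^-1 + (w6 G)%:~R^-1.

Lemma totalE : total =
  K%:R ^+ 3 * er ((sgz (w3 G) + sgz (w4 G) + sgz (w5 G) + sgz (w6 G))%:~R / 8).
Proof.
have c0 := c_neq0 det_W indef_S w3_neq w4_neq w5_neq w6_neq.
have MND := MND_lt0 det_W indef_S w3_neq w4_neq w5_neq w6_neq.
have <- := gauss_Hgraph R K_gt0 K_even (D_sqr det_W) (ca_eq G) MND c0.
apply: eq_bigr => x _; apply: eq_bigr => y _.
by rewrite /Hterm !addr0 /core.
Qed.

Lemma total_neq0 : total != 0.
Proof. by rewrite totalE mulf_neq0 ?er_neq0 // expf_neq0 // pnatr_eq0 -lt0n. Qed.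

Lemma theta_expand (t : R) s3 s4 s5 s6 (m n : nat) :
  s3 \in signs -> s4 \in signs -> s5 \in signs -> s6 \in signs ->
  let al := leaf_exp (w3 G) (w4 G) s3 s4 in let be := leaf_exp (w5 G) (w6 G) s5 s6 in
  theta_term G (((eps G)%:~R / k%:R) +i* t) al be m n * total =
  er (leaf_inv / (2 * K%:R)) * \sum_(x < K) \sum_(y < K)
    weight x y * (xleaf (w3 G) x s3 * xleaf (w4 G) x s4 * yleaf (w5 G) y s5 * yleaf (w6 G) y s6) *
    (xchar x ^+ m * ychar y ^+ n *
      (expR (- (2 * pi * t * ratr (Qform G (al + m%:R) (be + n%:R)))))%:C).
Proof.
move=> i3 i4 i5 i6 al be.
have [w30 w40 w50 w60] := weights_neq0 det_W w3_neq w4_neq w5_neq w6_neq.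
set Q := Qform _ _ _.
have sq s : s \in signs -> s ^+ 2 = 1 by rewrite !inE => /orP[] /eqP ->.
have sgsq s : s \in signs -> (sg * s) ^+ 2 = 1 by move=> /sq e; rewrite exprMn e sgn_sqr.
have thetaE : theta_term G (((eps G)%:~R / k%:R) +i* t) al be m n =
    (expR (- (2 * pi * t * ratr Q)))%:C * er ((eps G)%:~R * Q / k%:R).
  rewrite /theta_term qpowE -/Q; congr (_%:C * _); first by congr (expR (- _)); ring.
  rewrite erE; have -> : ratr ((eps G)%:~R * Q / k%:R) = ratr Q * ((eps G)%:~R / k%:R) :> R.
    by rewrite !rmorphM /= fmorphV /= ratr_nat ratr_int; ring.
  by [].
(* For sg = 1 take nu = n; for sg = -1 the reflection of be + n reverses both leaf signs and gives
   nu = -1 - n. *)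
have [nu nuE nuZ] : exists2 nu : int,
    sg%:~R * (be + n%:R) = leaf_exp (w5 G) (w6 G) (sg * s5) (sg * s6) + nu%:~R &
    2 * nu + 1 = sg * (2 * n%:Z + 1).
  have q5 : (w5 G)%:~R != 0 :> rat by rewrite intr_eq0.
  have q6 : (w6 G)%:~R != 0 :> rat by rewrite intr_eq0.
  rewrite /be /sgn; case: ifP => _.
    by exists n%:Z; rewrite ?mul1r.
  exists (- 1 - n%:Z); last by ring.
  rewrite (intrB _ (- 1) n) /leaf_exp !intrM !intrN -[n%:~R]/(n%:R); field.
  by rewrite q5 q6.
have F := theta_fourier R K_gt0 K_even (D_sqr det_W) (ca_eq G) m%:Z nu w30 w40 w50 w60
  (sq _ i3) (sq _ i4) (sgsq _ i5) (sgsq _ i6).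
rewrite thetaE -mulrA.
have -> : (eps G)%:~R * Q / k%:R = 2 * Sform (w1 G) (w2 G) (w3 G) (w4 G) (w5 G) (w6 G) D
   (leaf_exp (w3 G) (w4 G) s3 s4 + m%:Z%:~R)
   (leaf_exp (w5 G) (w6 G) (sg * s5) (sg * s6) + nu%:~R) / K%:R.
  rewrite -nuE (Qform_Sform det_W indef_S w3_neq w4_neq w5_neq w6_neq).
  exact: half_div.
rewrite /total F mulrCA; congr (_ * _).
rewrite mulr_sumr; apply: eq_bigr => x _; rewrite mulr_sumr; apply: eq_bigr => y _.
have -> : (x%:R * (2 * m%:Z + 1)%:~R + y%:R * (2 * nu + 1)%:~R) / K%:R =
   x%:Z%:~R / K%:R + sg%:~R * y%:Z%:~R / K%:R + x%:Z%:~R / k%:R * m%:R +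
   sg%:~R * y%:Z%:~R / k%:R * n%:R :> rat.
  rewrite nuZ KE intrM !intrD !intrM -[m%:~R]/(m%:R) -[n%:~R]/(n%:R).
  by rewrite -[x%:Z%:~R]/(x%:R) -[y%:Z%:~R]/(y%:R); field.
rewrite !erD -!erXn /Hterm /weight /xleaf /yleaf -/(xchar x) -/(ychar y).
set a1 := er _; set a2 := er _; set l3 := leafsum _ _ _ _; set l4 := leafsum _ _ _ _.
set l5 := leafsum _ _ _ _; set l6 := leafsum _ _ _ _; set c := core _ _ _ _ _ _.
by ring.
Qed.

Local Notation A := (`|HM G * Ha G|%:~R : R).
Local Notation B := (`|HM G * HN G|%:~R : R).
Local Notation C' := (`|HN G * Hc0 G|%:~R : R).
Definition half_inv (w : int) : R := (2 * w%:~R)^-1.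

Let A0 : 0 < A.
Proof.
rewrite ltr0z normr_gt0 mulf_neq0 //; first exact: M_neq0.
exact: a_neq0 det_W indef_S w3_neq w4_neq w5_neq w6_neq.
Qed.

Let B0 : 0 <= B. Proof. by rewrite ler0z normr_ge0. Qed.

Let C0 : 0 < C'.
Proof.
rewrite ltr0z normr_gt0 mulf_neq0 //; first exact: N_neq0.
exact: c_neq0 det_W indef_S w3_neq w4_neq w5_neq w6_neq.
Qed.

Lemma ratr_leaf_exp u v s t :
  ratr (leaf_exp u v s t) = 1 / 2 + s%:~R * half_inv u + t%:~R * half_inv v :> R.
Proof.
by rewrite /leaf_exp /half_inv !rmorphD !rmorphM /= !fmorphV !rmorphM /= !ratr_int ratr_nat rmorph1.
Qed.

Lemma gauss_Qform (t : R) al be (m n : nat) : 0 <= t ->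
  expR (- (2 * pi * t * ratr (Qform G (al + m%:R) (be + n%:R)))) =
  gauss A B C' (Num.sqrt (2 * pi * t)) (m%:R + ratr al) (n%:R + ratr be).
Proof.
move=> t0; rewrite /gauss sqr_sqrtr ?mulr_ge0 ?pi_ge0 //; congr (expR (- (_ * _))).
rewrite /Qform !rmorphD !rmorphM /= ?rmorphXn /= !rmorphD /= !ratr_int !ratr_nat.
by ring.
Qed.

Lemma xchar_norm x : `|xchar x| = 1. Proof. exact: norm_er. Qed.
Lemma ychar_norm y : `|ychar y| = 1. Proof. exact: norm_er. Qed.

Lemma dsums_shifted (w w' : R[i]) (s a b : R) : 0 < s -> 0 <= a -> 0 <= b ->
  `|w| = 1 -> `|w'| = 1 ->
  dsums (fun m n => w ^+ m * w' ^+ n * (gauss A B C' s (m%:R + a) (n%:R + b))%:C)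
    (shifted_sum A B C' w w' s a b).
Proof.
move=> s0 a0 b0 w1 w1'; have [C C1 H] := gauss_nice A0 B0 C0 0.
have N := nice_disc2 (ltW s0) C1 (nice_shift (ltW s0) C1 a0 b0 (H s s0)).
exact: S2_dsums s0 w1 w1' N.
Qed.

Definition theta_sum (tau : R[i]) : R[i] :=
  \sum_(al <- leaf_exps (w3 G) (w4 G)) \sum_(be <- leaf_exps (w5 G) (w6 G))
    (leaf_coef (w3 G) (w4 G) al * leaf_coef (w5 G) (w6 G) be)%:~R *
    dsum (theta_term G tau al be).

Definition radial_block (x y : int) (s : R) : R[i] :=
  block A B C' (xchar x) (ychar y) (half_inv (w3 G)) (half_inv (w4 G))
    (half_inv (w5 G)) (half_inv (w6 G)) (xleaf (w3 G) x) (xleaf (w4 G) x)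
    (yleaf (w5 G) y) (yleaf (w6 G) y) s.

Definition radial_limit : R[i] :=
  er (leaf_inv / (2 * K%:R)) / total * \sum_(x < K) \sum_(y < K) weight x y *
    ((xleaf (w3 G) x 1 - xleaf (w3 G) x (-1)) * (xleaf (w4 G) x 1 - xleaf (w4 G) x (-1)) *
     (yleaf (w5 G) y 1 - yleaf (w5 G) y (-1)) * (yleaf (w6 G) y 1 - yleaf (w6 G) y (-1)) *
     ((1 - xchar x)^-1 * (1 - ychar y)^-1)).

Lemma theta_sumE (t : R) : 0 < t ->
  theta_sum (((eps G)%:~R / k%:R) +i* t) =
  er (leaf_inv / (2 * K%:R)) / total *
    \sum_(x < K) \sum_(y < K) weight x y * radial_block x y (Num.sqrt (2 * pi * t)).
Proof.
move=> t0; set s := Num.sqrt _; set tau := _ +i* _.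
have s0 : 0 < s by rewrite sqrtr_gt0 !mulr_gt0 ?pi_gt0.
have [w30 w40 w50 w60] := weights_neq0 det_W w3_neq w4_neq w5_neq w6_neq.
pose T s3 s4 s5 s6 (x y : int) :=
  xleaf (w3 G) x s3 * xleaf (w4 G) x s4 * yleaf (w5 G) y s5 * yleaf (w6 G) y s6.
pose V s3 s4 s5 s6 (x y : int) := shifted_sum A B C' (xchar x) (ychar y) s
  (1 / 2 + s3%:~R * half_inv (w3 G) + s4%:~R * half_inv (w4 G))
  (1 / 2 + s5%:~R * half_inv (w5 G) + s6%:~R * half_inv (w6 G)).
pose c := er (leaf_inv / (2 * K%:R)) / total.
have term s3 s4 s5 s6 : s3 \in signs -> s4 \in signs -> s5 \in signs -> s6 \in signs ->
    dsum (theta_term G tau (leaf_exp (w3 G) (w4 G) s3 s4) (leaf_exp (w5 G) (w6 G) s5 s6)) =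
    c * \sum_(x < K) \sum_(y < K) weight x y * T s3 s4 s5 s6 x y * V s3 s4 s5 s6 x y.
  move=> i3 i4 i5 i6; apply: dsum_eq.
  have a0 := leaf_exp_ge0 w30 w40 w3_neq w4_neq i3 i4.
  have b0 := leaf_exp_ge0 w50 w60 w5_neq w6_neq i5 i6.
  have -> : theta_term G tau (leaf_exp (w3 G) (w4 G) s3 s4) (leaf_exp (w5 G) (w6 G) s5 s6) =
      (fun m n => c * \sum_(x < K) \sum_(y < K) weight x y * T s3 s4 s5 s6 x y *
        (xchar x ^+ m * ychar y ^+ n * (gauss A B C' s
          (m%:R + (1 / 2 + s3%:~R * half_inv (w3 G) + s4%:~R * half_inv (w4 G)))
          (n%:R + (1 / 2 + s5%:~R * half_inv (w5 G) + s6%:~R * half_inv (w6 G))))%:C)).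
    apply/funext => m; apply/funext => n; apply: (mulIf total_neq0).
    rewrite (@theta_expand t _ _ _ _ m n i3 i4 i5 i6).
    rewrite (gauss_Qform _ _ _ _ (ltW t0)) -/s !ratr_leaf_exp /c [RHS]mulrAC divfK ?total_neq0 //.
  apply: dsums_scale; apply: dsums_sum => x; apply: dsums_sum => y; apply: dsums_scale.
  apply: dsums_shifted; rewrite ?xchar_norm ?ychar_norm //.
    by rewrite -ratr_leaf_exp ler0q.
  by rewrite -ratr_leaf_exp ler0q.
rewrite /theta_sum.
pose f al be := dsum (theta_term G tau al be).
transitivity (\sum_(s3 <- signs) \sum_(s4 <- signs) (s3 * s4)%:~R *
    (\sum_(s5 <- signs) \sum_(s6 <- signs) (s5 * s6)%:~R *
      f (leaf_exp (w3 G) (w4 G) s3 s4) (leaf_exp (w5 G) (w6 G) s5 s6))).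
  rewrite -(leaf_sum (w3 G) (w4 G) (fun al =>
    \sum_(s5 <- signs) \sum_(s6 <- signs) (s5 * s6)%:~R * f al (leaf_exp (w5 G) (w6 G) s5 s6))).
  apply: eq_bigr => al _; rewrite -(leaf_sum (w5 G) (w6 G) (f al)) mulr_sumr.
  by apply: eq_bigr => be _; rewrite rmorphM /= mulrA.
transitivity (\sum_(s3 <- signs) \sum_(s4 <- signs) \sum_(s5 <- signs) \sum_(s6 <- signs)
   c * \sum_(x < K) \sum_(y < K) weight x y *
    ((s3 * s4 * s5 * s6)%:~R * T s3 s4 s5 s6 x y * V s3 s4 s5 s6 x y)).
  apply: eq_big_seq => s3 i3; apply: eq_big_seq => s4 i4; rewrite mulr_sumr.
  apply: eq_big_seq => s5 i5; rewrite mulr_sumr; apply: eq_big_seq => s6 i6.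
  have swap (p q r z : R[i]) : p * (q * (r * z)) = r * (p * (q * z)) by ring.
  rewrite /f (term _ _ _ _ i3 i4 i5 i6) swap; congr (_ * _).
  rewrite !mulr_sumr; apply: eq_bigr => x _; rewrite !mulr_sumr; apply: eq_bigr => y _.
  rewrite !intrM; move: (weight _ _) (T _ _ _ _ _ _) (V _ _ _ _ _ _) => p q r; ring.
(* The constant is pulled out of the four sign sums, which are then moved inside the sums over x and
   y. *)
under eq_bigr => s3 _ do under eq_bigr => s4 _ do under eq_bigr => s5 _ do
  rewrite -mulr_sumr.
under eq_bigr => s3 _ do under eq_bigr => s4 _ do rewrite -mulr_sumr.
under eq_bigr => s3 _ do rewrite -mulr_sumr.
rewrite -mulr_sumr; congr (_ * _).
under eq_bigr => s3 _ do under eq_bigr => s4 _ do under eq_bigr => s5 _ do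
  rewrite exchange_big.
under eq_bigr => s3 _ do under eq_bigr => s4 _ do rewrite exchange_big.
under eq_bigr => s3 _ do rewrite exchange_big.
rewrite exchange_big; apply: eq_bigr => x _.
under eq_bigr => s3 _ do under eq_bigr => s4 _ do under eq_bigr => s5 _ do
  rewrite exchange_big.
under eq_bigr => s3 _ do under eq_bigr => s4 _ do rewrite exchange_big.
under eq_bigr => s3 _ do rewrite exchange_big.
rewrite exchange_big; apply: eq_bigr => y _.
rewrite /radial_block /block mulr_sumr; apply: eq_bigr => s3 _.
rewrite mulr_sumr; apply: eq_bigr => s4 _; rewrite mulr_sumr; apply: eq_bigr => s5 _.
by rewrite mulr_sumr; apply: eq_bigr => s6 _.
Qed.

(** When k divides x, the numbers x + e and -(x - e) differ by 2 x, a multiple of K, and a leaf sum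
    is even and K-periodic. This supplies the sign independence that [block_limit] requires when a
    character is 1. *)
Lemma leafsum_reflect (w x e : int) : (k%:Z %| x)%Z ->
  leafsum R K w (x - e) = leafsum R K w (x + e).
Proof.
move=> /dvdzP[j xE].
have -> : x + e = - (x - e) + K%:Z * j by rewrite xE PoszM; ring.
by rewrite leafsum_periodic // leafsumN.
Qed.

Lemma xleaf_const w x : xchar x = 1 -> xleaf w x (-1) = xleaf w x 1.
Proof.
move=> x1; apply: leafsum_reflect.
by apply: contra_eqT x1; apply: er_neq1.
Qed.

Lemma yleaf_const w y : ychar y = 1 -> yleaf w y (-1) = yleaf w y 1.
Proof.
rewrite /ychar -intrM => y1; rewrite /yleaf mulrN mulr1; apply: leafsum_reflect.
have : (k%:Z %| sg * y)%Z by apply: contra_eqT y1; apply: er_neq1.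
by move=> /(dvdz_mull sg); rewrite mulrA -expr2 sgn_sqr mul1r.
Qed.

Lemma half_inv_sum_le (u v : int) : u != 0 -> v != 0 -> u <> 1 /\ u <> -1 -> v <> 1 /\ v <> -1 ->
  `|half_inv u| + `|half_inv v| <= 1 / 2.
Proof.
move=> u0 v0 u1 v1.
have hE w : half_inv w = ratr (2 * w%:~R)^-1.
  by rewrite fmorphV rmorphM /= ratr_int ratr_nat.
have := lerD (half_inv_le u0 u1) (half_inv_le v0 v1).
rewrite -(ler_rat R) rmorphD /= !hE !ratr_norm => /le_trans; apply.
rewrite rmorphD /= rmorphM /= fmorphV /= ratr_nat rmorph1; lra.
Qed.

Lemma theta_sum_Os : Os (fun s => er (leaf_inv / (2 * K%:R)) / total *
    (\sum_(x < K) \sum_(y < K) weight x y * radial_block x y s) - radial_limit).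
Proof.
have [w30 w40 w50 w60] := weights_neq0 det_W w3_neq w4_neq w5_neq w6_neq.
pose lim (x y : int) := (xleaf (w3 G) x 1 - xleaf (w3 G) x (-1)) *
  (xleaf (w4 G) x 1 - xleaf (w4 G) x (-1)) * (yleaf (w5 G) y 1 - yleaf (w5 G) y (-1)) *
  (yleaf (w6 G) y 1 - yleaf (w6 G) y (-1)) * ((1 - xchar x)^-1 * (1 - ychar y)^-1).
have O (x y : int) : Os (fun s => radial_block x y s - lim x y).
  have h34 := half_inv_sum_le w30 w40 w3_neq w4_neq.
  have h56 := half_inv_sum_le w50 w60 w5_neq w6_neq.
  apply: (@block_limit R A B C' (xchar x) (ychar y) _ _ _ _ (xleaf (w3 G) x)
    (xleaf (w4 G) x) (yleaf (w5 G) y) (yleaf (w6 G) y) A0 B0 C0 (xchar_norm x)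
    (ychar_norm y) h34 h56).
    by move=> x1; rewrite !xleaf_const.
  by move=> y1; rewrite !yleaf_const.
apply: (@Os_eq _ (fun s => er (leaf_inv / (2 * K%:R)) / total *
    \sum_(x < K) \sum_(y < K) weight x y * (radial_block x y s - lim x y))).
  move=> s _; rewrite /radial_limit -mulrBr; congr (_ * _).
  rewrite -sumrB; apply: eq_bigr => x _; rewrite -sumrB; apply: eq_bigr => y _.
  by rewrite -mulrBr.
by apply: OsZ; apply: Os_sum => x _; apply: Os_sum => y _; apply: OsZ.
Qed.

Lemma theta_sum_cvg :
  theta_sum (((eps G)%:~R / k%:R) +i* t) @[t --> (0 : R)^'+] --> (radial_limit : R[i]^o).
Proof.
have [C HC] := theta_sum_Os.
pose s t : R := Num.sqrt (2 * pi * t).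
apply: (@squeeze_norm R R _ _ _ (fun=> radial_limit) radial_limit (fun t => C * s t)).
- near=> t.
  have t0 : 0 < t by near: t; exact: nbhs_right_gt.
  have t1 : t < (2 * pi)^-1.
    by near: t; apply: nbhs_right_lt; rewrite invr_gt0 mulr_gt0 ?pi_gt0.
  have p0 : 0 < 2 * pi :> R by rewrite mulr_gt0 ?pi_gt0.
  rewrite theta_sumE //; apply: HC; rewrite sqrtr_gt0 mulr_gt0 //=.
  rewrite -[leRHS]sqrtr1 ler_wsqrtr // mulrC -ler_pdivlMr // div1r ltW //.
- apply: cvg_at_right_filter.
  have H : C * s t @[t --> (0 : R)] --> C * s 0.
    apply: cvgMl_tmp; apply: (@continuous_cvg _ _ _ _ _ (fun t => 2 * pi * t) Num.sqrt).
      exact: sqrt_continuous.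
    by apply: cvgMl_tmp; exact: cvg_id.
  by rewrite /s mulr0 sqrtr0 mulr0 in H.
- exact: (@cvg_cst (R[i]^o)).
Unshelve. all: by end_near. Qed.

Lemma Zhat_cvg :
  Zhat G (((eps G)%:~R / k%:R) +i* t) @[t --> (0 : R)^'+] -->
  (er (delta R G * (eps G)%:~R / k%:R) * ee ((sigmaW' R G)%:~R / 8) * sg%:~R *
   radial_limit : R[i]^o).
Proof.
have er_prod (d : rat) (n : int) : er (d * n%:~R / k%:R) =
    cos (2 * pi * (ratr d * (n%:~R / k%:R))) +i* sin (2 * pi * (ratr d * (n%:~R / k%:R))).
  by rewrite erE !rmorphM /= fmorphV /= ratr_nat ratr_int !mulrA.
have -> : (fun t => Zhat G (((eps G)%:~R / k%:R) +i* t)) =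
    (fun t => (expR (- (2 * pi * (ratr (delta R G) * t))))%:C *
      (er (delta R G * (eps G)%:~R / k%:R) * ee ((sigmaW' R G)%:~R / 8) * sg%:~R *
       theta_sum (((eps G)%:~R / k%:R) +i* t))).
  apply/funext => t; rewrite /Zhat qpowE -/(theta_sum _).
  by rewrite -er_prod !mulrA.
apply: cvg_expR_mul.
exact: (@cvgMl_tmp R[i] R _ (at_right_proper_filter 0)
  (fun t => theta_sum (((eps G)%:~R / k%:R) +i* t) : R[i]^o) _ _ theta_sum_cvg).
Qed.

End Radial.

(** * The WRT invariant *)

Lemma zetaE (R : realType) (n : nat) : zeta R n = er R n%:R^-1.
Proof. by rewrite er.unlock /zeta fmorphV /= ratr_nat. Qed.

Lemma prod_sum4 (V : comPzRingType) (n : nat) (f g h i : 'I_n -> V) :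
  (\sum_c f c) * (\sum_d g d) * (\sum_e h e) * (\sum_j i j) =
  \sum_c \sum_d \sum_e \sum_j f c * g d * h e * i j.
Proof.
under [RHS]eq_bigr => c _ do under eq_bigr => d _ do under eq_bigr => e _ do
  rewrite -mulr_sumr.
under [RHS]eq_bigr => c _ do under eq_bigr => d _ do rewrite -mulr_suml -mulr_sumr.
under [RHS]eq_bigr => c _ do rewrite -2!mulr_suml -mulr_sumr.
by rewrite -3!mulr_suml.
Qed.

Section WRTSum.
Variables (R : realType) (G : Hgraph) (k : nat) (k_gt0 : (0 < k)%N).
Local Notation er := (@er R).
Local Notation K := (2 * k)%N.
Local Notation leafsum := (leafsum R K).

Let qk : k%:R != 0 :> rat. Proof. by rewrite pnatr_eq0 -lt0n. Qed.
Let KE : K%:R = 2 * k%:R :> rat. Proof. by rewrite natrM. Qed.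
Let kE : (4 * k)%:R = 2 * K%:R :> rat. Proof. by rewrite !natrM; ring. Qed.

Definition dsine (n : int) : R[i] := er (n%:~R / K%:R) - er (- n%:~R / K%:R).
Definition leafdiff (w x : int) : R[i] := leafsum w (x + 1) - leafsum w (x - 1).

(** The WRT sum with the leaves summed out, over all labels of vertices 1 and 2: a label divisible
    by k has sine 0, and 0^-1 = 0 removes its term. *)
Definition HsumWRT : R[i] := \sum_(x < K) \sum_(y < K)
  core R K (w1 G) (w2 G) x%:Z y%:Z * ((dsine x%:Z)^-1 * (dsine y%:Z)^-1) *
  (leafdiff (w3 G) x%:Z * leafdiff (w4 G) x%:Z * leafdiff (w5 G) y%:Z * leafdiff (w6 G) y%:Z).

Lemma dsine_eq0 (n : int) : (k%:Z %| n)%Z -> dsine n = 0.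
Proof.
move=> /dvdzP[j ->]; apply/eqP; rewrite subr_eq0; apply/eqP.
by apply: (er_congr j); rewrite KE intrM -[k%:Z%:~R]/(k%:R); field.
Qed.

Lemma dsineN (n : int) : dsine (- n) = - dsine n.
Proof. by rewrite /dsine !intrN opprK opprB. Qed.

Lemma zeta_dsine (n : int) : zeta R K ^ n - zeta R K ^ (- n) = dsine n.
Proof. by rewrite zetaE !erXz /dsine intrN mulrC (mulrC _ (- _)). Qed.

(** The sine factor of a vertex of degree 1 is a difference of two characters, each of which shifts
    the neighbour's label by one. *)
Lemma leafdiffE (w x : int) : leafdiff w x =
  \sum_(z < K) er ((w%:~R * z%:R ^+ 2 + 2 * z%:R * x%:~R) / (2 * K%:R)) * dsine z%:Z.
Proof.
rewrite /leafdiff -sumrB; apply: eq_bigr => z _; rewrite mulrBr -!erD.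
by congr (er _ - er _); rewrite intrD ?intrN -[z%:Z%:~R]/(z%:R) KE; field.
Qed.

Lemma WRT_sum :
  \sum_(l : {ffun 'I_6 -> 'I_K} | [forall i, ~~ (k %| l i)%N])
    (let lv : 'cV[int]_6 := \col_i (l i : nat)%:Z in
     zeta R (4 * k) ^ ((lv^T *m Wmx G *m lv) 0 0) *
     \prod_(i < 6) (zeta R K ^ (l i : nat)%:Z - zeta R K ^ (- (l i : nat)%:Z))
         ^ (2 - (Hdeg i)%:Z)) = HsumWRT.
Proof.
pose Q (a b c d e f : int) := w1 G * a ^+ 2 + w2 G * b ^+ 2 + 2 * a * b +
  (w3 G * c ^+ 2 + 2 * c * a) + (w4 G * d ^+ 2 + 2 * d * a) +
  (w5 G * e ^+ 2 + 2 * e * b) + (w6 G * f ^+ 2 + 2 * f * b).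
pose H (a b c d e f : 'I_K) := er ((Q a%:Z b%:Z c%:Z d%:Z e%:Z f%:Z)%:~R / (2 * K%:R)) *
  ((dsine a%:Z)^-1 * (dsine b%:Z)^-1 * dsine c%:Z * dsine d%:Z * dsine e%:Z * dsine f%:Z).
rewrite big_mkcond (sum_ffun6 (H := H)); last first.
  move=> l /=; rewrite (@quad_form_Wmx G _ (fun i => (l (inord i) : nat)%:Z)); last first.
    by move=> i; rewrite mxE inord_val.
  under eq_bigr => i _ do rewrite zeta_dsine HdegE.
  rewrite zetaE erXz kE /H.
  have -> : \prod_(i < 6) dsine (l i) ^ (2 - (if (i < 2)%N then 3 else 1)%:Z) =
      (dsine (l (inord 0)))^-1 * (dsine (l (inord 1)))^-1 * dsine (l (inord 2)) *
      dsine (l (inord 3)) * dsine (l (inord 4)) * dsine (l (inord 5)).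
    have E (i : 'I_6) : dsine (l i) ^ (2 - (if (i < 2)%N then 3 else 1)%:Z) =
        (fun j : nat => dsine (l (inord j)) ^ (2 - (if (j < 2)%N then 3 else 1)%:Z)) i.
      by rewrite /= inord_val.
    rewrite (eq_bigr _ (fun i _ => E i)) -(big_mkord xpredT
      (fun j => dsine (l (inord j)) ^ (2 - (if (j < 2)%N then 3 else 1)%:Z))).
    by rewrite unlock /= mulr1 !mulrA.
  rewrite [(2 * _)^-1 * _]mulrC -/(Q _ _ _ _ _ _).
  (* A label vector excluded from the sum has an entry of sine 0, so its term vanishes whether that
     sine stands in the product or is inverted. *)
  case: ifP => // /negbT nl; case: (pickP (fun i => k %| l i)%N) => [i ki|none]; last first.
    by case/negP: nl; apply/forallP => i; rewrite none.
  have : dsine (l (inord i)) = 0 by apply: dsine_eq0; rewrite inord_val dvdzE.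
  move: (ltn_ord i); case: (i : nat) => [|[|[|[|[|[|//]]]]]] _ E;
    by rewrite E ?invr0 !(mulr0, mul0r).
apply: eq_bigr => x _; apply: eq_bigr => y _; rewrite !leafdiffE prod_sum4 mulr_sumr.
apply: eq_bigr => c _; rewrite mulr_sumr; apply: eq_bigr => d _.
rewrite mulr_sumr; apply: eq_bigr => e _; rewrite mulr_sumr; apply: eq_bigr => f _.
rewrite /H /core /quadphase.
have -> : (Q x%:Z y%:Z c%:Z d%:Z e%:Z f%:Z)%:~R / (2 * K%:R) =
    (w1 G)%:~R * x%:Z%:~R ^+ 2 / (2 * K%:R) + (w2 G)%:~R * y%:Z%:~R ^+ 2 / (2 * K%:R) +
    x%:Z%:~R * y%:Z%:~R / K%:R +
    ((w3 G)%:~R * c%:R ^+ 2 + 2 * c%:R * x%:Z%:~R) / (2 * K%:R) +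
    ((w4 G)%:~R * d%:R ^+ 2 + 2 * d%:R * x%:Z%:~R) / (2 * K%:R) +
    ((w5 G)%:~R * e%:R ^+ 2 + 2 * e%:R * y%:Z%:~R) / (2 * K%:R) +
    ((w6 G)%:~R * f%:R ^+ 2 + 2 * f%:R * y%:Z%:~R) / (2 * K%:R) :> rat.
  rewrite /Q !intrD !intrM -[x%:Z%:~R]/(x%:R) -[y%:Z%:~R]/(y%:R) -[c%:Z%:~R]/(c%:R).
  rewrite -[d%:Z%:~R]/(d%:R) -[e%:Z%:~R]/(e%:R) -[f%:Z%:~R]/(f%:R) KE.
  by field.
rewrite !erD.
move: (dsine _)^-1 (dsine _)^-1 => u v.
set e1 := er _; set e2 := er _; set e3 := er _; set e4 := er _; set e5 := er _.
set e6 := er _; set e7 := er _; ring.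
Qed.

End WRTSum.

(** * Comparison of constants *)

Section FinalFormula.
Variables (R : realType) (G : Hgraph).
Hypothesis det_W : \det (Wmx G) = 1 \/ \det (Wmx G) = -1.
Hypothesis indef_S : indefinite (Smx R G).
Hypotheses (w3_neq : w3 G <> 1 /\ w3 G <> -1) (w4_neq : w4 G <> 1 /\ w4 G <> -1).
Hypotheses (w5_neq : w5 G <> 1 /\ w5 G <> -1) (w6_neq : w6 G <> 1 /\ w6 G <> -1).
Variables (k : nat) (k_gt0 : (0 < k)%N).
Local Notation er := (@er R).
Local Notation K := (2 * k)%N.
Local Notation sg := (sgn (HN G * Ha G)).

Let qk : k%:R != 0 :> rat. Proof. by rewrite pnatr_eq0 -lt0n. Qed.
Let KE : K%:R = 2 * k%:R :> rat. Proof. by rewrite natrM. Qed.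

(* When k divides n both sides vanish, since 0^-1 = 0. *)
Lemma dsine_inv (n : int) : er (n%:~R / K%:R) * (1 - er (n%:~R / k%:R))^-1 = - (dsine R k n)^-1.
Proof.
have -> : n%:~R / k%:R = n%:~R / K%:R + n%:~R / K%:R :> rat by rewrite KE; field.
have -> : dsine R k n = - (er (n%:~R / K%:R))^-1 * (1 - er (n%:~R / K%:R + n%:~R / K%:R)).
  rewrite /dsine (mulNr n%:~R) erN erD; have := @er_neq0 R (n%:~R / K%:R).
  by move: (er _) => u u0; field.
by rewrite invfM invrN invrK mulNr opprK.
Qed.

Lemma sgn_cases (x : int) : sgn x = 1 \/ sgn x = -1.
Proof. by rewrite /sgn; case: ifP; [left|right]. Qed.

(** All signs pair off except one sg, which comes from the oddness of the sine at sg y; it cancels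
    the prefactor sgn(N a) of the theta function. *)
Lemma radial_limitE : radial_limit R G k =
  er (leaf_inv G / (2 * K%:R)) / total R G k * (sg%:~R * HsumWRT R G k).
Proof.
rewrite /radial_limit /HsumWRT; congr (_ * _).
rewrite mulr_sumr; apply: eq_bigr => x _; rewrite mulr_sumr; apply: eq_bigr => y _.
rewrite /weight /xchar /ychar.
have dx := dsine_inv x%:Z; have dy := dsine_inv (sg * y%:Z); rewrite intrM in dy.
set c := core _ _ _ _ _ _.
have xd w : xleaf R k w x%:Z 1 - xleaf R k w x%:Z (-1) = - leafdiff R k w x%:Z.
  by rewrite /xleaf /leafdiff !opprB ?opprK.
have yd w : yleaf R G k w y%:Z 1 - yleaf R G k w y%:Z (-1) = - sg%:~R * leafdiff R k w y%:Z.
  rewrite /yleaf /leafdiff; case: (sgn_cases (HN G * Ha G)) => ->.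
    by rewrite mulr1z !mul1r opprK mulN1r opprB.
  by rewrite mulrN1z !mulN1r !opprK mul1r.
have dyE : (dsine R k (sg * y%:Z))^-1 = sg%:~R * (dsine R k y%:Z)^-1.
  by case: (sgn_cases (HN G * Ha G)) => ->;
    rewrite ?mul1r ?mulN1r ?dsineN ?invrN ?mul1r ?rmorphN ?mulN1r.
rewrite !xd !yd; rewrite dyE in dy.
have s2 : sg%:~R * sg%:~R = 1 :> R[i] by rewrite -intrM -expr2 sgn_sqr.
move: dx dy (leafdiff R k (w3 G) x%:Z) (leafdiff R k (w4 G) x%:Z)
  (leafdiff R k (w5 G) y%:Z) (leafdiff R k (w6 G) y%:Z) s2 => dx dy l3 l4 l5 l6 s2.
transitivity (c * (er (x%:Z%:~R / K%:R) * (1 - er (x%:Z%:~R / k%:R))^-1) *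
  (er (sg%:~R * y%:Z%:~R / K%:R) * (1 - er (sg%:~R * y%:Z%:~R / k%:R))^-1) *
  (l3 * l4 * l5 * l6) * (sg%:~R * sg%:~R)).
  by ring.
rewrite dx dy s2; ring.
Qed.

Lemma ee_rat (r : rat) : ee (ratr r) = er r. Proof. by rewrite er.unlock. Qed.

(** The leaf signs in the phase of [total] match sigma'_W + sigma_W as sigma_S = 0, its modulus K^3
    is the sixth power of sqrt(2k), and the sum of the 1/w_i in [delta] cancels the phase of
    [leaf_inv]. *)
Lemma WRT_radial_limit : WRT R G k = 1 / (2 * (zeta R K - (zeta R K)^-1)) *
  (er (delta R G * (eps G)%:~R / k%:R) * ee ((sigmaW' R G)%:~R / 8) * sg%:~R * radial_limit R G k).
Proof.
have [w30 w40 w50 w60] := weights_neq0 det_W w3_neq w4_neq w5_neq w6_neq.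
have t0 := total_neq0 det_W indef_S w3_neq w4_neq w5_neq w6_neq k_gt0.
rewrite /WRT (WRT_sum R G k_gt0) radial_limitE zetaE erXz.
have -> : - (sigmaW R G)%:~R / 8 = ratr (- (sigmaW R G)%:~R / 8) :> R[i].
  by rewrite rmorphM /= fmorphV rmorphN /= ratr_int ratr_nat.
have -> : (sigmaW' R G)%:~R / 8 = ratr ((sigmaW' R G)%:~R / 8) :> R[i].
  by rewrite rmorphM /= fmorphV /= ratr_int ratr_nat.
rewrite !ee_rat.
have -> : (Num.sqrt (2 * k%:R : R))%:C ^+ 6 = K%:R ^+ 3 :> R[i].
  rewrite (exprM _ 2 3) -rmorphXn /= sqr_sqrtr ?mulr_ge0 ?ler0n //.
  by rewrite -(natrM R 2 k) -[_%:C]/(real_complex R K%:R) rmorph_nat.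
have K0 : K%:R ^+ 3 != 0 :> R[i] by rewrite expf_neq0 // pnatr_eq0 -lt0n muln_gt0.
have s2 : sg%:~R * sg%:~R = 1 :> R[i] by rewrite -intrM -expr2 sgn_sqr.
rewrite (totalE det_W indef_S w3_neq w4_neq w5_neq w6_neq k_gt0).
set Z := zeta _ _ - _; set S := HsumWRT _ _ _; set s := sg%:~R in s2 *.
set T := sgz _ + _ + _ + _.
have sig : (sigmaW' R G)%:~R = - (sigmaW R G)%:~R + T%:~R :> rat.
  rewrite /sigmaW' (sigmaS_eq0 det_W indef_S w3_neq w4_neq w5_neq w6_neq) subr0.
  by rewrite /T !sgn_sgz // -!addrA intrD intrN.
have del : delta R G * (eps G)%:~R / k%:R =
    ((4 * k)%:R)^-1 * (3 * sigmaW R G - \sum_i Hweight G i)%:~R - leaf_inv G / (2 * K%:R) :> rat.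
  have e2 : (eps G)%:~R * (eps G)%:~R = 1 :> rat by rewrite -intrM -expr2 eps_sqr.
  rewrite /delta -/(leaf_inv G); move: (eps G)%:~R e2 (_ - _)%:~R (leaf_inv G) => e e2 m l.
  transitivity (e * e * ((m - l) / 4 / k%:R)); first by ring.
  by rewrite e2 KE natrM; field.
have sig8 : er ((sigmaW' R G)%:~R / 8) = er (- (sigmaW R G)%:~R / 8) * er (T%:~R / 8).
  by rewrite sig mulrDl erD.
rewrite sig8 del erD erN div1r.
have -> : (2 * K%:R ^+ 3 * Z)^-1 = 2^-1 * (K%:R ^+ 3)^-1 * Z^-1 by rewrite !invfM.
have -> : (2 * Z)^-1 = 2^-1 * Z^-1 by rewrite invfM.
have := @er_neq0 R (T%:~R / 8); have := @er_neq0 R (leaf_inv G / (2 * K%:R)).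
move: (er (_ / 8)) (er (_^-1 * _)) (er (leaf_inv G / _)) (er (T%:~R / 8)) => p q r u r0 u0.
(* The inverse of Z is kept as an arbitrary scalar, so that k = 1, where Z = 0, needs no separate
   case. *)
move: (K%:R ^+ 3) K0 Z^-1 => K3 K30 z.
transitivity (p * q * (2^-1 * K3^-1 * z) * S * (s * s)); first by rewrite s2 mulr1.
by field; rewrite r0 u0 K30.
Qed.

End FinalFormula.

Theorem theorem1p1 (R : realType) (G : Hgraph)
    (det_W : \det (Wmx G) = 1 \/ \det (Wmx G) = -1)
    (indef_S : indefinite (Smx R G))
    (w3_neq : w3 G <> 1 /\ w3 G <> -1) (w4_neq : w4 G <> 1 /\ w4 G <> -1)
    (w5_neq : w5 G <> 1 /\ w5 G <> -1) (w6_neq : w6 G <> 1 /\ w6 G <> -1) :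
  [/\ forall (tau : R[i]) (al be : rat), 0 < complex.Im tau ->
        al \in leaf_exps (w3 G) (w4 G) -> be \in leaf_exps (w5 G) (w6 G) ->
        dsummable (theta_term G tau al be),
      exists c : rat, in_qC c (@Zhat R G)
    & forall k : nat, (0 < k)%N ->
        exists2 L : R[i],
          Zhat G (((eps G)%:~R / k%:R) +i* t) @[t --> (0 : R)^'+]
            --> (L : R[i]^o) &
          WRT R G k = 1 / (2 * (zeta R (2 * k) - (zeta R (2 * k))^-1)) * L ].
Proof.
split.
- exact: theta_summable det_W indef_S w3_neq w4_neq w5_neq w6_neq.
- exact: Zhat_in_qC det_W indef_S w3_neq w4_neq w5_neq w6_neq.
move=> k k_gt0; exists (er R (delta R G * (eps G)%:~R / k%:R) * ee ((sigmaW' R G)%:~R / 8) *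
    (sgn (HN G * Ha G))%:~R * radial_limit R G k).
  have H := Zhat_cvg det_W indef_S w3_neq w4_neq w5_neq w6_neq k_gt0.
  exact: H.
have H := WRT_radial_limit det_W indef_S w3_neq w4_neq w5_neq w6_neq k_gt0.
exact: H.
Qed.
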